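(* Let $m\ge 1$, let $\mathcal{A}_m=\mathbb{Z}[x]/(x^m)$, graded so that $x^i$ has degree $i$, and let $P_n$ be the $n$-gon. Let $g\ge 1$ be an integer. (Odd) For $n=2g+1$: $$\operatorname{Tor}\bigl(H^{*,*}_{\mathcal{A}_m}(P_{n})\bigr)=H^{n-2,m}_{\mathcal{A}_m}(P_{n})\oplus H^{n-4,2m}_{\mathcal{A}_m}(P_{n})\oplus\cdots\oplus H^{1,gm}_{\mathcal{A}_m}(P_{n}),$$ with each summand isomorphic to $\mathbb{Z}_m$, and the Poincaré polynomial of $H^{*,*}_{\mathcal{A}_m}(P_n)$ equals $$(q+\cdots+q^{m-1})^n+(q+\cdots+q^{m-1})\Bigl(t^{n-2}+(t^{n-3}+t^{n-4})q^m+\cdots+(t^2+t)q^{m(g-1)}\Bigr),$$ i.e. the last bracket is $t^{n-2}+\sum_{i=1}^{g-1}(t^{n-1-2i}+t^{n-2-2i})q^{im}$. (Even) For $n=2g+2$: $$\operatorname{Tor}\bigl(H^{*,*}_{\mathcal{A}_m}(P_{n})\bigr)=H^{n-2,m}_{\mathcal{A}_m}(P_{n})\oplus H^{n-4,2m}_{\mathcal{A}_m}(P_{n})\oplus\cdots\oplus H^{2,gm}_{\mathcal{A}_m}(P_{n}),$$ with each summand isomorphic to $\mathbb{Z}_m$, and the Poincaré polynomial of $H^{*,*}_{\mathcal{A}_m}(P_n)$ equals $$(q+\cdots+q^{m-1})^n+q^{m(n/2-1)}(q+\cdots+q^{m-1})+(q+\cdots+q^{m-1})\Bigl(t^{n-2}+(t^{n-3}+t^{n-4})q^m+\cdots+(t^3+t^2)q^{m(g-1)}+t\,q^{mg}\Bigr),$$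 i.e. the last bracket is $t^{n-2}+\sum_{i=1}^{g-1}(t^{n-1-2i}+t^{n-2-2i})q^{im}+t\,q^{mg}$.
   Context: $\mathbb{Z}_m=\mathbb{Z}/m\mathbb{Z}$; $\operatorname{Tor}$ of an abelian group is its torsion subgroup; the Poincaré polynomial of a bigraded abelian group $H^{*,*}$ is $\sum_{i,j}\operatorname{rank}(H^{i,j})t^iq^j$. For $m=1$, $q+\cdots+q^{m-1}$ is the empty sum $0$. **Graph cohomology of a polygon over a commutative ring $\mathcal{A}$.** Tensor products are over $\mathbb{Z}$. $P_n$ is the cycle with $n$ vertices and $n$ edges; $E$ is its edge set. For $s\subset E$ let $[P_n:s]$ be the subgraph with all vertices and edge set $s$, and $k(s)$ its number of connected components. Put $\Phi(s)=\mathcal{A}^{\otimes k(s)}$, one tensor factor attached to each component. For $e\in E\setminus s$ define $\Phi(s\subset s\cup e):\Phi(s)\to\Phi(s\cup e)$ as follows: if $e$ joins two different components of $[P_n:s]$, the map multiplies the corresponding two factors (the product is attached to the merged component) and leaves the others unchanged; if both endpoints of $e$ lie in the same component of $[P_n:s]$, the map is the identity. Set $C^i=\bigoplus_{|s|=i}\Phi(s)$ with differential which on $\Phi(s)$ is $d=\sum_{e\notin s}(-1)^{t(s,e)}\Phi(s\subset s\cup e)$, where $E$ is given a fixed linear ordering and $t(s,e)$ is the number of elements of $s$ smaller than $e$. The $i$-th cohomology is $H^i_{\mathcal{A}}(P_n)$. When $\mathcal{A}$ is graded, the complex is graded by total degree, which $d$ preserves, and $H^{i,j}_{\mathcal{A}}(P_n)$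 is the part of internal degree $j$. *)

(* Defs.v *)
From HB Require Import structures.
From mathcomp Require Import all_boot all_algebra.
From mathcomp Require Import ring_quotient boolp.
From mathcomp Require classical_sets.

Set Implicit Arguments.
Unset Strict Implicit.
Unset Printing Implicit Defensive.

Import GRing.Theory.
Local Open Scope ring_scope.

(* Z[x]/(x^m), for 0 < m.  The library's {poly %/ h} is the quotient by the
   monic polynomial h as soon as h is not constant; hence m = 0 is junk. *)
Definition truncpoly (m : nat) : comNzRingType := {poly %/ ('X^m : {poly int})}.

Definition tX (m : nat) : truncpoly m := 'qX.

Definition tcoef (m : nat) (u : truncpoly m) (i : nat) : int :=
  ((u : {poly %/ ('X^m : {poly int})}) : {poly int})`_i.

Section TruncPoly.
Variable m : nat.

Lemma tcoefD (u v : truncpoly m) i : tcoef (u + v) i = tcoef u i + tcoef v i.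
Proof. exact: coefD. Qed.

Lemma tcoef_is_additive i : zmod_morphism (fun u : truncpoly m => tcoef u i).
Proof. by move=> u v; exact: coefB. Qed.

Lemma tcoefMz (u : truncpoly m) z i : tcoef (u *~ z) i = tcoef u i *~ z.
Proof.
pose f : {additive truncpoly m -> int} := HB.pack (fun u => tcoef u i)
  (GRing.isZmodMorphism.Build _ _ _ (tcoef_is_additive i)).
exact: (raddfMz f).
Qed.

Lemma tcoef_sum I (r : seq I) (u : I -> truncpoly m) i :
  tcoef (\sum_(k <- r) u k) i = \sum_(k <- r) tcoef (u k) i.
Proof.
pose f : {additive truncpoly m -> int} := HB.pack (fun u => tcoef u i)
  (GRing.isZmodMorphism.Build _ _ _ (tcoef_is_additive i)).
exact: (raddf_sum f).
Qed.

Hypothesis m_gt0 : (0 < m)%N.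

Lemma mk_monicXm : mk_monic ('X^m : {poly int}) = 'X^m.
Proof. by rewrite /mk_monic size_polyXn ltnS m_gt0 monicXn. Qed.

Lemma tcoef_tXn (i : 'I_m) j : tcoef (tX m ^+ i) j = (j == i)%:R.
Proof.
have -> : tX m ^+ i = in_qpoly 'X^m 'X^i by rewrite [RHS]rmorphXn.
rewrite /tcoef in_qpoly_small ?coefXn // mk_monicXm !size_polyXn ltnS.
exact: ltn_ord.
Qed.

Lemma truncpoly_basis (u : truncpoly m) :
  u = \sum_(i < m) tX m ^+ i *~ tcoef u i.
Proof.
apply/val_inj/polyP => j; rewrite -![(val _)`_j]/(tcoef _ j) tcoef_sum.
under eq_bigr => i _ do rewrite tcoefMz tcoef_tXn.
case: (ltnP j m) => [jm|mj].
  rewrite (bigD1 (Ordinal jm)) //= big1 ?addr0 => [|i].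
    by rewrite eqxx intz.
  by rewrite -val_eqE eq_sym /= => /negPf ->; rewrite mul0rz.
rewrite big1 => [|i _]; last first.
  by rewrite gtn_eqF ?mul0rz // (leq_trans (ltn_ord i)).
rewrite /tcoef nth_default // (leq_trans (size_npoly _)) //.
by rewrite mk_monicXm size_polyXn.
Qed.

End TruncPoly.

(* The tensor power of truncpoly m over Z with one factor for each element of
   K.  As truncpoly m is free over Z on 1, x, ..., x^(m-1), the tensor power is
   the free abelian group on the monomials x^f, i.e. the tensors of the
   x^(f k), k in K.  Its universal property is tpow_universal below. *)
Notation tpow m K := {ffun {ffun K -> 'I_m} -> int} (only parsing).

Section TensorPower.
Variables (m : nat) (K : finType).

Definition tens (a : {ffun K -> truncpoly m}) : tpow m K :=
  [ffun f : {ffun K -> 'I_m} => \prod_k tcoef (a k) (f k)].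

Definition tmon (f : {ffun K -> 'I_m}) : {ffun K -> truncpoly m} :=
  [ffun k => tX m ^+ f k].

Definition upd (a : {ffun K -> truncpoly m}) (k : K) (u : truncpoly m) :
    {ffun K -> truncpoly m} :=
  [ffun k' => if k' == k then u else a k'].

Definition multiadditive (M : zmodType) (mu : {ffun K -> truncpoly m} -> M) :=
  forall a k u v, mu (upd a k (u + v)) = mu (upd a k u) + mu (upd a k v).

Lemma upd_id a k : upd a k (a k) = a.
Proof. by apply/ffunP => k'; rewrite ffunE; case: eqP => [->|]. Qed.

Lemma multiadditive0 (M : zmodType) (mu : {ffun K -> truncpoly m} -> M) a k :
  multiadditive mu -> mu (upd a k 0) = 0.
Proof.
by move=> mulin; apply: (addrI (mu (upd a k 0))); rewrite -mulin !addr0.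
Qed.

Lemma multiadditive_sum (M : zmodType) (mu : {ffun K -> truncpoly m} -> M)
    a k I (r : seq I) (u : I -> truncpoly m) : multiadditive mu ->
  mu (upd a k (\sum_(i <- r) u i)) = \sum_(i <- r) mu (upd a k (u i)).
Proof.
move=> mulin; elim: r => [|i r IH]; first by rewrite !big_nil multiadditive0.
by rewrite !big_cons mulin IH.
Qed.

Lemma multiadditiveMz (M : zmodType) (mu : {ffun K -> truncpoly m} -> M)
    a k u (z : int) : multiadditive mu ->
  mu (upd a k (u *~ z)) = mu (upd a k u) *~ z.
Proof.
move=> mulin.
have muMn n : mu (upd a k (u *+ n)) = mu (upd a k u) *+ n.
  elim: n => [|n IH]; first by rewrite !mulr0n multiadditive0.
  by rewrite !mulrS mulin IH.
case: z => n; first exact: muMn.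
rewrite NegzE !mulrNz; apply/eqP; rewrite -subr_eq0 opprK.
by rewrite -[X in _ + X]muMn -mulin addNr multiadditive0.
Qed.

Lemma tens_multiadditive : multiadditive tens.
Proof.
move=> a k u v; apply/ffunP => f; rewrite !ffunE.
rewrite [LHS](bigD1 k) //= [X in _ = X + _](bigD1 k) //=.
rewrite [X in _ = _ + X](bigD1 k) //= !ffunE eqxx tcoefD mulrDl.
by congr (_ * _ + _ * _); apply: eq_bigr => k' /negPf k'k; rewrite !ffunE k'k.
Qed.

Hypothesis m_gt0 : (0 < m)%N.

Lemma multiadditive_ext (M : zmodType) (mu nu : {ffun K -> truncpoly m} -> M) :
  multiadditive mu -> multiadditive nu ->
  (forall f, mu (tmon f) = nu (tmon f)) -> mu =1 nu.
Proof.
move=> mumul numul eqmon a.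
suff gen (r : seq K) : forall b : {ffun K -> truncpoly m},
    (forall k, k \notin r -> exists i : 'I_m, b k = tX m ^+ i) -> mu b = nu b.
  by apply: (gen (enum K)) => k; rewrite mem_enum.
elim: r => [|k r IH] b hb.
  have /fin_all_exists [f hf] : forall k, exists i : 'I_m, b k = tX m ^+ i.
    by move=> k; apply: hb.
  by have -> : b = tmon (finfun f) by apply/ffunP => k; rewrite !ffunE hf.
rewrite -(upd_id b k) (truncpoly_basis m_gt0 (b k)) !multiadditive_sum //.
apply: eq_bigr => i _; rewrite !multiadditiveMz //; congr (_ *~ _).
apply: IH => k' k'r; rewrite ffunE; case: (eqVneq k' k) => [_|k'k].
  by exists i.
by apply: hb; rewrite inE negb_or k'k.
Qed.

Lemma tens_tmon f g : tens (tmon f) g = (g == f)%:R.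
Proof.
rewrite ffunE; under eq_bigr => k _ do rewrite ffunE (tcoef_tXn m_gt0).
case: (eqVneq g f) => [->|neq]; first by apply: big1 => k _; rewrite eqxx.
have [k gfk] : exists k, g k != f k.
  apply/existsP; apply: contraNT neq => /existsPn eqgf.
  by apply/eqP/ffunP => k; apply/eqP; rewrite -[_ == _]negbK eqgf.
by rewrite (bigD1 k) //= val_eqE (negPf gfk) mul0r.
Qed.

Lemma tpow_basis (w : tpow m K) : w = \sum_f tens (tmon f) *~ w f.
Proof.
apply/ffunP => g; rewrite sum_ffunE (bigD1 g) //= big1 ?addr0 => [|f fg].
  by rewrite ffunMzE tens_tmon eqxx intz.
by rewrite ffunMzE tens_tmon eq_sym (negPf fg) mul0rz.
Qed.

(* tens exhibits tpow m K as the tensor power of Z[x]/(x^m) over Z. *)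
Theorem tpow_universal (M : zmodType) (mu : {ffun K -> truncpoly m} -> M) :
  multiadditive mu ->
  exists phi : {additive tpow m K -> M},
    (forall a, phi (tens a) = mu a) /\
    (forall psi : {additive tpow m K -> M},
       (forall a, psi (tens a) = mu a) -> psi =1 phi).
Proof.
move=> mulin; pose phi0 (w : tpow m K) := \sum_f mu (tmon f) *~ w f.
have phi0B : zmod_morphism phi0.
  move=> w w'; rewrite /phi0 -sumrB; apply: eq_bigr => f _.
  by rewrite !ffunE mulrzBr.
pose phiM := GRing.isZmodMorphism.Build _ _ phi0 phi0B.
pose phi : {additive tpow m K -> M} := HB.pack phi0 phiM.
exists phi; split=> [|psi psiE w].
  apply: multiadditive_ext => // [a k u v|f].
    by rewrite tens_multiadditive raddfD.
  rewrite /= /phi0 (bigD1 f) //= big1 ?addr0 => [|g gf].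
    by rewrite tens_tmon eqxx.
  by rewrite tens_tmon (negPf gf).
rewrite [in LHS](tpow_basis w) raddf_sum /= /phi0; apply: eq_bigr => f _.
by rewrite raddfMz psiE.
Qed.

End TensorPower.

Section Polygon.
Variables (m n : nat) (prec : rel 'I_n).

(* P_n has vertex set 'I_n and edge set 'I_n; the edge e joins e and ordS e
   (the cyclic successor of e). *)
Definition adjacent (s : {set 'I_n}) : rel 'I_n :=
  fun u v => [exists e in s, ((u == e) && (v == ordS e)) ||
                             ((v == e) && (u == ordS e))].

Definition components (s : {set 'I_n}) : {set {set 'I_n}} :=
  equivalence_partition (connect (adjacent s)) [set: 'I_n].

Definition component (s : {set 'I_n}) : finType :=
  {c : {set 'I_n} | c \in components s}.

Definition vertices (s : {set 'I_n}) (c : component s) : {set 'I_n} := sval c.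

Definition Phi (s : {set 'I_n}) := tpow m (component s).

Definition merge (s s' : {set 'I_n}) (a : {ffun component s -> truncpoly m}) :
    {ffun component s' -> truncpoly m} :=
  [ffun c' : component s' => \prod_(c : component s | vertices c \subset vertices c') a c].

(* The map Phi(s) -> Phi(s'), for s' = e |: s, given on the monomial basis: the
   factor at a component c' of [P_n : s'] is the product of the factors at the
   components of [P_n : s] it contains.  So the two factors joined by e are
   multiplied; if e joins no two components, then [P_n : s] and [P_n : s'] have
   the same components and the map is the identity.  edge_map_tens below gives
   its value on all pure tensors. *)
Definition edge_map (s s' : {set 'I_n}) (w : Phi s) : Phi s' :=
  \sum_(f : {ffun component s -> 'I_m}) tens (merge s' (tmon f)) *~ w f.

(* A state is a pair of a set s of edges and a monomial of Phi(s), so that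
   int-valued functions on states form the direct sum of all the Phi(s). *)
Definition state := {s : {set 'I_n} & {ffun component s -> 'I_m}}.

Definition state_degree (x : state) : nat := (\sum_k tagged x k)%N.

Definition cochain := {ffun state -> int}.

Definition proj (s : {set 'I_n}) (c : cochain) : Phi s :=
  [ffun f => c (Tagged (fun s => {ffun component s -> 'I_m}) f)].

Definition num_smaller (s : {set 'I_n}) (e : 'I_n) : nat :=
  #|[set e' in s | prec e' e]|.

(* The differential, given by its component in each Phi(s'), which receives a
   term from Phi(s' :\ e) for each e in s'. *)
Definition diff_at (s' : {set 'I_n}) (c : cochain) : Phi s' :=
  \sum_(e in s')
    edge_map s' (proj (s' :\ e) c) *~ (-1) ^+ num_smaller (s' :\ e) e.

Definition diff (c : cochain) : cochain :=
  [ffun x : state => diff_at (tag x) c (tagged x)].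

(* c lies in C^(i,j), the part of internal degree j of C^i. *)
Definition bihomogeneous (i j : nat) (c : cochain) : bool :=
  [forall x : state, (c x != 0) ==> (#|tag x| == i) && (state_degree x == j)].

Lemma edge_map_is_additive s s' : zmod_morphism (@edge_map s s').
Proof.
move=> w w'; rewrite /edge_map -sumrB; apply: eq_bigr => f _.
by rewrite !ffunE mulrzBr.
Qed.
HB.instance Definition _ s s' :=
  GRing.isZmodMorphism.Build _ _ (@edge_map s s') (@edge_map_is_additive s s').

Lemma diff_is_additive : zmod_morphism diff.
Proof.
move=> c c'; apply/ffunP => x; rewrite !ffunE /diff_at.
have projB s : proj s (c - c') = proj s c - proj s c'.
  by apply/ffunP => f; rewrite !ffunE.
under eq_bigr => e _ do rewrite projB raddfB mulrzBl.
by rewrite sumrB !ffunE.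
Qed.
HB.instance Definition _ :=
  GRing.isZmodMorphism.Build cochain cochain diff diff_is_additive.

Lemma bihomogeneous0 i j : bihomogeneous i j 0.
Proof. by apply/forallP => x; rewrite ffunE eqxx. Qed.

Lemma bihomogeneousB i j c c' :
  bihomogeneous i j c -> bihomogeneous i j c' -> bihomogeneous i j (c - c').
Proof.
move=> /forallP hc /forallP hc'; apply/forallP => x; apply/implyP.
rewrite !ffunE; case: (eqVneq (c x) 0) => [->|cx _].
  by rewrite add0r oppr_eq0 => cx'; apply: (implyP (hc' x)).
exact: (implyP (hc x)).
Qed.

Lemma component_sub (s s' : {set 'I_n}) (c : component s) : s \subset s' ->
  exists2 c' : component s',
    vertices c \subset vertices c' &
    forall c'' : component s', vertices c \subset vertices c'' -> c'' = c'.
Proof.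
move=> ss'.
have csym (r : {set 'I_n}) : connect_sym (adjacent r).
  apply: sym_connect_sym => u v; apply/existsP/existsP => -[e he]; exists e;
    by rewrite orbC.
have eqv (r : {set 'I_n}) : {in [set: 'I_n] & &,
    equivalence_rel (connect (adjacent r))}.
  by move=> u v w _ _ _; split=> // uv; apply: same_connect.
have part r := equivalence_partitionP (eqv r).
have sub u v : connect (adjacent s) u v -> connect (adjacent s') u v.
  apply: connect_sub => x y /exists_inP[e es xy]; apply: connect1.
  by apply/exists_inP; exists e; rewrite ?(subsetP ss').
have classP (r : {set 'I_n}) (A : component r) u v : u \in vertices A ->
    (v \in vertices A) = connect (adjacent r) u v.
  move=> uA; have [/eqP _ triv _] := and3P (part r).
  rewrite -(def_pblock triv (svalP A : vertices A \in _) uA).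
  by rewrite (pblock_equivalence_partition (eqv r)) ?inE.
have [u uc] : exists u, u \in vertices c.
  have [_ _ n0] := and3P (part s).
  by apply/set0Pn; apply: contraNneq n0 => <-; exact: (svalP c).
have uP : pblock (components s') u \in components s'.
  have [/eqP cov _ _] := and3P (part s').
  by apply: pblock_mem; rewrite cov inE.
have uin : u \in pblock (components s') u.
  by rewrite mem_pblock; have [/eqP -> _ _] := and3P (part s'); rewrite inE.
pose c' : component s' :=
  exist (fun A : {set _} => A \in components s') _ uP.
exists c' => [|c'' sub''].
  apply/subsetP => v; rewrite (classP _ c u) // => uv.
  by rewrite (classP _ c' u) //; apply: sub.
apply: val_inj; rewrite -!/(vertices _); apply/setP => v.
rewrite (classP _ c'' u) ?(subsetP sub'') //.
by rewrite (classP _ c' u).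
Qed.

Lemma edge_map_tens (s s' : {set 'I_n}) : (0 < m)%N -> s \subset s' ->
  forall a : {ffun component s -> truncpoly m},
    edge_map s' (tens a) = tens (merge s' a).
Proof.
move=> m_gt0 ss'.
apply: (multiadditive_ext m_gt0) => [a k u v|a c u v|f].
- exact: etrans (congr1 (@edge_map s s') (tens_multiadditive a k u v))
                (raddfD _ _ _).
- have [c' cc' c'uniq] := component_sub c ss'.
  pose rest := \prod_(d : component s | (vertices d \subset vertices c') && (d != c)) a d.
  have mergeE w : merge s' (upd a c w) = upd (merge s' a) c' (w * rest).
    apply/ffunP => c''; rewrite !ffunE.
    case: (eqVneq c'' c') => [->|neq].
      rewrite (bigD1 c) //= ffunE eqxx; congr (_ * _).
      by apply: eq_bigr => d /andP[_ /negPf dc]; rewrite ffunE dc.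
    apply: eq_bigr => d dc''; rewrite ffunE; case: eqP => // dc.
    by rewrite dc in dc''; rewrite (c'uniq _ dc'') eqxx in neq.
  have mergeD : merge s' (upd a c (u + v)) =
      upd (merge s' a) c' (u * rest + v * rest).
    exact: etrans (mergeE _) (congr1 (upd (merge s' a) c') (mulrDl u v rest)).
  apply: etrans (congr1 (@tens m (component s')) mergeD) _.
  apply: etrans (tens_multiadditive _ _ _ _) _.
  have congD (x x' y y' : {ffun component s' -> truncpoly m}) :
    x = x' -> y = y' -> tens x + tens y = tens x' + tens y' by move=> -> ->.
  exact: congD (esym (mergeE u)) (esym (mergeE v)).
rewrite /edge_map (bigD1 f) //= big1 ?addr0 => [|g gf].
  by rewrite tens_tmon // eqxx.
by rewrite tens_tmon // (negPf gf).
Qed.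

Definition is_cocycle (i j : nat) : pred cochain :=
  fun c => bihomogeneous i j c && (diff c == 0).

Lemma is_cocycle_zmod_closed i j : zmod_closed (is_cocycle i j).
Proof.
split=> [|c c']; rewrite ?unfold_in /=.
  by rewrite /is_cocycle bihomogeneous0 raddf0 eqxx.
rewrite /is_cocycle => /andP[hc /eqP dc] /andP[hc' /eqP dc'].
by apply/andP; split; [exact: bihomogeneousB | rewrite raddfB /= dc dc' subrr].
Qed.
HB.instance Definition _ i j :=
  GRing.isZmodClosed.Build cochain (is_cocycle i j) (is_cocycle_zmod_closed i j).

Definition cocycle (i j : nat) := {c : cochain | is_cocycle i j c}.
HB.instance Definition _ i j := SubChoice.on (cocycle i j).
HB.instance Definition _ i j := [SubChoice_isSubZmodule of cocycle i j by <:].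

Definition is_coboundary (i j : nat) (z : cocycle i j) : bool :=
  `[< exists2 b : cochain,
    if i is i'.+1 then bihomogeneous i' j b else b == 0 & val z = diff b >].

Lemma is_coboundary_zmod_closed i j : zmod_closed (@is_coboundary i j).
Proof.
split=> [|z z'].
  apply/asboolP; exists 0; last by rewrite !raddf0.
  by case: i => [|i] //; apply: bihomogeneous0.
move=> /asboolP[b hb zb] /asboolP[b' hb' zb']; apply/asboolP.
exists (b - b'); last by rewrite !raddfB /= zb zb'.
case: i {z z' zb zb'} hb hb' => [/eqP-> /eqP->|i hb hb'].
  by rewrite subrr.
exact: bihomogeneousB.
Qed.
HB.instance Definition _ i j :=
  GRing.isZmodClosed.Build (cocycle i j) (@is_coboundary i j)
    (is_coboundary_zmod_closed i j).

(* H^(i,j) of P_n over Z[x]/(x^m), the edges being ordered by prec. *)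
Definition cohomology (i j : nat) : zmodType :=
  Quotient.quot (GRing.ZmodClosed.clone (cocycle i j) (@is_coboundary i j) _).

End Polygon.

Definition strict_linear_order (T : eqType) (prec : rel T) : Prop :=
  [/\ irreflexive prec, transitive prec &
      forall x y, x != y -> prec x y || prec y x].

Definition zmod_iso (G G' : zmodType) : Prop :=
  exists f : {additive G -> G'}, bijective f.

(* Z/mZ for 0 < m; unlike 'Z_m, this is the trivial group for m = 1. *)
Definition Zmod (m : nat) : zmodType := 'I_(m.-1.+1).

Definition Zindependent (G : zmodType) (r : nat) (v : 'I_r -> G) : Prop :=
  forall a : 'I_r -> int, \sum_i v i *~ a i = 0 -> forall i, a i = 0.

(* The largest size of a Z-independent family (0 if there is none). *)
Definition rank (G : zmodType) : nat :=
  classical_sets.xget 0%N (fun r => (exists v : 'I_r -> G, Zindependent v) /\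
    forall r' (v : 'I_r' -> G), Zindependent v -> (r' <= r)%N).

Section Bigraded.
Variable H : nat -> nat -> zmodType.

(* The elements of the direct sum of all the H i j. *)
Definition in_dsum (h : forall i j, H i j) : Prop :=
  exists N, forall i j, ((N <= i) || (N <= j))%N -> h i j = 0.

Definition torsion (h : forall i j, H i j) : Prop :=
  exists2 k, (0 < k)%N & forall i j, h i j *+ k = 0.

(* The torsion subgroup of the direct sum of all the H i j is the direct sum of
   the H i j with S i j. *)
Definition Tor_eq_dsum (S : nat -> nat -> Prop) : Prop :=
  forall h, in_dsum h -> (torsion h <-> forall i j, ~ S i j -> h i j = 0).

(* P is a polynomial in t with coefficients in Z[q]. *)
Definition Poincare_polynomial (P : {poly {poly int}}) : Prop :=
  forall i j, (P`_i)`_j = (rank (H i j))%:R.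

End Bigraded.

(* Main.v *)
(** The idea is algebraic Morse theory. Going around the polygon, a basis element
    of the complex is a set of edges together with the cyclic word of exponents
    of its components, and adding an edge merges two neighbouring letters of the
    word. Up to a change of signs, forgetting the set of edges and keeping the
    word maps the complex to the Hochschild complex of Z[x]/(x^m). Two matchings
    cancel most cells: the first removes the letters 0 away from the component of
    vertex 0 (and normalises the set of edges), the second reduces the remaining
    words, up to their first letter, to 1, m-1, 1, m-1, ...

    The comparison map [gamma] of the bar resolution with the 2-periodic
    resolution of Z[x]/(x^m), whose differentials induce 0 and m x^(m-1),
    vanishes on the cells that are matched upwards and is 1 on the unmatched
    ones; so it computes the differential between unmatched cells, and no
    gradient path has to be followed. In each bidegree with positive cohomological
    degree at most one cell survives, and the cohomology is 0, Z or Z/m. In degree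
    0 the surviving cells are counted by a generating function. *)

From HB Require Import structures.
Require Import Defs.
From mathcomp Require Import all_boot all_order all_algebra.
From mathcomp Require Import ring_quotient generic_quotient boolp.
From mathcomp Require classical_sets.
From mathcomp Require Import zify ring.

Set Implicit Arguments.
Unset Strict Implicit.
Unset Printing Implicit Defensive.

Import GRing.Theory Num.Theory.
Local Open Scope ring_scope.

(** No Morse complex is constructed. A matching enters only as an integral linear system indexed by
    the lower cells, whose entry at [x], [y] is the coefficient of the differential of [y] at the
    partner of [x]; it is triangular with signs on the diagonal. Solving it, one subtracts a
    coboundary so that the coefficients at all partners vanish, or chooses the values of a cochain
    at the lower cells. Its injectivity shows that a cocycle in this normal form is 0 once its
    [gamma] is 0.

    The obstacle is that a merge need not keep the gaps initial, so the second matching does not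
    follow single incidences of cells.

    In [gamma], a pair of letters contributes a carry (1 if its sum reaches m), and a last unpaired
    letter k the factor of the derivative k x^(k-1) of x^k; differentiating x^m gives the m of m
    x^(m-1). But [gamma] forgets the power of x that multiplies the generator, hence cannot see that
    x^m = 0. It is therefore compatible with the differentials only below a bound on the internal
    degree, which holds wherever the target has a critical cell. *)

(** * Merging neighbouring letters of a cyclic word *)

Fixpoint merge_inner (r : nat) (a : seq nat) : seq nat :=
  match r, a with
  | 0, x :: y :: t => (x + y)%N :: t
  | r'.+1, x :: t => x :: merge_inner r' t
  | _, _ => a
  end.

(* The last entry of the cyclic word a merges into the first one. *)
Definition merge_at (r : nat) (a : seq nat) : seq nat :=
  if (r.+1 < size a)%N then merge_inner r a
  else if a is x :: y :: t then (x + last y t)%N :: belast y t else a.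

(* The matchings are triangular with respect to the moment: every other lower
   cell below the partner of a lower cell has a larger moment. *)
Fixpoint moment (a : seq nat) : nat :=
  if a is x :: t then (moment t + sumn t)%N else 0%N.

Lemma sumn_merge_inner r a : sumn (merge_inner r a) = sumn a.
Proof.
elim: r a => [|r IH] [|x t] //=; last by rewrite IH.
by case: t => //= y t; rewrite addnA.
Qed.

Lemma size_merge_inner r a :
  (r.+1 < size a)%N -> size (merge_inner r a) = (size a).-1.
Proof.
elim: r a => [|r IH] [|x t] //=; first by case: t.
by rewrite ltnS => h; rewrite IH //; case: t h.
Qed.

Lemma merge_inner_catl r b c :
  (r.+1 < size b)%N -> merge_inner r (b ++ c) = merge_inner r b ++ c.
Proof.
elim: r b => [|r IH] [|x t] //=; first by case: t.
by rewrite ltnS => h; rewrite IH.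
Qed.

Lemma merge_inner_catr r b c :
  merge_inner (size b + r) (b ++ c) = b ++ merge_inner r c.
Proof. by elim: b => //= x b ->. Qed.

Lemma merge_atE r a : (r.+1 < size a)%N -> merge_at r a = merge_inner r a.
Proof. by rewrite /merge_at => ->. Qed.

Lemma merge_at_last r x y t : ((size t).+2 <= r.+1)%N ->
  merge_at r (x :: rcons t y) = (x + y)%N :: t.
Proof.
move=> h; rewrite /merge_at /= size_rcons ltnNge h /=.
by case: t {h} => [|z t] //=; rewrite last_rcons belast_rcons.
Qed.

(** Merging a zero letter into its left or its right neighbour (the head, if the zero is last) gives
    the same word with opposite signs. All other merges keep this zero behind the head, where [h]
    vanishes. *)
Lemma alternating_sum_merge_zero (h : seq nat -> int) (x : nat) (t : seq nat) :
  (forall y u, 0%N \in u -> h (y :: u) = 0) -> 0%N \in t ->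
  \sum_(0 <= r < (size t).+1) (-1) ^+ r * h (merge_at r (x :: t)) = 0.
Proof.
move=> h0 t0; have [t1 [t2 ->]] : exists t1 t2 : seq nat, t = t1 ++ 0%N :: t2.
  by case/splitPr: t0 => t1 t2; exists t1, t2.
rewrite size_cat /= (@big_cat_nat _ _ _ (size t1)) ?leq0n //=; last lia.
rewrite big_nat big1 ?add0r => [|r /= rlt]; last first.
  rewrite merge_atE /= ?size_cat /=; last lia.
  case: r rlt => [|r] rlt; last first.
    by rewrite -cat_cons merge_inner_catl //= h0 ?mulr0 // mem_cat mem_head orbT.
  by case: t1 rlt => //= y t1 _; rewrite h0 ?mulr0 // mem_cat mem_head orbT.
rewrite big_ltn; last lia.
rewrite big_ltn; last lia.
have -> : merge_at (size t1) (x :: t1 ++ 0%N :: t2) = x :: t1 ++ t2.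
  rewrite merge_atE /= ?size_cat /=; last lia.
  have := merge_inner_catr 0 (belast x t1) (last x t1 :: 0%N :: t2).
  rewrite size_belast addn0 /= addn0 => E.
  by rewrite -!cat_cons (lastI x t1) !cat_rcons.
have -> : merge_at (size t1).+1 (x :: t1 ++ 0%N :: t2) = x :: t1 ++ t2.
  case: t2 => [|y t2].
    by rewrite cats1 merge_at_last // addn0 cats0.
  rewrite merge_atE /= ?size_cat /=; last lia.
  by have := merge_inner_catr 0 t1 [:: 0%N, y & t2]; rewrite addn0 /= => ->.
rewrite addrA exprS -!mulrA mulN1r subrr add0r big_nat big1 // => r rlt.
have -> : x :: t1 ++ 0%N :: t2 = (x :: rcons t1 0%N) ++ t2 by rewrite /= cat_rcons.
case: (ltnP r.+1 (size t1 + size t2).+2) => rle.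
  have hr : (r.+1 < size ((x :: rcons t1 0%N) ++ t2))%N.
    by rewrite size_cat /= size_rcons; lia.
  rewrite merge_atE {hr} //.
  have -> : r = ((size t1).+2 + (r - (size t1).+2))%N by lia.
  have := merge_inner_catr (r - (size t1).+2) (x :: rcons t1 0%N) t2.
  rewrite /= size_rcons !addSn /= => ->.
  by rewrite h0 ?mulr0 // mem_cat mem_rcons mem_head.
case: (lastP t2) rlt rle => [|t2' y]; first by rewrite /=; lia.
rewrite size_rcons => rlt rle.
rewrite /= -rcons_cat merge_at_last ?size_cat ?size_rcons; last lia.
by rewrite h0 ?mulr0 // mem_cat mem_rcons mem_head.
Qed.

(** * Words and their weights *)

Section Words.
Variable m : nat.

(* Reading a word by pairs from the left, let (x, y) be the first pair other
   than (1, m-1). The word is lower if x = 1, and is then matched with the word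
   in which x and y are merged; the upper words are those with 1 < x. *)
Fixpoint lower_word (a : seq nat) : bool :=
  if a is x :: y :: t then (x == 1%N) && ((y != m.-1) || lower_word t) else false.

Fixpoint word_partner (a : seq nat) : seq nat :=
  if a is x :: y :: t then
    if y == m.-1 then x :: y :: word_partner t else (x + y)%N :: t
  else a.

Fixpoint partner_pos (a : seq nat) : nat :=
  if a is x :: y :: t then
    if y == m.-1 then (partner_pos t).+2 else 0%N
  else 0%N.

Fixpoint critical_word (p : nat) : seq nat :=
  match p with
  | 0 => [::]
  | 1 => [:: 1%N]
  | p'.+2 => [:: 1%N, m.-1 & critical_word p']
  end.

Definition letters (a : seq nat) := all (fun x => 0 < x < m)%N a.

Lemma word_ind (P : seq nat -> Prop) :
  P [::] -> (forall x, P [:: x]) -> (forall x y t, P t -> P [:: x, y & t]) ->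
  forall a, P a.
Proof.
move=> P0 P1 P2 a; suff [] : P a /\ forall x, P (x :: a) by [].
by elim: a => [|x a [IH1 IH2]]; split=> // y; apply: P2.
Qed.

Lemma merge_word_partner a : lower_word a ->
  merge_inner (partner_pos a) a = word_partner a /\
  ((partner_pos a).+1 < size a)%N.
Proof.
elim/word_ind: a => [|x|x y t IH] //= /andP[_].
by case: eqVneq => //= -> /IH[-> ?].
Qed.

Lemma sumn_word_partner a : sumn (word_partner a) = sumn a.
Proof. elim/word_ind: a => [|x|x y t IH] //=; case: ifP => _ /=; lia. Qed.

(** The right-hand side is the moment of any word with tail [word_partner a]. Such a word occurs
    when another lower word is merged further left than [a]. *)
Lemma moment_lower_word a : lower_word a -> letters a ->
  (moment a < moment (word_partner a) + sumn (word_partner a))%N.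
Proof.
elim/word_ind: a => [|x|x y t IH] //= /andP[/eqP-> ht] /and3P[_ hy /IH{}IH].
have := sumn_word_partner t.
by case: eqVneq ht => //= [-> /IH|_ _]; lia.
Qed.

Lemma letters_word_partner a : lower_word a -> letters a -> letters (word_partner a).
Proof.
elim/word_ind: a => [|x|x y t IH] //= /andP[/eqP-> ht] /and3P[hx hy ha].
case: eqVneq ht => /= [ey|ney] ht; last first.
  by rewrite /letters /= -/(letters t) ha andbT; lia.
by have := IH ht ha; rewrite /letters /= hy => ->; rewrite !andbT; lia.
Qed.

(** Excludes the merge of the last letter into the head. The first pair other than (1, m-1) now
    starts with 1 + y > 1, whatever letter is appended. *)
Lemma lower_word_partner_rcons a z : lower_word a -> letters a ->
  ~~ lower_word (rcons (word_partner a) z).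
Proof.
elim/word_ind: a => [|x|x y t IH] //= /andP[/eqP-> ht] /and3P[_ hy ha].
case: eqVneq ht => /= [ey|ney] ht; first by rewrite ey eqxx /= IH.
have e : (1 + y == 1)%N = false by lia.
by case: t {ht ha IH} => [|u t] /=; rewrite e.
Qed.

(** To the right of the pair merged in [a], the merge would leave in [b] a pair starting with 1 + y,
    so [b] would not be lower. At this pair it determines [b], whose letter there is 1. To the left
    it must split a letter m-1, as 1 is not a sum of two positive letters, and this shifts letters
    to the right and increases the moment. *)
Lemma merge_inner_lower r a b : lower_word a -> letters a ->
  lower_word b -> letters b -> merge_inner r b = word_partner a ->
  (r.+1 < size b)%N ->
  (b = a /\ r = partner_pos a) \/ (moment a < moment b)%N.
Proof.
elim/word_ind: a r b => [|x|x y t IH] //= r b /andP[/eqP-> ht] /and3P[_ hy ha].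
case: (eqVneq y) ht => /= [ey|ney] ht; last first.
  move=> lb hb; case: r => [|r]; last first.
    case: b lb hb => [|b1 [|b2 b]] //= /andP[/eqP-> _] /and3P[_ _ _] [].
    by move=> e1; lia.
  case: b lb hb => [|b1 [|b2 b]] //= /andP[/eqP-> _] /and3P[_ _ _] [].
  by move=> e1 -> _; left; split=> //; have -> : b2 = y by lia.
move=> lb hb; case: b lb hb => [|b1 [|b2 b]] //= /andP[/eqP-> lb] /and3P[_ hb2 hb].
case: r => [|[|r]] /=.
- by move=> [e1]; move: hb2; rewrite -e1; lia.
- case: b lb hb => [|b3 b] //= lb /andP[hb3 hb] [e1 eb] _; right.
  have := moment_lower_word ht ha; rewrite -eb /=.
  have := sumn_word_partner t; rewrite -eb; move: (moment t) (moment b) => ? ?; lia.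
- move=> [eb2]; rewrite -/(merge_inner r b) => eb hsz.
  rewrite eb2 ey eqxx /= in lb.
  case: (IH r b ht ha lb hb eb hsz) => [[-> ->]|lt]; first by left; rewrite eb2.
  by right; have := sumn_merge_inner r b; rewrite eb sumn_word_partner; lia.
Qed.

Lemma merge_at_lower r x y a b : lower_word a -> letters a ->
  lower_word b -> letters b -> (r < (size b).+1)%N ->
  merge_at r (y :: b) = x :: word_partner a ->
  (y :: b = x :: a /\ r = (partner_pos a).+1) \/
  (moment (x :: a) < moment (y :: b))%N.
Proof.
move=> la ha lb hb rb; case: (ltnP r.+1 (size (y :: b))) => rlt; last first.
  case/lastP: b lb hb rlt {rb} => [|b z] // lb hb; rewrite /= size_rcons => rlt.
  rewrite merge_at_last // => -[_ eb].
  by move: lb; rewrite eb (negPf (lower_word_partner_rcons z la ha)).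
rewrite merge_atE //; case: r rlt {rb} => [|r] /= rlt.
  case: b lb hb rlt => [|z b] //= lb /andP[hz hb] _ [e1 eb]; right.
  have := moment_lower_word la ha; have := sumn_word_partner a.
  by rewrite -eb; lia.
case=> -> eb; have := merge_inner_lower la ha lb hb eb rlt.
case=> [[-> ->]|lt]; first by left.
by right; have := sumn_merge_inner r b; rewrite eb sumn_word_partner /=; lia.
Qed.

(** An upper word is the partner of the word in which the first letter x > 1 of its first wrong pair
    (or its unpaired last letter) is split into 1 and x-1. As x < m, the new letter is not m-1, so
    the partner is formed at this very place. *)
Lemma word_cases a : letters a ->
  [\/ lower_word a, a = critical_word (size a)
    | exists b, [/\ lower_word b, letters b, size b = (size a).+1 & word_partner b = a]].
Proof.
elim/word_ind: a => [|x|x y t IH] /=.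
- by move=> _; apply: Or32.
- move=> /andP[hx _]; case: (eqVneq x 1%N) => [->|nx]; first by apply: Or32.
  apply: Or33; exists [:: 1%N; x.-1]; rewrite /=.
  have e : (x.-1 == m.-1) = false by lia.
  rewrite e /=; split=> //; first by rewrite /letters /= !andbT; lia.
  by congr [:: _]; lia.
- move=> /and3P[hx hy ht]; case: (eqVneq x 1%N) => [->|nx]; last first.
    apply: Or33; exists [:: 1%N, x.-1, y & t]; rewrite /=.
    have e : (x.-1 == m.-1) = false by lia.
    rewrite e /=; split=> //; last by congr (_ :: _); lia.
    by rewrite /letters /= hy -/(letters t) ht; lia.
  case: (eqVneq y m.-1) => [->|ny] /=; last by apply: Or31.
  case: (IH ht) => [lt|et|[b [lb hb sb eb]]].
  + exact: Or31.
  + by apply: Or32; rewrite -et.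
  apply: Or33; exists [:: 1%N, m.-1 & b]; rewrite /= eqxx /= sb eb.
  by split=> //; rewrite /letters /= -/(letters b) hb; lia.
Qed.

(* The coefficients of the comparison map from the bar resolution of
   Z[x]/(x^m) to its 2-periodic resolution. *)
Fixpoint weight (a : seq nat) : int :=
  match a with
  | [::] => 1
  | [:: x] => x%:R
  | x :: y :: t => (m <= x + y)%N%:R * weight t
  end.

(** The first pair other than (1, m-1) is (1, y) with 1 + y < m: it has no carry. *)
Lemma weight_lower a : lower_word a -> letters a -> weight a = 0.
Proof.
elim/word_ind: a => [|x|x y t IH] //= /andP[/eqP-> ht] /and3P[_ hy ha].
case: eqVneq ht => /= [ey|ney] ht; first by rewrite IH ?mulr0.
have -> : (m <= 1 + y)%N = false by lia.
by rewrite mul0r.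
Qed.

Lemma weight_critical p : (0 < m)%N -> weight (critical_word p) = 1.
Proof.
move=> m_gt0; elim/ltn_ind: p => [[|[|p]]] IH //=; rewrite IH // mulr1.
by have -> : (m <= 1 + m.-1)%N by lia.
Qed.

(** The bound is the internal degree of the generator of the periodic resolution in homological
    degree [size a]. *)
Lemma weight_neq0 a : weight a != 0 -> ((size a)./2 * m + odd (size a) <= sumn a)%N.
Proof.
elim/word_ind: a => [|x|x y t IH] //=.
  by rewrite addn0; case: x => //.
by case: leqP => h; rewrite ?mul0r ?eqxx // mul1r => /IH; lia.
Qed.

Lemma weight_eq0 a x : (x < m)%N -> all (fun x => (x < m)%N) a -> 0%N \in a -> weight a = 0.
Proof.
move=> xm; elim/word_ind: a => [|z|z y t IH] //=; first by rewrite !inE => _ /eqP <-.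
move=> /and3P[hz hy ht]; rewrite !inE => /or3P[/eqP e|/eqP e|/(IH ht)->]; last exact: mulr0.
  by rewrite -e add0n leqNgt hy mul0r.
by rewrite -e addn0 leqNgt hz mul0r.
Qed.

Definition small (a : seq nat) := all (fun x => x < m)%N a.

Arguments small : simpl never.

Lemma small_cons x t : small (x :: t) = (x < m)%N && small t.
Proof. by []. Qed.

Definition smallweight (a : seq nat) : int := if small a then weight a else 0.

(* Vanishes at the words that label no cell. *)
Definition cyclic_weight (a : seq nat) : int :=
  if small a then weight (behead a) else 0.

(* What remains of the alternating sum of the weights of all inner merges,
   besides the weight of the tail: all other terms telescope. *)
Fixpoint inner_boundary (a : seq nat) : int :=
  match a with
  | [::] => 0
  | [:: x] => 1
  | [:: x; y] => y%:R - (x + y < m)%N%:R * (x + y)%:R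
  | x :: y :: t => (m <= x + y)%N%:R * inner_boundary t
  end.

Lemma smallweight_cons2 x y t : (x < m)%N -> (y < m)%N ->
  smallweight [:: x, y & t] = (m <= x + y)%N%:R * smallweight t.
Proof.
move=> hx hy; rewrite /smallweight; have -> : small [:: x, y & t] = small t.
  by rewrite !small_cons hx hy.
by case: ifP => //=; rewrite mulr0.
Qed.

Lemma sum_inner_boundary x t : small (x :: t) ->
  \sum_(0 <= r < size t) (-1) ^+ r.+1 * smallweight (merge_inner r (x :: t))
  = inner_boundary (x :: t) - weight t.
Proof.
have [k] := ubnP (size t); elim: k => // k IH in x t *.
case: t => [|y [|z t]] hk.
- by move=> _; rewrite big_nil subrr.
- rewrite big_nat1 /= expr1 /smallweight /small /= !andbT => /andP[hx hy].
  case: ltnP => _; rewrite ?mul0r ?mul1r; ring.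
move=> h; have /and4P[hx hy hz ht] := h.
have -> : inner_boundary [:: x, y, z & t] =
  (m <= x + y)%N%:R * inner_boundary (z :: t) by [].
have -> : weight [:: y, z & t] = (m <= y + z)%N%:R * weight t by [].
set B := inner_boundary _.
rewrite big_nat_recl // big_nat_recl //=.
have -> : \sum_(0 <= i < size t) (-1) ^+ i.+3 *
    smallweight [:: x, y & merge_inner i (z :: t)] =
    (m <= x + y)%N%:R * (B - weight t).
  rewrite /B -IH; [|by move: hk => /=; lia|by rewrite /small /= hz].
  rewrite big_distrr /=; apply: eq_bigr => i _.
  by rewrite smallweight_cons2 // !exprS !mulN1r opprK mulrCA.
have e1 : smallweight ((x + y)%N :: z :: t) =
   (x + y < m)%N%:R * (m <= x + y + z)%N%:R * weight t.
  rewrite /smallweight !small_cons hz (ht : small t) andbT.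
  by case: ltnP => _; rewrite ?mul0r ?mul1r.
have e2 : smallweight (x :: (y + z)%N :: t) =
   (y + z < m)%N%:R * (m <= x + y + z)%N%:R * weight t.
  rewrite /smallweight !small_cons hx (ht : small t) andbT /= addnA.
  by case: (ltnP (y + z)) => _; rewrite ?mul0r ?mul1r.
(* The cocycle identity of the carry: this is what makes the sum telescope. *)
have e3 : (m <= x + y + z)%N%:R * ((y + z < m)%N%:R - (x + y < m)%N%:R) =
   (m <= x + y)%N%:R - (m <= y + z)%N%:R :> int.
  by case: (leqP m (x + y)) => h1; case: (leqP m (y + z)) => h2;
    case: leqP => h3 //; lia.
rewrite e1 e2.
rewrite expr1 sqrrN expr1n.
transitivity ((m <= x + y)%N%:R * (B - weight t) +
  (m <= x + y + z)%N%:R * ((y + z < m)%N%:R - (x + y < m)%N%:R) * weight t); first ring.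
rewrite e3; ring.
Qed.

(** Unless both sides vanish, every pair takes up at least m of the total degree. The bound then
    leaves less than m for the last letter and [a0] together. *)
Lemma inner_boundary_odd x t a0 : small (x :: t) -> ~~ odd (size t) ->
  (a0 < m)%N -> (a0 + sumn (x :: t) < (size t)./2.+1 * m)%N ->
  inner_boundary (x :: t) = (last x t + a0 < m)%N%:R * weight (belast x t).
Proof.
have [k] := ubnP (size t); elim: k => // k IH in x t *.
case: t => [|y [|z t]] // hk.
  move=> _ _ ha0 /=; rewrite addn0 mul1n addnC mulr1 => ->.
  by [].
move=> /and4P[hx hy hz ht] ho ha0 hs.
rewrite -[inner_boundary _]/((m <= x + y)%N%:R * inner_boundary (z :: t)).
rewrite -[weight (belast _ _)]/((m <= x + y)%N%:R * weight (belast z t)).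
rewrite -[last _ _]/(last z t).
case: (leqP m (x + y)) => hxy; last by rewrite !mul0r mulr0.
rewrite !mul1r; apply: IH => //.
- by move: hk => /=; lia.
- by rewrite small_cons hz.
- by move: ho => /=; rewrite negbK.
- by move: hs => /=; lia.
Qed.

Lemma inner_boundary_even x y t a0 : small [:: x, y & t] -> ~~ odd (size t) ->
  (a0 < m)%N -> (a0 + sumn [:: x, y & t] <= (size t)./2.+1 * m)%N ->
  inner_boundary [:: x, y & t] +
    (last y t + a0 < m)%N%:R * weight (x :: belast y t) =
  m%:R * weight [:: x, y & t].
Proof.
have [k] := ubnP (size t); elim: k => // k IH in x y t *.
case: t => [|z [|u t]] // hk.
  (* The origin of the factor m: if [m <= x + y], the degree bound forces [x + y = m] and [a0 = 0],
     and the two terms add up to [y + x]. *)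
  move=> /and3P[hx hy _] _ ha0 /= hs; rewrite mulr1.
  case: (leqP m (x + y)) => h1; case: (ltnP (y + a0)) => h2; lia.
move=> /and4P[hx hy hz ht] ho ha0 hs.
rewrite -[inner_boundary _]/((m <= x + y)%N%:R * inner_boundary [:: z, u & t]).
rewrite -[weight (_ :: belast _ _)]/((m <= x + y)%N%:R * weight (z :: belast u t)).
rewrite -[weight [:: x, y, z, u & t]]/((m <= x + y)%N%:R * weight [:: z, u & t]).
rewrite -[last _ _]/(last u t).
case: (leqP m (x + y)) => hxy; last by rewrite !mul0r !mulr0 addr0.
rewrite !mul1r; apply: IH => //.
- by move: hk => /=; lia.
- by rewrite small_cons hz.
- by move: ho => /=; rewrite negbK.
- by move: hs => /=; lia.
Qed.

Lemma sum_cyclic_weight a0 x t : small [:: a0, x & t] ->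
  \sum_(0 <= r < (size t).+2) (-1) ^+ r * cyclic_weight (merge_at r [:: a0, x & t]) =
  inner_boundary (x :: t) - (m <= a0 + x)%N%:R * weight t +
  (-1) ^+ (size t).+1 * (last x t + a0 < m)%N%:R * weight (belast x t).
Proof.
rewrite !small_cons => /and3P[ha hx ht].
rewrite big_nat_recr // big_nat_recl //.
have -> : merge_at (size t).+1 [:: a0, x & t] = (a0 + last x t)%N :: belast x t.
  by rewrite /merge_at /= ltnn.
have -> : \sum_(0 <= i < size t) (-1) ^+ i.+1 * cyclic_weight (merge_at i.+1 [:: a0, x & t])
  = inner_boundary (x :: t) - weight t.
  rewrite -sum_inner_boundary ?small_cons ?hx // !big_nat.
  apply: eq_bigr => i hi; rewrite merge_atE //= /cyclic_weight small_cons ha.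
  by [].
set IB := inner_boundary (x :: t).
rewrite expr0 mul1r merge_atE // /cyclic_weight /= !small_cons ht andbT.
have hb : small (belast x t).
  have : small (x :: t) by rewrite small_cons hx.
  by rewrite lastI /small all_rcons => /andP[].
rewrite hb andbT (addnC a0 (last x t)).
by case: (leqP m (a0 + x)) => _; case: ifP => _ /=; ring.
Qed.

(** Compatibility with the periodic differential that induces 0. By the degree bound, the power of x
    multiplying the generator in the target is below m, so that forgetting it does no harm. *)
Lemma sum_cyclic_weight_odd a0 t : small (a0 :: t) -> odd (size t) ->
  (a0 + sumn t < (size t)./2.+1 * m)%N ->
  \sum_(0 <= r < (size t).+1) (-1) ^+ r * cyclic_weight (merge_at r (a0 :: t)) = 0.
Proof.
case: t => [|x t] // h ho hs; rewrite sum_cyclic_weight // (@inner_boundary_odd x t a0).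
- have := @weight_neq0 t; case: (eqVneq (weight t) 0) => [-> _|_ /(_ isT) hw].
    rewrite mulr0 subr0 -signr_odd ho expr1; ring.
  have -> : (m <= a0 + x)%N = false.
    move: hs ho => /= hs ho; move: hs; rewrite uphalf_half (negPf ho) add0n mulSn.
    by move: ((size t)./2 * m)%N hw => ? ?; lia.
  rewrite mul0r subr0 -signr_odd ho expr1; ring.
- by case/andP: h.
- by [].
- by case/andP: h.
- by move: hs ho => /= hs /negPf ho; move: hs; rewrite uphalf_half ho.
Qed.

(** The same for the differential inducing m x^(m-1). Equality is allowed in the bound, since the
    generator of the target has an extra degree 1. *)
Lemma sum_cyclic_weight_even a0 t : small (a0 :: t) -> ~~ odd (size t) -> (0 < size t)%N ->
  (a0 + sumn t <= (size t)./2 * m)%N ->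
  \sum_(0 <= r < (size t).+1) (-1) ^+ r * cyclic_weight (merge_at r (a0 :: t))
  = m%:R * weight t.
Proof.
case: t => [|x [|y t]] // h ho _ hs; rewrite (@sum_cyclic_weight a0 x (y :: t)) //.
rewrite -(@inner_boundary_even x y t a0).
- have := @weight_neq0 (y :: t); case: (eqVneq (weight (y :: t)) 0) => [-> _|_ /(_ isT) hw].
    by rewrite mulr0 subr0 -signr_odd (negPf ho) expr0 mul1r.
  have -> : (m <= a0 + x)%N = false.
    move: hs ho hw => /= hs ho; rewrite uphalf_half mulnDl.
    move: hs ho; rewrite mulSn negbK => hs /negPf ->.
    by move: ((size t)./2 * m)%N hs => ? ?; lia.
  by rewrite mul0r subr0 -signr_odd (negPf ho) expr0 mul1r.
- by case/andP: h.
- by move: ho => /=; rewrite negbK.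
- by case/andP: h.
- by move: hs => /=; lia.
Qed.
End Words.
Arguments small : simpl never.

(** * Components of a subgraph of the polygon *)

Section Gaps.
Variable n : nat.
Implicit Types (s : {set 'I_n}) (e u v : 'I_n).

Definition gaps_below s (v : nat) : nat := \sum_(g : 'I_n | g \notin s) (g < v)%N.

(* The components are numbered along the cycle, the one of vertex 0 (which
   continues after the last gap) being number 0. *)
Definition comp_rank s (v : nat) : nat :=
  if gaps_below s v == #|~: s| then 0%N else gaps_below s v.

Lemma gaps_below0 s : gaps_below s 0 = 0%N.
Proof. exact: big1. Qed.

Lemma gaps_below_full s (v : nat) : (n <= v)%N -> gaps_below s v = #|~: s|.
Proof.
move=> nv; rewrite -sum1_card /gaps_below.
by apply: eq_big => [g|g _]; rewrite ?inE // (leq_trans (ltn_ord g) nv).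
Qed.

Lemma gaps_belowS s e : gaps_below s e.+1 = ((e \notin s) + gaps_below s e)%N.
Proof.
rewrite /gaps_below; case: (boolP (e \in s)) => es /=.
  apply: eq_bigr => g gs; congr nat_of_bool; rewrite ltnS leq_eqVlt val_eqE.
  by case: eqVneq => // ge; rewrite ge es in gs.
rewrite (bigD1 e) //= ltnS leqnn; congr addn.
rewrite [RHS](bigD1 e) //= ltnn add0n; apply: eq_bigr => g /andP[_ ge].
by rewrite ltnS leq_eqVlt val_eqE (negPf ge).
Qed.

Lemma leq_gaps_below s (u v : nat) : (u <= v)%N -> (gaps_below s u <= gaps_below s v)%N.
Proof.
by move=> uv; apply: leq_sum => g _; case: (ltnP g u) => // gu; rewrite (leq_trans gu uv).
Qed.

Lemma gaps_below_le s (v : nat) : (gaps_below s v <= #|~: s|)%N.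
Proof.
by rewrite -(@gaps_below_full s (maxn n v)) ?leq_maxl // leq_gaps_below ?leq_maxr.
Qed.

Lemma gaps_below_lt s e (v : nat) : e \notin s ->
  (gaps_below s e < gaps_below s v)%N = (e < v)%N.
Proof.
move=> es; apply/idP/idP => [|ev]; last first.
  by apply: leq_trans (leq_gaps_below s ev); rewrite gaps_belowS es.
by apply: contraTT; rewrite -!leqNgt => /leq_gaps_below.
Qed.

Lemma gaps_below_lt_card s e : e \notin s -> (gaps_below s e < #|~: s|)%N.
Proof. by move=> es; rewrite -(@gaps_below_full s n) // gaps_below_lt. Qed.

Lemma comp_rank_gap s e : e \notin s -> comp_rank s e = gaps_below s e.
Proof.
by move=> es; rewrite /comp_rank ltn_eqF // gaps_below_lt_card.
Qed.

Lemma comp_rank_ordS s e : e \in s -> comp_rank s (ordS e) = comp_rank s e.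
Proof.
move=> es; rewrite /comp_rank /=.
have E : gaps_below s e.+1 = gaps_below s e by rewrite gaps_belowS es.
case: (ltnP e.+1 n) => h; first by rewrite modn_small // E.
have -> : e.+1 = n by have := ltn_ord e; lia.
rewrite modnn gaps_below0; rewrite (gaps_below_full _ h) in E.
by rewrite -E eqxx; case: eqP.
Qed.

Lemma comp_rank_lt s (v : nat) : (comp_rank s v < maxn 1 #|~: s|)%N.
Proof.
rewrite /comp_rank; case: eqVneq => [_|h]; first by rewrite leq_max.
by rewrite leq_max [X in _ || X]ltn_neqAle h gaps_below_le orbT.
Qed.

Lemma adjacent_sym s : symmetric (adjacent s).
Proof.
by move=> u v; apply/existsP/existsP => -[e he]; exists e; rewrite orbC.
Qed.

Lemma connect_adj_sym s : connect_sym (adjacent s).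
Proof. exact: sym_connect_sym (adjacent_sym s). Qed.

Lemma adjacent_ordS s e : e \in s -> adjacent s e (ordS e).
Proof. by move=> es; apply/exists_inP; exists e; rewrite ?eqxx. Qed.

Lemma connect_up s u v : (u <= v)%N -> gaps_below s u = gaps_below s v ->
  connect (adjacent s) u v.
Proof.
have [k] := ubnP (v - u); elim: k u => // k IH u hk uv E.
have [->|nuv] := eqVneq u v; first exact: connect0.
have {nuv}uv : (u < v)%N by rewrite ltn_neqAle uv andbT.
have us : u \in s.
  apply: contraTT uv => us; rewrite -(gaps_below_lt _ us) E ltnn //.
have uS : ordS u = u.+1 :> nat by rewrite /= modn_small // (leq_ltn_trans uv).
apply: connect_trans (connect1 (adjacent_ordS us)) _.
apply: IH; rewrite uS //; first by lia.
by rewrite gaps_belowS us.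
Qed.

Lemma connect_wrap s u v : (v : nat) = 0%N -> gaps_below s u = #|~: s| ->
  connect (adjacent s) u v.
Proof.
move=> v0 E; have n_gt0 : (0 < n)%N by apply: leq_trans (ltn_ord u).
have hl : (n.-1 < n)%N by rewrite prednK.
pose l := Ordinal hl.
have ul : (u <= l)%N by rewrite /= -ltnS prednK.
have El : gaps_below s l = #|~: s|.
  by apply/eqP; rewrite eqn_leq gaps_below_le -E leq_gaps_below.
have ls : l \in s.
  by apply/negPn/negP => /gaps_below_lt_card; rewrite El ltnn.
apply: connect_trans (connect_up ul _) _; first by rewrite E.
have -> : v = ordS l by apply: val_inj => /=; rewrite v0 prednK // modnn.
exact: connect1 (adjacent_ordS ls).
Qed.

Lemma connect_comp_rank s u v :
  connect (adjacent s) u v = (comp_rank s u == comp_rank s v).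
Proof.
apply/idP/eqP => [|E].
  case/connectP => p; elim: p u => [|w p IH] u /=; first by move=> _ ->.
  case/andP => /exists_inP[e es] uw pw lw; rewrite -(IH w pw lw).
  by case/orP: uw => /andP[/eqP-> /eqP->]; rewrite comp_rank_ordS.
have n_gt0 : (0 < n)%N by apply: leq_trans (ltn_ord u).
pose z := Ordinal n_gt0.
(* Every vertex after the last gap is replaced by vertex 0; for the remaining ones the rank is the
   number of gaps below. *)
suff key w : exists w', [/\ connect (adjacent s) w w' & gaps_below s w' = comp_rank s w].
  have [u' [uu' Eu]] := key u; have [v' [vv' Ev]] := key v.
  have uv' : gaps_below s u' = gaps_below s v' by rewrite Eu Ev.
  apply: connect_trans uu' _; rewrite connect_adj_sym.
  apply: connect_trans vv' _.
  case: (leqP v' u') => h; first exact: connect_up.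
  by rewrite connect_adj_sym connect_up // ltnW.
rewrite /comp_rank; case: eqVneq => [h|h]; last by exists w; rewrite connect0.
by exists z; split; [apply: connect_wrap | rewrite gaps_below0].
Qed.

(* The effect on comp_rank of adding the r-th of q gaps. *)
Definition collapse (q r k : nat) : nat :=
  let k' := if (k <= r)%N then k else k.-1 in if k'.+1 == q then 0%N else k'.

Lemma card_setCU1 s e : e \notin s -> #|~: (e |: s)|.+1 = #|~: s|.
Proof.
move=> es; rewrite [in RHS](cardsD1 e) inE es add1n; congr (_.+1).
by congr #|pred_of_set _|; apply/setP => g; rewrite !inE negb_or.
Qed.

Lemma gaps_belowU1 s e (v : nat) : e \notin s ->
  gaps_below s v = ((e < v)%N + gaps_below (e |: s) v)%N.
Proof.
move=> es; rewrite /gaps_below (bigD1 e) //=; congr addn.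
by apply: eq_bigl => g; rewrite !inE negb_or andbC.
Qed.

Lemma comp_rankU1 s e (v : nat) : e \notin s ->
  comp_rank (e |: s) v = collapse #|~: s| (gaps_below s e) (comp_rank s v).
Proof.
move=> es; rewrite /comp_rank /collapse -(card_setCU1 es) (gaps_belowU1 v es).
have := gaps_below_lt v es; rewrite (gaps_belowU1 v es) (gaps_belowU1 e es) ltnn add0n.
have := gaps_below_le (e |: s) v; have := gaps_below_le (e |: s) e.
move: (gaps_below _ v) (gaps_below _ e) (#|_|) => a b c.
move=> bc ac; case: (ltnP e v) => _; rewrite ?add1n ?add0n ?eqSS => h.
  case: (eqVneq a c) => [//|nac]; first by rewrite leq0n; case: ifP.
  have -> : (a.+1 <= b)%N = false by lia.
  by rewrite /= ?eqSS (negPf nac).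
have -> : (a == c.+1) = false by lia.
have -> : (a <= b)%N by lia.
by [].
Qed.
End Gaps.

Arguments collapse : simpl never.

Lemma size_merge_at r a : (r < size a)%N -> size (merge_at r a) = maxn 1 (size a).-1.
Proof.
move=> ra; rewrite /merge_at; case: ltnP => h.
  by rewrite size_merge_inner //; lia.
by case: a ra h => [|x [|y t]] //= _ _; rewrite size_belast; lia.
Qed.

Lemma nth_merge_inner r a k : (r.+1 < size a)%N ->
  nth 0%N (merge_inner r a) k =
  if (k < r)%N then nth 0%N a k
  else if k == r then (nth 0%N a r + nth 0%N a r.+1)%N else nth 0%N a k.+1.
Proof.
elim: r a k => [|r IH] [|x t] k //=; first by case: t => // y t _; case: k.
by rewrite ltnS => h; case: k => //= k; rewrite IH // ltnS eqSS.
Qed.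

(** Relates the merge of words to the renumbering of components by [collapse]: it is the edge map
    read off on labels. *)
Lemma nth_merge_at r a k : (r < size a)%N -> (k < size (merge_at r a))%N ->
  nth 0%N (merge_at r a) k =
  \sum_(i < size a | collapse (size a) r i == k) nth 0%N a i.
Proof.
move=> ra; rewrite size_merge_at // => kq.
case: (ltnP r.+1 (size a)) => h.
  rewrite merge_atE // nth_merge_inner //.
  have E (i : 'I_(size a)) : collapse (size a) r i = if (i <= r)%N then i : nat else i.-1.
    by have := ltn_ord i; rewrite /collapse; case: (leqP i r) => hi ia; case: eqP => [?|_] //; lia.
  have hk : (k < size a)%N by lia.
  have hk1 : (k.+1 < size a)%N by lia.
  case: ltngtP => kr.
  - rewrite (big_pred1 (Ordinal hk)) // => i /=; rewrite E /= -val_eqE /=.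
    by case: (leqP i r) => hi; apply/eqP/eqP; lia.
  - rewrite (big_pred1 (Ordinal hk1)) // => i /=; rewrite E /= -val_eqE /=.
    by case: (leqP i r) => hi; apply/eqP/eqP; lia.
  - rewrite (bigD1 (Ordinal ra)) /=; last by have /= -> := E (Ordinal ra); rewrite leqnn kr.
    congr addn; rewrite (big_pred1 (Ordinal h)) // => i /=; rewrite E /= -!val_eqE /=.
    by case: (leqP i r) => hi; apply/andP/eqP => [[/eqP e1 /eqP e2]|e1]; try split;
      try apply/eqP; lia.
have er : size a = r.+1 by lia.
have E (i : 'I_(size a)) : collapse (size a) r i = if i.+1 == size a then 0%N else i.
  by have := ltn_ord i; rewrite /collapse; case: (leqP i r) => [//|?]; lia.
case: a ra h kq er E => [|x t] //; case/lastP: t => [|t y] ra h kq er E.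
  rewrite /merge_at /=; have -> : k = 0%N by move: kq => /=; lia.
  by rewrite (big_pred1 ord0) // => i /=; rewrite E (ord1 i) /=.
have ht : size (x :: rcons t y) = (size t).+2 by rewrite /= size_rcons.
have hr : r = (size t).+1 by move: er; rewrite ht; lia.
rewrite {r}hr in ra h er E kq *.
rewrite merge_at_last //.
case: k kq => [|k] kq.
  have h0 : (0 < size (x :: rcons t y))%N by [].
  rewrite (bigD1 (Ordinal h0)) /=; last by have /= -> := E (Ordinal h0); case: ifP.
  congr addn; rewrite (big_pred1 (Ordinal ra)) /=.
    by rewrite nth_rcons ltnn eqxx.
  move=> i /=; rewrite E -!val_eqE.
rewrite (_ : (i.+1 == size (x :: rcons t y)) = (i.+1 == (size t).+2)) /=; last by congr (_ == _).
  have h2 := leq_trans (ltn_ord i) (eq_leq ht).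
  by case: ifP => h1; apply/andP/eqP => [[/eqP e1 /eqP e2]|e1];
    try split; try apply/eqP; lia.
have hk : (k.+1 < size (x :: rcons t y))%N by move: kq; rewrite ht /=; lia.
rewrite (big_pred1 (Ordinal hk)) /=.
  by rewrite nth_rcons; have -> : (k < size t)%N by move: kq; rewrite ht /=; lia.
move=> i /=; rewrite E -!val_eqE.
rewrite (_ : (i.+1 == size (x :: rcons t y)) = (i.+1 == (size t).+2)) /=; last by congr (_ == _).
by move: kq; rewrite ht; case: ifP => h1 h2; apply/eqP/eqP; lia.
Qed.

Section Components.
Variables (n : nat).
Hypothesis n_gt0 : (0 < n)%N.
Implicit Types (s : {set 'I_n}) (e u v : 'I_n).

Lemma connect_adj_equiv s :
  {in [set: 'I_n] & &, equivalence_rel (connect (adjacent s))}.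
Proof.
by move=> u v w _ _ _; split=> // uv; exact: (same_connect (@connect_adj_sym _ s) uv).
Qed.

Definition component_rank s (c : component s) : nat :=
  if [pick u in vertices c] is Some u then comp_rank s u else 0%N.

Lemma mem_vertices s (c : component s) v :
  (v \in vertices c) = (comp_rank s v == component_rank c).
Proof.
have part := equivalence_partitionP (connect_adj_equiv s).
have [/eqP _ triv n0] := and3P part.
have classP u w : u \in vertices c -> (w \in vertices c) = connect (adjacent s) u w.
  move=> uc; rewrite -(def_pblock triv (svalP c : vertices c \in _) uc).
  by rewrite (pblock_equivalence_partition (connect_adj_equiv s)) ?inE.
have [u uc] : exists u, u \in vertices c.
  by apply/set0Pn; apply: contraNneq n0 => <-; exact: (svalP c).
rewrite /component_rank; case: pickP => [w wc|/(_ u)]; last by rewrite uc.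
by rewrite (classP w) // connect_comp_rank eq_sym.
Qed.

Lemma component_rank_inj s : injective (@component_rank s).
Proof.
move=> c c' E; apply: val_inj; apply/setP => v.
by rewrite -!/(vertices _) !mem_vertices E.
Qed.

Lemma component_vertex s (c : component s) : exists v, v \in vertices c.
Proof.
have [_ _ n0] := and3P (equivalence_partitionP (connect_adj_equiv s)).
by apply/set0Pn; apply: contraNneq n0 => <-; exact: (svalP c).
Qed.

Lemma component_rank_lt s (c : component s) : (component_rank c < maxn 1 #|~: s|)%N.
Proof.
have [v] := component_vertex c; rewrite mem_vertices => /eqP <-.
exact: comp_rank_lt.
Qed.

Lemma gap_at s k : (k < #|~: s|)%N -> exists2 e, e \notin s & gaps_below s e = k.
Proof.
rewrite -(gaps_below_full s (leqnn n)) => kn.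
suff H (v : nat) : (v <= n)%N -> (k < gaps_below s v)%N ->
    exists2 e, e \notin s & gaps_below s e = k by exact: H (leqnn n) kn.
elim: v => [|v IH] vn; first by rewrite gaps_below0.
rewrite (gaps_belowS s (Ordinal vn)) /=.
case: (ltnP k (gaps_below s v)) => [h _|h]; first by apply: IH => //; apply: ltnW.
case: (boolP (Ordinal vn \in s)) => hv /=; first by rewrite ltnNge h.
by rewrite add1n ltnS => h'; exists (Ordinal vn) => //=; apply/eqP; rewrite eqn_leq h h'.
Qed.

Lemma component_of_rank s k : (k < maxn 1 #|~: s|)%N ->
  exists c : component s, component_rank c = k.
Proof.
move=> kq; have [v <-] : exists v, comp_rank s v = k.
  case: (posnP #|~: s|) => q0; last first.
    have [|e es <-] := @gap_at s k; first by lia.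
    by exists e; rewrite comp_rank_gap.
  exists (Ordinal n_gt0); rewrite /comp_rank gaps_below0 q0 eqxx.
  by move: kq; rewrite q0 maxn0; case: k.
have part := equivalence_partitionP (connect_adj_equiv s).
have [/eqP cov triv _] := and3P part.
have vc : v \in cover (components s) by rewrite cov inE.
exists (exist (fun A : {set _} => A \in components s) _ (pblock_mem vc)).
by apply/eqP; rewrite eq_sym -mem_vertices /vertices /= mem_pblock.
Qed.

Lemma vertices_subset s e (c : component s) (c' : component (e |: s)) : e \notin s ->
  (vertices c \subset vertices c') =
  (collapse #|~: s| (gaps_below s e) (component_rank c) == component_rank c').
Proof.
move=> es; have [u uc] := component_vertex c.
have := uc; rewrite mem_vertices => /eqP <-; rewrite -comp_rankU1 // -mem_vertices.
apply/subsetP/idP => [|uc' v vc]; first exact.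
move: uc' uc vc; rewrite !mem_vertices => /eqP <- /eqP <- /eqP E.
by rewrite !comp_rankU1 // E.
Qed.
End Components.

(** * The differential on labelled cells *)

Section Labels.
Variables (m n : nat).
Hypotheses (m_gt0 : (0 < m)%N) (n_gt0 : (0 < n)%N).
Notation state := (state m n).
Implicit Types (s : {set 'I_n}) (x y : state).

(** Each sum has one term, as [component_rank] is injective; this avoids choosing the component of a
    given number. Without gaps, as with one gap, there is one component, hence [maxn 1]. *)
Definition labels x : seq nat :=
  mkseq (fun k => \sum_(c | component_rank c == k) (tagged x c : nat))%N
        (maxn 1 #|~: tag x|).

Lemma size_labels x : size (labels x) = maxn 1 #|~: tag x|.
Proof. by rewrite size_mkseq. Qed.

Lemma nth_labels x (c : component (tag x)) :
  nth 0%N (labels x) (component_rank c) = tagged x c.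
Proof.
rewrite nth_mkseq ?component_rank_lt // (big_pred1 c) // => c' /=.
by rewrite (inj_eq (@component_rank_inj _ _)).
Qed.

Lemma labels_small x : small m (labels x).
Proof.
apply/(all_nthP 0%N) => k; rewrite size_labels => /(component_of_rank n_gt0)[c <-].
by rewrite nth_labels.
Qed.

Lemma sumn_labels x : sumn (labels x) = state_degree x.
Proof.
rewrite sumnE /state_degree big_map -[X in iota 0 X](subn0 (maxn 1 _)).
rewrite -/(index_iota 0 _) big_mkord.
rewrite (partition_big (fun c => Ordinal (component_rank_lt c)) predT) //=.
Qed.

Lemma labels_inj x y : tag x = tag y -> labels x = labels y -> x = y.
Proof.
case: x y => s f [s' f'] /= ss; case: s' / ss f' => f' E.
congr Tagged; apply/ffunP => c; apply: val_inj => /=.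
have := @nth_labels (Tagged (fun s => {ffun component s -> 'I_m}) f) c; rewrite /= => <-.
by have := @nth_labels (Tagged (fun s => {ffun component s -> 'I_m}) f') c; rewrite /= => <-; rewrite E.
Qed.

Lemma state_of_labels s a : size a = maxn 1 #|~: s| -> small m a ->
  exists2 x : state, tag x = s & labels x = a.
Proof.
move=> sa sm.
have hlt (c : component s) : (nth 0%N a (component_rank c) < m)%N.
  by apply: (allP sm); rewrite mem_nth // sa component_rank_lt.
exists (Tagged (fun s => {ffun component s -> 'I_m}) [ffun c => Ordinal (hlt c)]) => //.
apply: (@eq_from_nth _ 0%N); first by rewrite size_labels.
move=> k; rewrite size_labels => /(component_of_rank n_gt0)[c <-].
by rewrite nth_labels /= ffunE.
Qed.
End Labels.
Global Opaque labels.

Section Diff.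
Variables (m n : nat) (prec : rel 'I_n).
Hypotheses (m_gt0 : (0 < m)%N) (n_gt0 : (0 < n)%N).
Implicit Types (s : {set 'I_n}).

Lemma tcoef_tX_exp k (i : 'I_m) : tcoef (tX m ^+ k) i = (i == k :> nat)%:R.
Proof.
case: (ltnP k m) => km; first by rewrite (tcoef_tXn m_gt0 (Ordinal km)).
have -> : tX m ^+ k = 0.
  have E : tX m ^+ m = in_qpoly 'X^m 'X^m by rewrite [RHS]rmorphXn.
  rewrite -(subnK km) exprD E.
  have -> : in_qpoly 'X^m 'X^m = 0 :> truncpoly m.
    apply: val_inj; rewrite /= mk_monicXm // Pdiv.RingMonic.rmodpp ?monicXn //.
  by rewrite mulr0.
rewrite [LHS]coef0 ltn_eqF //; exact: leq_trans km.
Qed.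

Definition merges s s' (f : {ffun component s -> 'I_m}) (f' : {ffun component s' -> 'I_m}) :=
  [forall c', (\sum_(c | vertices c \subset vertices c') (f c : nat))%N == f' c'].

Lemma edge_mapE s s' (w : Phi m s) f' :
  edge_map s' w f' = \sum_f w f * (merges f f')%:R.
Proof.
rewrite /edge_map sum_ffunE; apply: eq_bigr => f _.
rewrite ffunMzE mulrzz mulrC; congr (_ * _).
rewrite ffunE; under eq_bigr => c' _.
  rewrite ffunE; under eq_bigr => c _ do rewrite ffunE.
  rewrite -(big_morph _ (exprD (tX m)) (expr0 _)) tcoef_tX_exp eq_sym.
  over.
case: (boolP (merges f f')) => [/forallP h|].
  by rewrite big1 // => c' _; rewrite h.
rewrite negb_forall => /existsP[c' /negPf h].
by rewrite (bigD1 c') //= h mul0r.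
Qed.

Notation mk f := (Tagged (fun s => {ffun component s -> 'I_m}) f).

Lemma merges_labels s e (f : {ffun component s -> 'I_m})
    (f' : {ffun component (e |: s) -> 'I_m}) : e \notin s ->
  merges f f' = (labels (mk f') == merge_at (gaps_below s e) (labels (mk f))).
Proof.
move=> es.
have sl : size (labels (mk f)) = #|~: s|.
  by rewrite size_labels /= -(card_setCU1 es); lia.
have rlt : (gaps_below s e < size (labels (mk f)))%N by rewrite sl gaps_below_lt_card.
have E (c' : component (e |: s)) :
  nth 0%N (merge_at (gaps_below s e) (labels (mk f))) (component_rank c') =
  (\sum_(c | vertices c \subset vertices c') (f c : nat))%N.
  rewrite nth_merge_at //; last first.
    by rewrite size_merge_at // sl -(card_setCU1 es) component_rank_lt.
  rewrite (eq_bigl _ _ (fun c => vertices_subset c c' es)) sl.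
  have ltc (c : component s) : (component_rank c < #|~: s|)%N.
    by have := component_rank_lt c; rewrite -(card_setCU1 es); lia.
  rewrite [RHS](partition_big (fun c => Ordinal (ltc c))
     (fun i => collapse #|~: s| (gaps_below s e) i == component_rank c')) //=.
  apply: eq_bigr => k /eqP hk.
  rewrite nth_mkseq; last first.
    by apply: leq_trans (ltn_ord k) _; rewrite leq_max leqnn orbT.
  apply: eq_bigl => c; rewrite -val_eqE /= andbC.
  by case: eqP => //= ->; rewrite hk eqxx.
apply/forallP/eqP => [h|h c'].
  apply: (@eq_from_nth _ 0%N).
    by rewrite size_labels size_merge_at //= sl -(card_setCU1 es).
  move=> k; rewrite size_labels /= => /(component_of_rank n_gt0)[c' <-].
  by rewrite E (eqP (h c')) (nth_labels (x := mk f')).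
by rewrite -E -h (nth_labels (x := mk f')).
Qed.

Lemma merges_tagged s e (f : {ffun component s -> 'I_m}) (y : state m n) :
  e \notin s -> tag y = e |: s ->
  merges f (tagged y) = (labels y == merge_at (gaps_below s e) (labels (mk f))).
Proof. by case: y => s' f' es /= E; rewrite E in f' *; apply: merges_labels. Qed.

Definition incident (x y : state m n) (e : 'I_n) : bool :=
  [&& e \notin tag x, tag y == e |: tag x &
      labels y == merge_at (gaps_below (tag x) e) (labels x)].

Lemma diffE (c : cochain m n) y :
  diff prec c y =
  \sum_x c x * \sum_(e | incident x y e) (-1) ^+ num_smaller prec (tag x) e.
Proof.
rewrite ffunE /diff_at sum_ffunE.
under [RHS]eq_bigr => x _ do rewrite big_distrr big_mkcond /=.
rewrite exchange_big /=.
rewrite [RHS](bigID (mem (tag y))) /= [X in _ = _ + X]big1 ?addr0; last first.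
  move=> e ey; rewrite big1 // => x _; case: ifP => // /and3P[_ /eqP ty].
  by rewrite ty !inE eqxx in ey.
apply: eq_bigr => e ey; rewrite ffunMzE.
have es : e \notin tag y :\ e by rewrite !inE eqxx.
rewrite edge_mapE.
rewrite -big_mkcond /=.
rewrite (eq_bigl (fun x => (tag x == tag y :\ e) && (incident x y e))); last first.
  move=> x; rewrite /incident; case: (boolP (e \in tag x)) => /= ex; first by rewrite andbF.
  case: (eqVneq (tag y)) => [ty|ny] /=; last by rewrite andbF.
  suff -> : tag x == tag y :\ e by [].
  by rewrite ty setU1K.
rewrite big_mkcondr /=.
have -> : \sum_(x | tag x == tag y :\ e)
    (if incident x y e then c x * (-1) ^+ num_smaller prec (tag x) e else 0) =
  \sum_(s | s == tag y :\ e) \sum_(f : {ffun component s -> 'I_m})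
    (if incident (mk f) y e then c (mk f) * (-1) ^+ num_smaller prec s e else 0).
  rewrite (@sig_big_dep _ _ _ _ (fun s => {ffun component s -> 'I_m})
    (pred1 (tag y :\ e)) (fun _ _ => true) (fun s (f : {ffun component s -> 'I_m}) =>
    if incident (mk f) y e then c (mk f) * (-1) ^+ num_smaller prec s e else 0)).
  by apply: eq_big => [[s f]|[s f] _] //=; rewrite andbT.
rewrite big_pred1_eq mulrzz mulr_suml.
apply: eq_bigr => f _; rewrite ffunE /incident /= es.
have ty : tag y = e |: (tag y :\ e) by rewrite setD1K.
rewrite -ty eqxx /= -merges_tagged //; case: (merges _ _); first by rewrite mulr1.
by rewrite mulr0 mul0r.
Qed.

End Diff.

(** * Signs: from the order of the edges to the number of gaps *)

Section Gauge.
Variables (n : nat) (prec : rel 'I_n).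
Hypothesis precP : strict_linear_order prec.
Implicit Types (s : {set 'I_n}) (e : 'I_n).

Lemma prec_asym e e' : e != e' -> (prec e e' + prec e' e = 1)%N.
Proof.
have [irr tr tot] := precP; move=> ne.
have := tot _ _ ne; case: (boolP (prec e e')) => h1; case: (boolP (prec e' e)) => h2 //=.
by have := tr _ _ _ h1 h2; rewrite irr.
Qed.

Lemma num_smallerE s e : num_smaller prec s e = (\sum_(e' in s) prec e' e)%N.
Proof.
rewrite /num_smaller -sum1_card big_mkcond [RHS]big_mkcond /=.
by apply: eq_bigr => e' _; rewrite !inE; case: (e' \in s); case: prec.
Qed.

Lemma gaps_below_full_ord e : (\sum_(g : 'I_n) (g < e) = e)%N.
Proof.
suff H (v : nat) : (v <= n -> \sum_(g : 'I_n) (g < v) = v)%N.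
  by rewrite H // ltnW.
elim: v => [|v IH] vn; first exact: big1.
rewrite (bigD1 (Ordinal vn)) //= ltnSn add1n; congr _.+1.
rewrite -[RHS](IH (ltnW vn)) [RHS](bigD1 (Ordinal vn)) //= ltnn add0n.
apply: eq_bigr => g; rewrite -val_eqE /= => gv.
by rewrite ltnS leq_eqVlt (negPf gv).
Qed.

(* Multiplying by gauge replaces the sign of the edge e in the differential,
   which depends on prec, by the parity of the number of gaps below e. *)
Definition gauge_exp s : nat :=
  (\sum_(e in s) (e + \sum_(e' in s) ((e' < e) && prec e e')))%N.

Definition gauge s : int := (-1) ^+ gauge_exp s.

Lemma gauge_sq s : gauge s * gauge s = 1.
Proof. by rewrite -expr2 sqrr_sign. Qed.

Lemma gauge_neq0 s : gauge s != 0.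
Proof. by rewrite /gauge signr_eq0. Qed.

(** The inner sum of [gauge_exp] counts the inversions of [prec] against the numerical order of the
    edges. The correction is even, so the sign exponents agree modulo 2. *)
Lemma gauge_exp_add s e : e \notin s ->
  (gauge_exp (e |: s) + num_smaller prec s e = gauge_exp s + gaps_below s e +
     2 * \sum_(e' in s) (if e' < e then 1 else prec e' e))%N.
Proof.
move=> es; rewrite /gauge_exp big_setU1 //= big_setU1 //= ltnn add0n.
have -> : (\sum_(e1 in s) (e1 + \sum_(e' in e |: s) ((e' < e1) && prec e1 e')) =
   \sum_(e1 in s) ((e < e1) && prec e1 e) +
   \sum_(e1 in s) (e1 + \sum_(e' in s) ((e' < e1) && prec e1 e')))%N.
  rewrite -big_split; apply: eq_bigr => e1 _ /=.
  by rewrite big_setU1 //= addnCA.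
rewrite num_smallerE.
(* The edges below [e] are gaps or belong to [s]: for this reason [gauge_exp] contains the summand
   [e]. *)
have H1 : (e : nat) = (gaps_below s e + \sum_(g in s) (g < e)%N)%N.
  rewrite /gaps_below addnC -(bigID (mem s) predT (fun g : 'I_n => (g < e)%N : nat)) /=.
  by rewrite gaps_below_full_ord.
have H2 : (2 * \sum_(e' in s) (if e' < e then 1 else prec e' e) =
  \sum_(g in s) (g < e)%N + \sum_(e' in s) ((e' < e) && prec e e') +
  \sum_(e1 in s) ((e < e1) && prec e1 e) + \sum_(e' in s) prec e' e)%N.
  rewrite -!big_split big_distrr /=; apply: eq_bigr => g gs.
  have ge : g != e by apply: contraNneq es => <-.
  have := prec_asym ge; case: ltngtP => h /=; last by rewrite (val_inj h) eqxx in ge.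
    by case: (prec g e); case: (prec e g).
  by case: (prec g e); case: (prec e g).
rewrite H2 {1}H1; ring.
Qed.

Lemma gauge_add s e : e \notin s ->
  gauge (e |: s) * (-1) ^+ num_smaller prec s e = gauge s * (-1) ^+ gaps_below s e.
Proof.
move=> es; rewrite /gauge -!exprD gauge_exp_add //.
by rewrite exprD exprM sqrrN expr1n mulr1.
Qed.
End Gauge.

Lemma sum_gaps n (s : {set 'I_n}) (F : nat -> int) :
  \sum_(e | e \notin s) F (gaps_below s e) = \sum_(0 <= r < #|~: s|) F r.
Proof.
rewrite -(gaps_below_full s (leqnn n)).
suff H (v : nat) : (v <= n)%N -> \sum_(e : 'I_n | (e \notin s) && (e < v)%N) F (gaps_below s e) =
    \sum_(0 <= r < gaps_below s v) F r.
  by rewrite -H //; apply: eq_bigl => e; rewrite ltn_ord andbT.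
elim: v => [|v IH] vn; first by rewrite gaps_below0 big_nil big1 // => e /andP[].
pose o := Ordinal vn; rewrite (gaps_belowS s o) /=.
case: (boolP (o \in s)) => os.
  rewrite -IH 1?ltnW //; apply: eq_bigl => e.
  rewrite [in LHS]ltnS leq_eqVlt.
  case: (eqVneq (e : nat) v) => ev //=; rewrite ltn_neqAle ev eqxx /= andbF.
  by have -> : e = o by [apply: val_inj]; rewrite os.
rewrite add1n big_nat_recr //= -IH 1?ltnW // (bigD1 o) /= ?os ?leqnn // addrC.
congr (_ + _); apply: eq_bigl => e.
by rewrite ltnS [in RHS]ltn_neqAle -val_eqE /= -andbA [(e <= v)%N && _]andbC.
Qed.

(** * The differential squares to zero *)

Section DiffDiff.
Variables (m n : nat) (prec : rel 'I_n).
Hypotheses (m_gt0 : (0 < m)%N) (precP : strict_linear_order prec).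
Implicit Types (s : {set 'I_n}) (e : 'I_n).

Lemma merge_merge s s' s'' (a : {ffun component s -> truncpoly m}) :
  s \subset s' -> s' \subset s'' -> Defs.merge s'' (Defs.merge s' a) = Defs.merge s'' a.
Proof.
move=> ss' s's''; apply/ffunP => c''; rewrite !ffunE.
have [F F1 F2] := fin_all_exists2 (fun c : component s => component_sub c ss').
rewrite [RHS](partition_big F (fun c' => vertices c' \subset vertices c'')) /=.
  apply: eq_bigr => c' c'c''; rewrite ffunE; apply: eq_bigl => c.
  apply/idP/andP => [cc'|[_ /eqP <-]]; last exact: F1.
  by split; [apply: subset_trans c'c'' | rewrite (F2 _ _ cc')].
move=> c cc''; have [c1 c1F c1u] := component_sub (F c) s's''.
suff -> : c'' = c1 by [].
have [c2 c2F c2u] := component_sub c (subset_trans ss' s's'').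
by rewrite (c2u _ cc'') (c2u c1) // (subset_trans (F1 c)).
Qed.

Lemma edge_map_comp s s' s'' (w : Phi m s) :
  s \subset s' -> s' \subset s'' -> edge_map s'' (edge_map s' w) = edge_map s'' w.
Proof.
move=> ss' s's''.
transitivity (\sum_f edge_map s'' (tens (Defs.merge s' (tmon f))) *~ w f).
  apply: etrans (raddf_sum _ _ _ _) _; apply: eq_bigr => f _; exact: raddfMz.
apply: eq_bigr => f _; congr (_ *~ _).
by apply: etrans (edge_map_tens m_gt0 s's'' _) _; rewrite merge_merge.
Qed.

(** Adding two edges in either order gives the same composite map. The signs are opposite, because
    exactly one of the two edges precedes the other. *)
Lemma diff_diff (c : cochain m n) : diff prec (diff prec c) = 0.
Proof.
apply/ffunP => -[s f]; rewrite !ffunE /=.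
pose G s' := edge_map s (proj s' c) f.
pose A e e' : nat := (num_smaller prec (s :\ e :\ e') e' + num_smaller prec (s :\ e) e)%N.
have E : diff_at prec s (diff prec c) f =
   \sum_(e in s) \sum_(e' in s :\ e) G (s :\ e :\ e') * (-1) ^+ A e e'.
  rewrite /diff_at sum_ffunE; apply: eq_bigr => e es.
  have -> : proj (s :\ e) (diff prec c) = diff_at prec (s :\ e) c.
    by apply/ffunP => f'; rewrite !ffunE.
  rewrite raddf_sum /= ffunMzE sum_ffunE mulrzz mulr_suml.
  apply: eq_bigr => e' e's; rewrite raddfMz /= edge_map_comp ?subsetDl //.
  by rewrite ffunMzE mulrzz -mulrA -exprD.
rewrite E; set S := LHS.
(* The exchange of [e] and [e'] changes the sign of every term. *)
suff SS : S = - S by lia.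
rewrite {2}/S -sumrN.
have -> : S = \sum_(e | e \in s) \sum_(e' | (e' \in s) && (e' != e)) G (s :\ e :\ e') * (-1) ^+ A e e'.
  by apply: eq_bigr => e _; apply: eq_bigl => e'; rewrite !inE andbC.
rewrite (exchange_big_dep (mem s)) /=; last by move=> e e' _ /andP[].
apply: eq_bigr => e' e's; rewrite -sumrN; apply: eq_big => [e|e /andP[es /andP[_ ne]]].
  by rewrite !inE e's /= andbC eq_sym.
have -> : s :\ e :\ e' = s :\ e' :\ e by rewrite !setDDl setUC.
rewrite -mulrN; congr (_ * _).
have [esn esn'] : e \notin s :\ e' :\ e /\ e' \notin s :\ e :\ e' by rewrite !inE !eqxx.
have B e1 e2 : e1 \in s -> e2 \in s -> e2 != e1 ->
    num_smaller prec (s :\ e1) e1 = (prec e2 e1 + num_smaller prec (s :\ e1 :\ e2) e1)%N.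
  move=> h1 h2 h; rewrite !num_smallerE (big_setD1 e2) //= !inE h h2 //.
rewrite /A (B e e') // (B e' e) 1?eq_sym //.
have -> : s :\ e' :\ e = s :\ e :\ e' by rewrite !setDDl setUC.
have := prec_asym precP ne.
move: (num_smaller _ _ e) (num_smaller _ _ e') => a b.
case: (prec e' e) (prec e e') => [] [] //= _; rewrite ?add0n ?add1n !(exprD, exprS); ring.
Qed.
End DiffDiff.

(** * The two matchings *)

Section Triangular.
Variables (X : finType) (L : pred X) (M : X -> nat) (A : X -> X -> int) (u : X -> int).
Hypothesis u_sq : forall x, u x * u x = 1.
Hypothesis A_tri : forall x y, L x -> L y -> (M y <= M x)%N -> A x y = u x * (x == y)%:R.

(** Besides the diagonal entry, row [x] involves only columns with larger [M], so the system is
    treated from the top value of [M] downwards. The diagonal entry [u x] is its own inverse, hence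
    no denominators. *)
Lemma triangular_inj (b : X -> int) :
  (forall x, L x -> \sum_(y | L y) A x y * b y = 0) -> forall x, L x -> b x = 0.
Proof.
move=> Ab x; pose B := (\sum_y M y)%N.
have MB y : (M y <= B)%N by rewrite /B (bigD1 y) //= leq_addr.
have [k] := ubnP (B - M x); elim: k x => // k IH x hk Lx.
have := Ab x Lx; rewrite (bigD1 x) //= A_tri // eqxx mulr1 big1 ?addr0 => [E|y /andP[Ly yx]].
  by rewrite -[b x]mul1r -(u_sq x) -mulrA E mulr0.
case: (leqP (M y) (M x)) => Myx; first by rewrite A_tri // eq_sym (negPf yx) mulr0 mul0r.
by rewrite (IH y) ?mulr0 //; have := MB y; have := MB x; lia.
Qed.

Lemma triangular_surj (phi : X -> int) :
  exists b : X -> int, forall x, L x -> \sum_(y | L y) A x y * b y = phi x.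
Proof.
pose B := (\sum_y M y)%N.
have MB y : (M y <= B)%N by rewrite /B (bigD1 y) //= leq_addr.
(* At stage [k] the equations at levels of [M] above [B - k] hold, with [b] supported on these
   levels. *)
suff H k : exists b : X -> int, (forall y, (M y + k <= B)%N -> b y = 0) /\
    (forall x, L x -> (B < M x + k)%N -> \sum_(y | L y) A x y * b y = phi x).
  have [b [_ hb]] := H B.+1; exists b => x Lx; apply: hb => //; lia.
elim: k => [|k [b [b0 bphi]]].
  by exists (fun _ => 0); split=> // x _; have := MB x; lia.
exists (fun y => if (M y + k == B)%N then u y * (phi y - \sum_(z | L z) A y z * b z) else b y).
split=> [y hy|x Lx hx].
  by rewrite ifN; [apply: b0; lia | apply/eqP; lia].
rewrite (bigD1 x) //= A_tri // eqxx mulr1.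
have E : \sum_(y | L y && (y != x)) A x y *
    (if (M y + k == B)%N then u y * (phi y - \sum_(z | L z) A y z * b z) else b y) =
    \sum_(y | L y && (y != x)) A x y * b y.
  apply: eq_bigr => y /andP[Ly yx]; case: eqP => // My.
  by rewrite A_tri //; [rewrite eq_sym (negPf yx) !(mulr0, mul0r) | lia].
rewrite E; case: eqP => hMx.
  rewrite mulrA u_sq mul1r (bigD1 x) //= b0 ?mulr0; last by lia.
  by rewrite add0r subrK.
rewrite -bphi //; last by lia.
by rewrite [RHS](bigD1 x) //= A_tri // eqxx mulr1.
Qed.
End Triangular.

Section Pairing.
Variables (m n : nat) (prec : rel 'I_n).
Hypotheses (m_gt0 : (0 < m)%N) (n_gt0 : (0 < n)%N) (precP : strict_linear_order prec).
Notation state := (state m n).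
Notation cochain := (cochain m n).

(** A functional on words, pulled back along the map that forgets the set of edges. The gauge makes
    this map compatible with the differentials. *)
Definition pairing (h : seq nat -> int) (c : cochain) : int :=
  \sum_(x : state) gauge prec (tag x) * h (labels x) * c x.

Lemma pairing_is_additive h : zmod_morphism (pairing h).
Proof.
by move=> c c'; rewrite /pairing -sumrB; apply: eq_bigr => x _; rewrite !ffunE mulrBr.
Qed.
HB.instance Definition _ h :=
  GRing.isZmodMorphism.Build cochain int (pairing h) (pairing_is_additive h).

Lemma incident_labels (x y : state) e : incident x y e ->
  [/\ e \notin tag x, tag y = e |: tag x &
      labels y = merge_at (gaps_below (tag x) e) (labels x)].
Proof. by case/and3P => -> /eqP -> /eqP ->. Qed.

Lemma incident_inj (x y z : state) e : incident x y e -> incident x z e -> y = z.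
Proof.
move=> /incident_labels[_ ty ly] /incident_labels[_ tz lz].
by apply: labels_inj; rewrite ?ty ?ly.
Qed.

Lemma size_labels_gap (x : state) e : e \notin tag x -> size (labels x) = #|~: tag x|.
Proof. by move=> ex; rewrite size_labels; apply/maxn_idPr; rewrite -(card_setCU1 ex). Qed.

Lemma incident_exists (x : state) e : e \notin tag x ->
  small m (merge_at (gaps_below (tag x) e) (labels x)) -> exists y, incident x y e.
Proof.
move=> ex sm.
have [||y ty ly] := @state_of_labels m n n_gt0 (e |: tag x) (merge_at (gaps_below (tag x) e) (labels x)).
- rewrite size_merge_at (size_labels_gap ex) ?gaps_below_lt_card //.
  by rewrite -(card_setCU1 ex).
- exact: sm.
by exists y; rewrite /incident ex ty ly !eqxx.
Qed.

(** The transpose of the differential is the alternating sum of all cyclic merges. The hypothesis on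
    [h] accounts for merges producing a letter at least m: these are 0 in the complex and label no
    cell. *)
Lemma pairing_diff h c : (forall a, ~~ small m a -> h a = 0) ->
  pairing h (diff prec c) = \sum_(x : state) c x * (gauge prec (tag x) *
    \sum_(0 <= r < #|~: tag x|) (-1) ^+ r * h (merge_at r (labels x))).
Proof.
move=> h0; rewrite /pairing.
under eq_bigr => y _ do rewrite (diffE prec m_gt0 n_gt0) mulr_sumr.
rewrite exchange_big /=; apply: eq_bigr => x _.
rewrite -(sum_gaps (tag x) (fun r => (-1) ^+ r * h (merge_at r (labels x)))).
rewrite mulr_sumr mulr_sumr.
under eq_bigr => y _ do rewrite mulrCA mulr_sumr mulr_sumr big_mkcond.
rewrite exchange_big /= [RHS]big_mkcond; apply: eq_bigr => e _.
case: (boolP (e \in tag x)) => ex /=.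
  by rewrite big1 // => y _; rewrite /incident ex.
rewrite -big_mkcond /=.
case: (boolP (small m (merge_at (gaps_below (tag x) e) (labels x)))) => sm.
  have [y ixy] := incident_exists ex sm.
  rewrite (big_pred1 y) => [|z]; last first.
    by apply/idP/eqP => [/incident_inj|->] //; apply.
  have [_ -> ->] := incident_labels ixy.
  congr (_ * _); rewrite mulrAC (gauge_add precP ex) //; ring.
rewrite h0 // !mulr0 big1 // => y /incident_labels[_ _ ly].
by rewrite h0 ?mulr0 ?mul0r ?mulr0 // ly.
Qed.

End Pairing.

(** The moment weights each letter by its position. Among the words with a given merge at [r], it is
    thus least when the right one of the two merged letters is 0. *)
Lemma merge_inner_zero_unique r a b : (r.+1 < size a)%N -> size b = size a ->
  nth 0%N a r.+1 = 0%N -> merge_inner r b = merge_inner r a ->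
  b = a \/ (moment a < moment b)%N.
Proof.
elim: r a b => [|r IH] [|x a] [|y b] //=.
  case: a b => [|x2 a] [|y2 b] //= _ _ -> [exy ->].
  by case: y2 exy => [|y2] exy; [left; congr [:: _, _ & _]; lia | right; lia].
rewrite ltnS => ra [sb] a0 [-> E]; case: (IH a b ra sb a0 E) => [->|lt]; first by left.
by right; rewrite -(sumn_merge_inner r b) E sumn_merge_inner; lia.
Qed.

Lemma gaps_below_initial n (s : {set 'I_n}) (v : nat) : (v <= n)%N ->
  (forall i : 'I_n, (i < v)%N -> i \notin s) -> gaps_below s v = v.
Proof.
elim: v => [|v IH] vn hv; first exact: gaps_below0.
rewrite (gaps_belowS s (Ordinal vn)) hv //= IH 1?ltnW // => i iv.
by apply: hv; rewrite ltnS ltnW.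
Qed.

Section Matching.
Variables (m n : nat).
Notation state := (state m n).
Notation cochain := (cochain m n).
Implicit Types (x y z : state) (c : cochain) (e : 'I_n).

(** Counted behind the head, so that it is the position at which this zero is merged to the left.
    Without a zero it is the length of the tail. *)
Definition first_zero x : nat := index 0%N (behead (labels x)).

Lemma labels_cons x : exists a0, labels x = a0 :: behead (labels x).
Proof.
have := size_labels x; case: (labels x) => [|a0 a] /=; first lia.
by exists a0.
Qed.

Hypothesis n_gt0 : (0 < n)%N.

Lemma card_gaps_le x : (#|~: tag x| <= n)%N.
Proof. by have := max_card (mem (~: tag x)); rewrite card_ord. Qed.

Lemma size_labels_le x : (size (labels x) <= n)%N.
Proof. by rewrite size_labels geq_max n_gt0 card_gaps_le. Qed.

Lemma first_zero_lt x : (first_zero x < n)%N.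
Proof.
have := size_labels_le x; have [a0 ->] := labels_cons x => /=.
by apply: leq_ltn_trans; apply: index_size.
Qed.

Definition first_zero_edge x : 'I_n := Ordinal (first_zero_lt x).

(* Adding the edge first_zero x merges the first zero label, other than the
   label of the component of vertex 0, into its left neighbour. The last
   disjunct matches the cells with 0 as only gap with those without gap. *)
Definition zero_lower x : bool :=
  [forall i : 'I_n, (i <= first_zero x)%N ==> (i \notin tag x)] &&
  ((first_zero x < size (behead (labels x)))%N || (#|~: tag x| == 1%N)).

Definition initial_gaps x : bool :=
  [forall i : 'I_n, (i \notin tag x) == (i < #|~: tag x|)%N].

Definition word_lower x : bool :=
  [&& initial_gaps x, letters m (behead (labels x)) &
      lower_word m (behead (labels x))].

Definition lower x := zero_lower x || word_lower x.

Lemma letters0 a : letters m a -> 0%N \notin a.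
Proof. by move=> h; apply/negP => /(allP h). Qed.

Lemma lower_word_size a : lower_word m a -> (1 < size a)%N.
Proof. by case: a => [|x [|y a]]. Qed.

Lemma card_gaps_word_lower x : word_lower x -> #|~: tag x| = size (labels x).
Proof.
case/and3P=> _ _ /lower_word_size; rewrite size_behead size_labels.
by rewrite /maxn; case: ifP => //; case: #|_|.
Qed.

Lemma zero_lower_not_word x : zero_lower x -> word_lower x = false.
Proof.
move=> /andP[_ h]; apply/negP => /and3P[_ /letters0 l0 /lower_word_size hs].
case/orP: h => h; first by move: l0; rewrite -index_mem -/(first_zero x) h.
move: hs; have := size_labels x; rewrite (eqP h); case: (labels x) => //=; lia.
Qed.

Lemma zero_lower_gap x (i : 'I_n) : zero_lower x -> (i <= first_zero x)%N -> i \notin tag x.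
Proof. by move=> /andP[/forallP h _]; apply: (implyP (h i)). Qed.

Lemma zero_lower_nonspecial x : zero_lower x -> (1 < #|~: tag x|)%N ->
  (first_zero x < size (behead (labels x)))%N.
Proof. by move=> /andP[_ /orP[]] // /eqP ->. Qed.

Lemma zero_lower_edge x : zero_lower x -> gaps_below (tag x) (first_zero_edge x) = first_zero x.
Proof.
move=> l1; apply: gaps_below_initial => [|i hi]; first by apply: ltnW; apply: first_zero_lt.
by apply: (zero_lower_gap l1); apply: ltnW.
Qed.

Lemma zero_lower_notin x : zero_lower x -> first_zero_edge x \notin tag x.
Proof. by move=> l1; apply: (zero_lower_gap l1). Qed.

Hypothesis m_gt0 : (0 < m)%N.

Lemma small_merge_zero_lower x : zero_lower x ->
  small m (merge_at (gaps_below (tag x) (first_zero_edge x)) (labels x)).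
Proof.
move=> l1; rewrite zero_lower_edge //.
have sl := size_labels_gap (zero_lower_notin l1).
have sm := labels_small n_gt0 x.
case: (ltnP 1 #|~: tag x|) => h; last first.
  have : (size (labels x) <= 1)%N by rewrite sl.
  rewrite /merge_at; case: (labels x) sm => [|a0 [|a1 a]] //=.
have h1 := zero_lower_nonspecial l1 h.
have h2 : ((first_zero x).+1 < size (labels x))%N.
  by move: h1; have [a0 ->] := labels_cons x.
rewrite merge_atE //; apply/(all_nthP 0%N) => i hi.
rewrite nth_merge_inner //.
have h0 : nth 0%N (labels x) (first_zero x).+1 = 0%N.
  have [a0 ->] := labels_cons x; rewrite /= nth_index // -index_mem //.
have bnd k : (nth 0%N (labels x) k < m)%N.
  case: (ltnP k (size (labels x))) => hk; first by apply: (allP sm); rewrite mem_nth.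
  by rewrite nth_default.
by case: ifP => _; [| rewrite h0 addn0; case: ifP].
Qed.

Lemma zero_lower_partner x : zero_lower x -> exists y, incident x y (first_zero_edge x).
Proof.
move=> l1; apply: incident_exists => //; first exact: zero_lower_notin.
exact: small_merge_zero_lower.
Qed.

Lemma initial_gapsP x (i : 'I_n) : initial_gaps x -> (i \notin tag x) = (i < #|~: tag x|)%N.
Proof. by move=> /forallP/(_ i)/eqP. Qed.

(** If [e] is another edge, then the edge of [x] lies in [y]; so the gaps of [y] are not initial,
    and the first zero of [y] comes before that of [x]. A merge beyond position [first_zero x] would
    keep this zero in [z], whose letters behind the head are nonzero up to that position. A merge
    exactly there is settled by the comparison of moments. *)
Lemma zero_lower_incident x y z e : zero_lower x -> lower y ->
  incident x z (first_zero_edge x) -> incident y z e ->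
  (y = x /\ e = first_zero_edge x) \/ (moment (labels x) < moment (labels y))%N.
Proof.
move=> lx ly /incident_labels[kx tzx lzx] /incident_labels[ey tzy lzy].
set k := first_zero_edge x in kx tzx lzx *.
have slx := size_labels_gap kx; have sly := size_labels_gap ey.
have sxy : size (labels y) = size (labels x).
  by rewrite slx sly -(card_setCU1 kx) -(card_setCU1 ey) -tzx -tzy.
rewrite zero_lower_edge // in lzx.
have h0 : (1 < #|~: tag x|)%N -> ((first_zero x).+1 < size (labels x))%N /\
     nth 0%N (labels x) (first_zero x).+1 = 0%N.
  move=> h; have := zero_lower_nonspecial lx h; have [a0 ->] := labels_cons x => /=.
  by split=> //; rewrite nth_index // -index_mem.
have key r : r = first_zero x -> labels z = merge_at r (labels y) ->
    labels y = labels x \/ (moment (labels x) < moment (labels y))%N.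
  move=> -> lz; case: (ltnP 1 #|~: tag x|) => h.
    have [h1 h2] := h0 h.
    have h3 : ((first_zero x).+1 < size (labels y))%N by rewrite sxy.
    apply: (merge_inner_zero_unique h1 sxy h2).
    exact: etrans (esym (merge_atE h3)) (etrans (esym lz) (etrans lzx (merge_atE h1))).
  left; move: lz sxy; rewrite lzx /merge_at.
  by move: h; rewrite -slx; case: (labels x) (labels y) => [|a1 [|a2 a]] [|b1 [|b2 b]].
have [ek|ek] := eqVneq e k.
  have txy : tag y = tag x.
    by apply/setP => i; have := congr1 (fun s : {set _} => i \in s) tzy; rewrite tzx ek !inE;
      case: eqVneq => //= -> _; rewrite (negPf kx) -ek (negPf ey).
  rewrite ek txy -/k zero_lower_edge // in lzy.
  case: (key _ erefl lzy) => [E|]; last by right.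
  by left; split=> //; apply: labels_inj.
right.
have ky : k \in tag y by have := setU11 k (tag x); rewrite -tzx tzy !inE eq_sym (negPf ek).
have ex : e \in tag x by have := setU11 e (tag y); rewrite -tzy tzx !inE (negPf ek).
have gek : (first_zero x < e)%N by apply: contraTT ex; rewrite -leqNgt; apply: zero_lower_gap.
have gy i : (i < first_zero x)%N -> forall hi : (i < n)%N, Ordinal hi \notin tag y.
  move=> ik hi; have : Ordinal hi \notin tag z.
    by rewrite tzx !inE negb_or -val_eqE /= ltn_eqF //= zero_lower_gap // ltnW.
  by apply: contra; rewrite tzy !inE => ->; rewrite orbT.
case/orP: ly => ly; last first.
  case/and3P: ly => iy _ _; move: ey ky; rewrite initial_gapsP // => h.
  by rewrite -[_ \in _]negbK initial_gapsP // (ltn_trans gek h).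
have kyk : (first_zero y < first_zero x)%N.
  by rewrite ltnNge; apply: contraL ky => /(@zero_lower_gap y k ly).
have nsy : (1 < #|~: tag y|)%N.
  have z0 : Ordinal n_gt0 \notin tag y by apply: zero_lower_gap.
  rewrite (cardsD1 e) (cardsD1 (Ordinal n_gt0)) !inE ey z0.
  by rewrite -val_eqE /= (ltn_eqF (leq_ltn_trans _ gek)).
have nsx : (1 < #|~: tag x|)%N by rewrite -slx -sxy sly.
have [h1 h2] := h0 nsx.
have hy1 := zero_lower_nonspecial ly nsy.
have hy2 : nth 0%N (labels y) (first_zero y).+1 = 0%N.
  by have [a0 ->] := labels_cons y; rewrite /= nth_index // -index_mem.
have nz i : (0 < i <= first_zero x)%N -> nth 0%N (labels x) i != 0%N.
  case: i => // i /= hi; have [a0 ->] := labels_cons x => /=.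
  have := before_find 0%N hi => /= /negbT; apply: contra => /eqP ->; by [].
have nzz i : (0 < i <= first_zero x)%N -> nth 0%N (labels z) i != 0%N.
  move=> hi; rewrite lzx merge_atE // nth_merge_inner //.
  case: ltngtP => hk; [exact: nz | by case/andP: hi; lia |].
  by rewrite h2 addn0 -hk nz.
have ger : (first_zero x <= gaps_below (tag y) e)%N.
  have -> : first_zero x = gaps_below (tag y) (first_zero x).
    rewrite gaps_below_initial // => [|i hi]; first exact: ltnW (first_zero_lt x).
    have := gy i hi (ltn_ord i).
    by have -> : Ordinal (ltn_ord i) = i by apply: val_inj.
  by apply: leq_gaps_below; apply: ltnW.
have rlt : (gaps_below (tag y) e < size (labels y))%N by rewrite sly gaps_below_lt_card.
have szz : (first_zero x < size (labels z))%N.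
  by rewrite lzx size_merge_at ?slx //; move: h1; rewrite slx; lia.
have [E|E] := eqVneq (gaps_below (tag y) e) (first_zero x).
  case: (key _ E lzy) => // E'.
  have := nz (first_zero y).+1; rewrite -E' hy2 eqxx => /(_ _) h.
  by have := h; rewrite ltnS kyk => /(_ isT).
have := nzz (first_zero y).+1; rewrite ltnS kyk => /(_ isT).
rewrite lzy; case: (ltnP (gaps_below (tag y) e).+1 (size (labels y))) => hr.
  rewrite merge_atE // nth_merge_inner //.
  have -> : ((first_zero y).+1 < gaps_below (tag y) e)%N by lia.
  by rewrite hy2.
have : ((first_zero y).+1 < size (labels z))%N by apply: leq_ltn_trans szz.
move: hy2; rewrite lzy /merge_at (leq_gtF hr) /=.
case: (labels y) => [|a0 [|a1 a]] //=; rewrite size_belast ltnS => hn hs.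
move: hn; rewrite -[X in nth _ X _]/(a1 :: a) lastI nth_rcons size_belast hs => ->.
by [].
Qed.

End Matching.

Lemma merge_inner_insert0 r a : (r < size a)%N ->
  merge_inner r (take r.+1 a ++ 0%N :: drop r.+1 a) = a.
Proof.
elim: r a => [|r IH] [|x a] //=; first by rewrite take0 drop0 /= addn0.
by rewrite ltnS => /IH ->.
Qed.

Lemma index_insert0 r a : (r <= index 0%N a)%N -> index 0%N (take r a ++ 0%N :: drop r a) = r.
Proof.
elim: r a => [|r IH] [|x a] //=.
by case: eqP => //= _; rewrite ltnS => /IH ->.
Qed.

Section Tau.
Variables (m n : nat) (prec : rel 'I_n).
Hypotheses (m_gt0 : (0 < m)%N) (n_gt0 : (0 < n)%N) (precP : strict_linear_order prec).
Notation state := (state m n).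
Notation cochain := (cochain m n).
Notation fz_edge := (first_zero_edge n_gt0).
Implicit Types (x y z : state) (c : cochain) (e : 'I_n).

Lemma initial_gaps_inj x y : initial_gaps x -> initial_gaps y ->
  labels x = labels y -> #|~: tag x| = #|~: tag y| -> x = y.
Proof.
move=> ix iy lxy cxy; apply: labels_inj => //.
by apply/setP => i; apply: negb_inj; rewrite initial_gapsP // initial_gapsP // cxy.
Qed.

Lemma initial_gaps_intro x :
  (forall i : 'I_n, (i < #|~: tag x|)%N -> i \notin tag x) -> initial_gaps x.
Proof.
move=> h; have qn : (#|~: tag x| <= n)%N := card_gaps_le x.
have sub : [set i : 'I_n | (i < #|~: tag x|)%N] \subset ~: tag x.
  by apply/subsetP => i; rewrite !inE => /h.
have card : #|[set i : 'I_n | (i < #|~: tag x|)%N]| = #|~: tag x|.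
  rewrite -sum1_card (eq_bigl (fun i : 'I_n => i < #|~: tag x|)%N) => [|i]; last by rewrite inE.
  by rewrite -(big_ord_widen n (fun=> 1%N)) // sum_nat_const card_ord muln1.
have /eqP E : [set i : 'I_n | (i < #|~: tag x|)%N] == ~: tag x by rewrite eqEcard sub card leqnn.
by apply/forallP => i; have := congr1 (fun s : {set _} => i \in s) E; rewrite !inE => ->.
Qed.

Lemma card_gaps_setD1 (s : {set 'I_n}) e : e \in s -> #|~: (s :\ e)| = #|~: s|.+1.
Proof.
move=> es; have e0 : e \notin s :\ e by rewrite !inE eqxx.
by rewrite -(card_setCU1 e0) setD1K.
Qed.

(** Compare the least edge [f] with the first zero. If [f] does not come later, removing [f] and
    inserting a zero letter gives the lower partner. If the zero comes first, [x] itself is lower.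
    If there is no zero and [f] lies beyond the tail, the gaps are initial. *)
Lemma partner_or_critical x :
  [\/ zero_lower x, exists2 y, zero_lower y & incident y x (fz_edge y) |
      [/\ initial_gaps x, letters m (behead (labels x)) & (1 < #|~: tag x|)%N]].
Proof.
have sm := labels_small n_gt0 x; have sl := size_labels x.
pose z0 := Ordinal n_gt0.
have [q0|q_gt0] := posnP #|~: tag x|.
  have zx : z0 \in tag x by have := cards0_eq q0 => /setP/(_ z0); rewrite !inE => /negbFE.
  (* The cell without gap: its partner has the same one-letter word and edge 0 as its only gap. *)
  have c1 : #|~: (tag x :\ z0)| = 1%N by rewrite card_gaps_setD1 // q0.
  have [||y ty ly] := @state_of_labels m n n_gt0 (tag x :\ z0) (labels x) => //.
    by rewrite sl c1 q0.
  have fy : first_zero y = 0%N.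
    by rewrite /first_zero ly; move: sl; rewrite q0; case: (labels x) => [|a0 [|a1 a]].
  apply: Or32; exists y.
    rewrite /zero_lower fy ty c1 eqxx orbT andbT; apply/forallP => i; apply/implyP.
    rewrite leqn0 => /eqP i0; have -> : i = z0 by apply: val_inj.
    by rewrite !inE eqxx.
  have -> : fz_edge y = z0 by apply: val_inj.
  rewrite /incident ty ly !inE eqxx /= setD1K // eqxx /=.
  have -> : gaps_below (tag x :\ z0) 0 = 0%N by apply: gaps_below0.
  by move: sl; rewrite q0 /merge_at; case: (labels x) => [|a0 [|a1 a]].
have {}sl : size (labels x) = #|~: tag x| by rewrite sl; apply/maxn_idPr.
(* The least edge of [x], or [n] if [x] has none. *)
pose f : nat := find (fun i => i \in tag x) (enum 'I_n).
have fP (i : 'I_n) : (i < f)%N -> i \notin tag x.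
  by move=> hi; have := before_find i hi; rewrite nth_ord_enum => /negbT.
have [hfz|hzf] := leqP f (first_zero x).
  have fn : (f < n)%N := leq_ltn_trans hfz (first_zero_lt n_gt0 x).
  have fx : Ordinal fn \in tag x.
    have : has (fun i => i \in tag x) (enum 'I_n) by rewrite has_find size_enum_ord.
    move=> /(nth_find z0); rewrite -/f.
    have -> // : nth z0 (enum 'I_n) f = Ordinal fn.
    by apply: val_inj; rewrite /= nth_enum_ord.
  have fs : (f < size (labels x))%N.
    by have [a0 ->] := labels_cons x => /=; rewrite ltnS (leq_trans hfz) // index_size.
  have [||y ty ly] := @state_of_labels m n n_gt0 (tag x :\ Ordinal fn)
      (take f.+1 (labels x) ++ 0%N :: drop f.+1 (labels x)).
  - by rewrite card_gaps_setD1 // size_cat /= addnS -size_cat cat_take_drop sl; apply/esym/maxn_idPr.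
  - by rewrite /small all_cat /= m_gt0 -all_cat cat_take_drop.
  have fy : first_zero y = f.
    rewrite /first_zero ly; move: hfz; rewrite /first_zero.
    by have [a0 ->] := labels_cons x => /= /index_insert0.
  have ey : fz_edge y = Ordinal fn by apply: val_inj.
  have l1y : zero_lower y.
    rewrite /zero_lower fy; apply/andP; split.
      apply/forallP => i; apply/implyP; rewrite ty leq_eqVlt => /orP[/eqP e|/fP].
        have -> : i = Ordinal fn by apply: val_inj.
        by rewrite !inE eqxx.
      by apply: contra; rewrite !inE => /andP[].
    apply/orP; left; rewrite ly; move: fs.
    have [a0 ->] := labels_cons x => /= h.
    by rewrite size_cat /= addnS -size_cat cat_take_drop ltnS.
  apply: Or32; exists y => //.
  have := zero_lower_edge n_gt0 l1y; rewrite ey fy => gf.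
  rewrite /incident gf ly ty setD1K // eqxx !inE eqxx /=.
  rewrite merge_atE ?merge_inner_insert0 //.
  by rewrite size_cat /= addnS -size_cat cat_take_drop ltnS.
case: (boolP ((first_zero x < size (behead (labels x)))%N || (#|~: tag x| == 1%N))) => h.
  apply: Or31; rewrite /zero_lower h andbT; apply/forallP => i; apply/implyP => hi.
  by apply: fP; apply: leq_ltn_trans hi hzf.
move: h; rewrite negb_or -leqNgt => /andP[h1 h2].
apply: Or33; split; last by lia.
  apply: initial_gaps_intro => i hi; apply: fP; apply: leq_ltn_trans hzf.
  by apply: leq_trans h1; rewrite size_behead sl; lia.
have z : 0%N \notin behead (labels x) by rewrite -index_mem -leqNgt.
apply/allP => a ha; rewrite lt0n.
have -> : a != 0%N by apply: contraNneq z => <-.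
by apply: (allP sm); apply: mem_behead.
Qed.

Definition word_target x : seq nat := head 0%N (labels x) :: word_partner m (behead (labels x)).

(* The coefficient at the partner of x. For a lower word, the partner is not
   incident to x: it appears only after adding up the coefficients of all the
   cells with the same labels. *)
Definition probe x c : int :=
  if zero_lower x then \sum_(y | incident x y (fz_edge x)) c y
  else pairing prec (fun a => (a == word_target x)%:R) c.

Lemma probe_is_additive x : zmod_morphism (probe x).
Proof.
move=> c c'; rewrite /probe; case: ifP => _; last by rewrite raddfB.
by rewrite -sumrB; apply: eq_bigr => y _; rewrite !ffunE.
Qed.
HB.instance Definition _ x :=
  GRing.isZmodMorphism.Build cochain int (probe x) (probe_is_additive x).

Definition point x : cochain := [ffun y => (y == x)%:R].

Lemma pointE x y : point x y = (y == x)%:R.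
Proof. exact: ffunE. Qed.

Definition probe_sign x : int :=
  if zero_lower x then (-1) ^+ num_smaller prec (tag x) (fz_edge x)
  else gauge prec (tag x) * (-1) ^+ (partner_pos m (behead (labels x))).+1.

Lemma probe_sign_sq x : probe_sign x * probe_sign x = 1.
Proof.
rewrite /probe_sign; case: ifP => _; first by rewrite -expr2 sqrr_sign.
by rewrite mulrACA gauge_sq mul1r -expr2 sqrr_sign.
Qed.

Lemma word_target_small x : word_lower x -> small m (word_target x).
Proof.
move=> /and3P[_ lt low]; have := labels_small n_gt0 x.
rewrite /word_target; have [a0 E] := labels_cons x; rewrite E /= small_cons => /andP[ha _].
rewrite small_cons ha; apply/allP => a ha'.
by have := allP (letters_word_partner low lt) _ ha' => /andP[].
Qed.

Lemma diff_point x z : diff prec (point x) z =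
  \sum_(e | incident x z e) (-1) ^+ num_smaller prec (tag x) e.
Proof.
rewrite (diffE prec m_gt0 n_gt0) (bigD1 x) //= pointE eqxx mul1r [X in _ + X]big1 ?addr0 // => y yx.
by rewrite pointE (negPf yx) mul0r.
Qed.

(** Within each matching this is the comparison of moments for cells with a common target. A probe
    of the second kind vanishes on the lower cells of the first matching, since its word has no zero
    behind the head. *)
Lemma probe_triangular x y : lower x -> lower y ->
  (moment (labels y) <= moment (labels x))%N ->
  probe x (diff prec (point y)) = probe_sign x * (x == y)%:R.
Proof.
move=> lx ly hM; rewrite /probe /probe_sign; case: ifP => l1x.
  have [z xz] := zero_lower_partner n_gt0 m_gt0 l1x.
  rewrite (big_pred1 z) => [|z']; last first.
    by apply/idP/eqP => [/incident_inj|->] //; apply.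
  rewrite diff_point; case: (eqVneq x y) => [<-|xy].
    rewrite (big_pred1 (fz_edge x)) ?mulr1 // => e.
    apply/idP/eqP => [xe|-> //].
    by case: (zero_lower_incident m_gt0 l1x lx xz xe) => [[]|]; rewrite ?ltnn.
  rewrite mulr0 big1 // => e ye.
  case: (zero_lower_incident m_gt0 l1x ly xz ye) => [[E]|]; last by rewrite ltnNge hM.
  by rewrite E eqxx in xy.
have {lx}l2x : word_lower x by move: lx; rewrite /lower l1x.
rewrite pairing_diff //; last first.
  move=> a; case: eqP => // ->; by rewrite word_target_small.
rewrite (bigD1 y) //= [X in _ + X]big1 ?addr0; last first.
  by move=> z /negPf zy; rewrite pointE zy mul0r.
rewrite pointE eqxx mul1r.
have /and3P[ix ltx lowx] := l2x.
case l1y: (zero_lower y).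
  have -> : (x == y) = false by apply: contraFF l1x => /eqP ->.
  rewrite mulr0; case: (ltnP 1 #|~: tag y|) => q1; last first.
    have q1' : #|~: tag y| = 1%N.
      have zy : Ordinal n_gt0 \notin tag y by apply: (zero_lower_gap l1y).
      by apply/eqP; rewrite eqn_leq q1 card_gt0; apply/set0Pn; exists (Ordinal n_gt0); rewrite inE.
    rewrite q1' big_nat1 (_ : (_ == _) = false) ?mulr0 //.
    apply/eqP => E; have := congr1 size E; rewrite /word_target /=.
    have := size_labels y; rewrite q1' /merge_at /=.
    case: (labels y) => [|a0 [|a1 a]] //= _ [].
    case: (behead (labels x)) lowx => [|b0 [|b1 b]] //= _.
    by case: ifP.
  have := zero_lower_nonspecial l1y q1; rewrite /first_zero index_mem.
  have := size_labels_gap (zero_lower_notin n_gt0 l1y).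
  have [b0 Eb] := labels_cons y; rewrite Eb /= => <- z0.
  (* The two merges of a zero letter of [y] cancel only after the sum over all cells with the same
     word. *)
  rewrite (@alternating_sum_merge_zero (fun a => (a == word_target x)%:R)) ?mulr0 // => v u u0.
  rewrite (_ : (_ == _) = false) //; apply/eqP => -[_ E].
  by have := letters0 (letters_word_partner lowx ltx); rewrite -E u0.
have l2y : word_lower y by move: ly; rewrite /lower l1y.
have /and3P[iy lty lowy] := l2y.
have qy := card_gaps_word_lower l2y; have qx := card_gaps_word_lower l2x.
have key r : (r < #|~: tag y|)%N -> merge_at r (labels y) = word_target x ->
    y = x /\ r = (partner_pos m (behead (labels x))).+1.
  move: qy lty lowy hM; have [b0 Eb] := labels_cons y.
  have [a0 Ea] := labels_cons x => qy lty lowy hM.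
  rewrite qy Eb /word_target /= => hr E.
  rewrite Ea /= in E.
  case: (merge_at_lower lowx ltx lowy lty hr E) => [[E1 E2]|]; last first.
    by rewrite -Ea -Eb ltnNge hM.
  split=> //; apply: initial_gaps_inj => //; first by rewrite Ea Eb.
  by rewrite qx qy Ea Eb E1.
case: (eqVneq x y) => [E|xy]; last first.
  rewrite big_nat big1 ?mulr0 // => r /andP[_ hr].
  case: eqP => [/(key _ hr)[E _]|_]; last by rewrite mulr0.
  by rewrite E eqxx in xy.
rewrite mulr1 -E in key qy *; congr (_ * _).
have [E1 E2] := merge_word_partner lowx.
have hp : ((partner_pos m (behead (labels x))).+1 < #|~: tag x|)%N.
  by rewrite qx; have [a0 ->] := labels_cons x => /=; rewrite ltnS ltnW.
rewrite big_mkord (bigD1 (Ordinal hp)) //= big1 ?addr0 => [|r hr].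
  rewrite (_ : (_ == _) = true) ?mulr1 //; apply/eqP.
  rewrite merge_atE /word_target; last first.
    by have [a0 Ea] := labels_cons x; rewrite Ea /=.
  by have [a0 Ea] := labels_cons x; move: E1; rewrite Ea /= => ->.
case: eqP => [/(key _ (ltn_ord r))[_ E']|_]; last by rewrite mulr0.
by move: hr; rewrite -val_eqE /= E' eqxx.
Qed.
End Tau.

(** * From functionals on cochains to cohomology groups *)

Lemma quot_iso (V G : zmodType) (I : zmodClosed V) (f : {additive V -> G}) :
  (forall v, (v \in I) = (f v == 0)) -> (forall g, exists v, f v = g) ->
  zmod_iso (Quotient.quot I) G.
Proof.
move=> fI fsurj; pose Q := Quotient.quot I.
have fpi (v w : V) : (\pi_Q v = \pi_Q w)%qT <-> f v = f w.
  split=> [/eqP|E].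
    by rewrite -Quotient.idealrBE fI raddfB subr_eq0 => /eqP.
  by apply/eqP; rewrite -Quotient.idealrBE fI raddfB E subrr.
pose F0 (h : Q) := f (repr h).
have F0B : zmod_morphism F0.
  move=> h h'; rewrite /F0 -raddfB; apply/fpi.
  by rewrite reprK [RHS]raddfB /= !reprK.
pose F : {additive Q -> G} := HB.pack F0 (GRing.isZmodMorphism.Build _ _ F0 F0B).
exists F; have inj : injective F.
  by move=> h h' /fpi; rewrite !reprK.
have surj g : exists h, F h = g.
  by have [v <-] := fsurj g; exists (\pi_Q v)%qT; apply/fpi; rewrite reprK.
have [G1 HG] := choice surj.
by exists G1 => // h; apply: inj; rewrite HG.
Qed.

Section Cohomology.
Variables (m n : nat) (prec : rel 'I_n) (i j : nat).

(** The map is defined on all cochains, so that [gamma] and evaluations can be used directly; only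
    its restriction to cocycles matters. *)
Lemma cohomology_iso (G : zmodType) (f : {additive cochain m n -> G}) :
  (forall z, bihomogeneous i j z -> diff prec z = 0 ->
    f z = 0 <-> exists2 b : cochain m n,
      if i is i'.+1 then bihomogeneous i' j b else b == 0 & z = diff prec b) ->
  (forall g, exists z, [/\ bihomogeneous i j z, diff prec z = 0 & f z = g]) ->
  zmod_iso (cohomology m prec i j) G.
Proof.
move=> fker fsurj.
pose F0 (z : cocycle m prec i j) := f (val z).
have F0B : zmod_morphism F0 by move=> z z'; apply: (raddfB f).
pose F : {additive cocycle m prec i j -> G} := HB.pack F0 (GRing.isZmodMorphism.Build _ _ F0 F0B).
apply: (@quot_iso _ _ _ F) => [z|g].
  have /andP[hz /eqP dz] := valP z.
  apply/asboolP/eqP => h; first by apply/(fker _ hz dz).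
  by apply/(fker _ hz dz).
have [z [hz dz fz]] := fsurj g.
have cz : is_cocycle prec i j z by rewrite /is_cocycle hz dz eqxx.
by exists (exist _ z cz).
Qed.
End Cohomology.

Lemma sumn_merge_at r a : (r < size a)%N -> sumn (merge_at r a) = sumn a.
Proof.
move=> ra; rewrite /merge_at; case: ifP => _; first exact: sumn_merge_inner.
case: a ra => [|x [|y t]] //= _; rewrite -addnA; congr addn.
have := lastI y t => /(congr1 sumn) /=; rewrite -cats1 sumn_cat /= => ->; lia.
Qed.

(** * Normal forms modulo coboundaries *)

Section Morse.
Variables (m n : nat) (prec : rel 'I_n).
Hypotheses (m_gt0 : (0 < m)%N) (n_gt0 : (0 < n)%N) (precP : strict_linear_order prec).
Notation state := (state m n).
Notation cochain := (cochain m n).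
Notation d := (diff prec).
Notation test := (probe prec n_gt0).
Notation point := (@point m n).
Implicit Types (x y z : state) (c b : cochain) (i j : nat).

Definition bidegree i j x : bool := (#|tag x| == i) && (state_degree x == j).

Lemma bihomogeneousP i j c :
  reflect (forall x, c x != 0 -> bidegree i j x) (bihomogeneous i j c).
Proof. by apply: (iffP forallP) => h x; apply/implyP; apply: h. Qed.

Lemma card_gaps x : #|~: tag x| = (n - #|tag x|)%N.
Proof. by rewrite cardsCs setCK card_ord. Qed.

Lemma bihomogeneous_diff i j c : bihomogeneous i j c -> bihomogeneous i.+1 j (d c).
Proof.
move=> /bihomogeneousP hc; apply/bihomogeneousP => y.
rewrite (diffE prec m_gt0 n_gt0) => h.
have /existsP[x /andP[cx /existsP[e xy]]] :
    [exists x, (c x != 0) && [exists e, incident x y e]].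
  apply: contraNT h => /existsPn h; apply/eqP; apply: big1 => x _.
  have := h x; rewrite negb_and negbK => /orP[/eqP->|/existsPn hx]; first by rewrite mul0r.
  by rewrite big_pred0 ?mulr0 // => e; apply/negbTE.
have /andP[/eqP cx1 /eqP cx2] := hc x cx.
have [ex ty ly] := incident_labels xy.
rewrite /bidegree ty cardsU1 ex cx1 eqxx /= -cx2 -!sumn_labels // ly sumn_merge_at //.
by rewrite (size_labels_gap ex) gaps_below_lt_card.
Qed.

Definition lower_in i j x := lower x && bidegree i j x.

Lemma cochain_points c : c = \sum_x point x *~ c x.
Proof.
apply/ffunP => y; rewrite sum_ffunE (bigD1 y) //= big1 ?addr0 => [|x xy];
  rewrite ffunMzE pointE ?eqxx ?intz //.
by rewrite eq_sym (negPf xy) mul0rz.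
Qed.

Lemma probe_diff x c : test x (d c) = \sum_y test x (d (point y)) * c y.
Proof.
rewrite [in LHS](cochain_points c) !raddf_sum; apply: eq_bigr => y _.
by rewrite !raddfMz /= mulrzz.
Qed.

Lemma probe_diff_lower i j x c : (forall y, ~~ lower_in i j y -> c y = 0) ->
  test x (d c) = \sum_(y | lower_in i j y) test x (d (point y)) * c y.
Proof.
move=> h; rewrite probe_diff (bigID (lower_in i j)) /= [X in _ + X]big1 ?addr0 // => y hy.
by rewrite h ?mulr0.
Qed.

Lemma lower_in_triangular i j x y : lower_in i j x -> lower_in i j y ->
  (moment (labels y) <= moment (labels x))%N ->
  test x (d (point y)) = probe_sign prec n_gt0 x * (x == y)%:R.
Proof. by move=> /andP[lx _] /andP[ly _]; apply: probe_triangular. Qed.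

Lemma lower_supported_hom i j c : (forall y, ~~ lower_in i j y -> c y = 0) -> bihomogeneous i j c.
Proof.
move=> h; apply/bihomogeneousP => x cx.
by have : lower_in i j x by [apply: contraNT cx => /h ->]; case/andP.
Qed.

Lemma solve_lower i j (phi : state -> int) :
  exists b, (forall x, ~~ lower_in i j x -> b x = 0) /\
            (forall x, lower_in i j x -> test x (d b) = phi x).
Proof.
have [b hb] := triangular_surj (probe_sign_sq prec n_gt0) (@lower_in_triangular i j) phi.
exists [ffun x => if lower_in i j x then b x else 0]; split=> [x /negPf h|x Lx].
  by rewrite ffunE h.
rewrite (@probe_diff_lower i j) => [|y /negPf h]; last by rewrite ffunE h.
by rewrite -hb //; apply: eq_bigr => y Ly; rewrite ffunE Ly.
Qed.

Lemma lower_inj i j b : (forall x, ~~ lower_in i j x -> b x = 0) ->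
  (forall x, lower_in i j x -> test x (d b) = 0) -> b = 0.
Proof.
move=> b0 hb; apply/ffunP => x; rewrite ffunE.
case: (boolP (lower_in i j x)) => Lx; last exact: b0.
apply: (triangular_inj (probe_sign_sq prec n_gt0) (@lower_in_triangular i j) (b := b)) => // y Ly.
by rewrite -(probe_diff_lower y b0) hb.
Qed.

(** At least two gaps are required because the first matching already matches every cell with at
    most one gap. *)
Definition critical x :=
  [&& initial_gaps x, letters m (behead (labels x)), (1 < #|~: tag x|)%N &
      behead (labels x) == critical_word m (size (behead (labels x)))].

Lemma incident_bidegree i j x y e : incident x y e -> bidegree i.+1 j y -> bidegree i j x.
Proof.
move=> /incident_labels[ex ty ly] /andP[/eqP cy /eqP dy].
rewrite /bidegree -eqSS -cy ty cardsU1 ex eqxx /=.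
rewrite -dy -!sumn_labels // ly sumn_merge_at //.
by rewrite (size_labels_gap ex) gaps_below_lt_card.
Qed.

(** A vanishing probe of the first kind is the vanishing of [c] at one partner. After that, a probe
    of the second kind, a sum over all cells with a given word, retains only the cell with initial
    gaps. *)
Lemma normal_support i j c : bihomogeneous i.+1 j c ->
  (forall x, lower_in i j x -> test x c = 0) ->
  forall x, ~~ lower x -> ~~ critical x -> c x = 0.
Proof.
move=> /bihomogeneousP hc nc.
have partner0 x y : zero_lower y -> incident y x (first_zero_edge n_gt0 y) -> c x = 0.
  move=> ly yx; case: (eqVneq (c x) 0) => // /hc bx.
  have : test y c = 0.
    by apply: nc; rewrite /lower_in /lower ly (incident_bidegree yx bx).
  rewrite /probe ly (big_pred1 x) // => z.
  by apply/idP/eqP => [/incident_inj|->] //; apply.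
move=> x nlx ncx; case: (eqVneq (c x) 0) => // cx0; have bx := hc x cx0.
case: (partner_or_critical m_gt0 n_gt0 x) => [l1|[y ly yx]|[ix ltx qx]].
- by rewrite /lower l1 in nlx.
- exact: partner0 ly yx.
have [a0 Ea] := labels_cons x.
have slx : size (labels x) = #|~: tag x|.
  by rewrite size_labels; apply/maxn_idPr; apply: ltnW.
case: (word_cases ltx) => [low|crit|[b [lowb ltb sb eb]]].
- by rewrite /lower /word_lower ix ltx low orbT in nlx.
- by rewrite /critical ix ltx qx -crit eqxx in ncx.
have /andP[/eqP cx1 _] := bx.
have qn : (#|~: tag x| < n)%N.
  by rewrite card_gaps cx1; lia.
(* The lower cell has one letter more, so its gaps are the initial ones together with the next
   edge. *)
pose s := [set e : 'I_n | (#|~: tag x| < e)%N].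
have cs : forall e : 'I_n, (e \notin s) = (e < (#|~: tag x|).+1)%N.
  by move=> e; rewrite inE -leqNgt.
have qs : #|~: s| = (#|~: tag x|).+1.
  rewrite -sum1_card (eq_bigl (fun i : 'I_n => i < (#|~: tag x|).+1)%N) => [|e].
    by rewrite -(big_ord_widen n (fun=> 1%N)) // sum_nat_const card_ord muln1.
  by rewrite inE cs.
have small_b : small m (a0 :: b).
  have := labels_small n_gt0 x; rewrite Ea !small_cons => /andP[-> _] /=.
  by apply/allP => v /(allP ltb) /andP[].
have [||y ty ly] := @state_of_labels m n n_gt0 s (a0 :: b) => //.
  rewrite qs (maxn_idPr _) // -slx Ea /= sb //.
have l2y : word_lower y.
  rewrite /word_lower ly /= ltb lowb !andbT; apply/forallP => e.
  by rewrite ty qs cs eqxx.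
have by_ : bidegree i j y.
  move/andP: bx => [/eqP b1 /eqP b2].
  rewrite /bidegree -sumn_labels // -b2 -sumn_labels // ly Ea /= -(sumn_word_partner m b) eb eqxx andbT.
  have E : (#|s| + (n - i.+1).+1 = n)%N by rewrite -b1 -card_gaps -qs cardsC card_ord.
  have i_n : (i < n)%N by have := max_card (mem (tag x)); rewrite card_ord b1.
  by rewrite ty; apply/eqP; move: E i_n; move: #|s| => v; lia.
have : test y c = 0 by apply: nc; rewrite /lower_in /lower l2y orbT.
rewrite /probe; have -> : zero_lower y = false.
  by apply/negP => /(zero_lower_not_word n_gt0); rewrite l2y.
rewrite /pairing (bigD1 x) //= [X in _ + X]big1 ?addr0.
  rewrite /word_target ly /= eb -Ea eqxx mulr1 => /eqP.
  by rewrite mulf_eq0 (negPf (gauge_neq0 prec (tag x))) => /eqP.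
(* Another cell with the word of [x] is a partner in the first matching, where [c] vanishes, or has
   initial gaps and then equals [x]. *)
move=> z zx; case: eqP => [lz|_]; last by rewrite mulr0 mul0r.
have {}lz : labels z = labels x by rewrite lz /word_target ly /= eb -Ea.
case: (eqVneq (c z) 0) => [->|cz]; first by rewrite mulr0.
have /andP[/eqP bz1 _] := hc z cz.
case: (partner_or_critical m_gt0 n_gt0 z) => [l1|[w lw wz]|[iz _ _]].
- have := zero_lower_nonspecial l1; rewrite !card_gaps bz1 -cx1 -card_gaps qx => /(_ isT).
  by rewrite /first_zero index_mem lz (negPf (letters0 ltx)).
- by rewrite (partner0 _ _ lw wz) eqxx in cz.
case/eqP: zx; apply: initial_gaps_inj => //.
by rewrite !card_gaps bz1 cx1.
Qed.
End Morse.

Lemma size_critical_word m p : size (critical_word m p) = p.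
Proof. by elim/ltn_ind: p => [[|[|p]]] IH //=; rewrite IH. Qed.

Lemma sumn_critical_word m p : (0 < m)%N -> sumn (critical_word m p) = (p./2 * m + odd p)%N.
Proof.
by move=> m_gt0; elim/ltn_ind: p => [[|[|p]]] IH //=; rewrite IH // negbK mulSn; lia.
Qed.

Lemma letters_critical_word m p : (1 < m)%N -> letters m (critical_word m p).
Proof.
move=> m_gt1; elim/ltn_ind: p => [[|[|p]]] IH //=; rewrite /letters /= -?/(letters m _) ?IH //; lia.
Qed.

(** * The comparison map and the unmatched cells *)

Section Gamma.
Variables (m n : nat) (prec : rel 'I_n).
Hypotheses (m_gt0 : (0 < m)%N) (n_gt0 : (0 < n)%N) (precP : strict_linear_order prec).
Notation state := (state m n).
Notation cochain := (cochain m n).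
Notation d := (diff prec).
Notation test := (probe prec n_gt0).
Notation point := (@point m n).
Implicit Types (x y : state) (c b z : cochain) (i j : nat).

Definition gamma c : int := pairing prec (cyclic_weight m) c.
HB.instance Definition _ :=
  GRing.isZmodMorphism.Build cochain int gamma (pairing_is_additive prec (cyclic_weight m)).

Lemma gammaE c :
  gamma c = \sum_(x : state) gauge prec (tag x) * cyclic_weight m (labels x) * c x.
Proof. by []. Qed.

Lemma cyclic_weight_labels x : cyclic_weight m (labels x) = weight m (behead (labels x)).
Proof. by rewrite /cyclic_weight labels_small. Qed.

Lemma cyclic_weight_lower x : lower x -> (1 < #|~: tag x|)%N -> cyclic_weight m (labels x) = 0.
Proof.
rewrite cyclic_weight_labels => /orP[l1 q1|/and3P[_ ltx low] _]; last exact: weight_lower.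
have := zero_lower_nonspecial l1 q1; rewrite /first_zero index_mem => z.
have := labels_small n_gt0 x; have [a0 Ea] := labels_cons x; rewrite Ea small_cons => /andP[ha hb].
exact: (weight_eq0 ha hb).
Qed.

Lemma cyclic_weight_critical x : critical x -> cyclic_weight m (labels x) = 1.
Proof.
by rewrite cyclic_weight_labels => /and4P[_ _ _ /eqP ->]; rewrite weight_critical.
Qed.

Lemma size_labels_bidegree i j x : bidegree i j x -> (i < n)%N ->
  size (behead (labels x)) = (n - i.+1)%N.
Proof.
move=> /andP[/eqP bi _] i_n; rewrite size_behead size_labels card_gaps bi; lia.
Qed.

Lemma critical_bounds i j x : critical x -> bidegree i j x ->
  [/\ (i.+1 < n)%N, (1 < m)%N,
      labels x = (j - ((n - i.+1)./2 * m + odd (n - i.+1)))%N :: critical_word m (n - i.+1) &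
      ((n - i.+1)./2 * m + odd (n - i.+1) <= j < (n - i.+1)./2 * m + odd (n - i.+1) + m)%N].
Proof.
move=> /and4P[_ ltx qx /eqP cx] bx.
have i_n : (i.+1 < n)%N by move: qx; rewrite card_gaps; case/andP: bx => /eqP-> _; lia.
have sx := size_labels_bidegree bx (ltnW i_n).
rewrite sx in cx; have /andP[_ /eqP dx] := bx.
have := labels_small n_gt0 x; move: dx; rewrite -sumn_labels //.
have [a0 Ea] := labels_cons x; rewrite Ea /= cx sumn_critical_word // small_cons => dx /andP[ha _].
split=> //; last by lia.
  have : (0 < size (behead (labels x)))%N by rewrite sx; lia.
  by case: (behead _) ltx => //= v a /andP[hv _] _; lia.
by congr (_ :: _); lia.
Qed.

Lemma critical_uniq i j x y : critical x -> bidegree i j x ->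
  critical y -> bidegree i j y -> x = y.
Proof.
move=> cx bx cy by_; apply: initial_gaps_inj; first by case/and4P: cx.
- by case/and4P: cy.
- have [_ _ -> _] := critical_bounds cx bx.
  by have [_ _ -> _] := critical_bounds cy by_.
by case/andP: bx => /eqP bx _; case/andP: by_ => /eqP by_ _; rewrite !card_gaps bx by_.
Qed.

Lemma initial_gaps_exists (q : nat) (a : seq nat) : (0 < q <= n)%N -> size a = q -> small m a ->
  exists x : state, [/\ initial_gaps x, #|tag x| = (n - q)%N & labels x = a].
Proof.
move=> /andP[q_gt0 qn] sa sm.
pose s := [set e : 'I_n | (q <= e)%N].
have qs : #|~: s| = q.
  rewrite -sum1_card (eq_bigl (fun i : 'I_n => i < q)%N) => [|e].
    by rewrite -(big_ord_widen n (fun=> 1%N)) // sum_nat_const card_ord muln1.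
  by rewrite !inE -ltnNge.
have [||x tx lx] := @state_of_labels m n n_gt0 s a => //.
  by rewrite qs sa (maxn_idPr _).
exists x; split=> //.
  by apply/forallP => e; rewrite tx qs inE -ltnNge eqxx.
by have := card_gaps x; rewrite tx qs; have := max_card (mem s); rewrite card_ord; move: #|s| => v; lia.
Qed.

Lemma critical_exists i j : (i.+1 < n)%N -> (1 < m)%N ->
  ((n - i.+1)./2 * m + odd (n - i.+1) <= j < (n - i.+1)./2 * m + odd (n - i.+1) + m)%N ->
  exists2 x : state, critical x & bidegree i j x.
Proof.
move=> i_n m_gt1 hj; set p := (n - i.+1)%N in hj *.
have hp := sumn_critical_word p m_gt0; have lp := letters_critical_word p m_gt1.
have sp := size_critical_word m p.
have [|||x [ix tx lx]] := @initial_gaps_exists p.+1 ((j - (p./2 * m + odd p))%N :: critical_word m p).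
- by rewrite /p; lia.
- by rewrite /= sp.
- by rewrite small_cons; apply/andP; split; [lia | apply/allP => v /(allP lp) /andP[]].
exists x.
  rewrite /critical ix lx /= lp sp eqxx andbT card_gaps tx; rewrite /p; lia.
rewrite /bidegree tx -sumn_labels // lx /= hp.
by apply/andP; split; apply/eqP; [rewrite /p|]; lia.
Qed.

Lemma gamma_lower i j b : (i.+1 < n)%N -> (forall x, ~~ lower_in i j x -> b x = 0) -> gamma b = 0.
Proof.
move=> i_n hb; apply: big1 => x _; case: (boolP (lower_in i j x)) => [/andP[lx /andP[/eqP bx _]]|/hb ->].
  by rewrite cyclic_weight_lower ?mulr0 ?mul0r // card_gaps bx; lia.
by rewrite mulr0.
Qed.

(** Lower cells have weight 0 here, and a bidegree contains at most one critical cell. *)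
Lemma gamma_critical i j c x : bihomogeneous i j c ->
  (forall y, ~~ lower y -> ~~ critical y -> c y = 0) ->
  critical x -> bidegree i j x -> gamma c = gauge prec (tag x) * c x.
Proof.
move=> /bihomogeneousP hc sc cx bx; have [i_n _ _ _] := critical_bounds cx bx.
rewrite /gamma /pairing (bigD1 x) //= [X in _ + X]big1 ?addr0 => [|y yx].
  by rewrite cyclic_weight_critical // mulr1.
case: (eqVneq (c y) 0) => [->|/hc by_]; first by rewrite mulr0.
case: (boolP (lower y)) => ly.
  rewrite cyclic_weight_lower ?mulr0 ?mul0r //; case/andP: by_ => /eqP by_ _.
  by rewrite card_gaps by_; lia.
case: (boolP (critical y)) => cy; last by rewrite sc ?mulr0.
by rewrite (critical_uniq cy by_ cx bx) eqxx in yx.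
Qed.

Lemma gamma_small i j c : (i < n)%N -> bihomogeneous i j c ->
  (j < (n - i.+1)./2 * m + odd (n - i.+1))%N -> gamma c = 0.
Proof.
move=> i_n /bihomogeneousP hc hj; apply: big1 => x _.
case: (eqVneq (c x) 0) => [->|/hc bx]; first by rewrite mulr0.
case: (eqVneq (weight m (behead (labels x))) 0) => [E|/weight_neq0].
  by rewrite cyclic_weight_labels E mulr0 mul0r.
rewrite (size_labels_bidegree bx) // => h.
have /andP[_ /eqP] := bx; rewrite -sumn_labels //.
have [a0 ->] := labels_cons x; rewrite /= => E; move: h hj; rewrite -E; lia.
Qed.

Lemma gamma_diff_rec i j c : (i.+1 < n)%N -> bihomogeneous i j c -> forall k : int,
  (forall a0 t, small m (a0 :: t) -> size t = (n - i.+1)%N -> (a0 + sumn t)%N = j ->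
    \sum_(0 <= r < (size t).+1) (-1) ^+ r * cyclic_weight m (merge_at r (a0 :: t)) = k * weight m t) ->
  gamma (d c) = k * gamma c.
Proof.
move=> i_n /bihomogeneousP hc k hk; rewrite /gamma pairing_diff //; last first.
  by move=> a /negbTE; rewrite /cyclic_weight => ->.
rewrite /pairing mulr_sumr; apply: eq_bigr => x _.
case: (eqVneq (c x) 0) => [->|/hc bx]; first by rewrite mul0r !mulr0.
have st := size_labels_bidegree bx (ltnW i_n).
have /andP[/eqP bi /eqP] := bx; rewrite -sumn_labels // => bj.
have := labels_small n_gt0 x; rewrite cyclic_weight_labels.
have [a0 Ea] := labels_cons x; rewrite Ea in bj *; move=> sm.
have -> : #|~: tag x| = (size (behead (labels x))).+1 by rewrite card_gaps bi st; lia.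
by rewrite hk //; rewrite /=; ring.
Qed.

Lemma gamma_diff_odd i j c : (i.+1 < n)%N -> bihomogeneous i j c -> odd (n - i.+1) ->
  (j < (n - i.+1)./2.+1 * m)%N -> gamma (d c) = 0.
Proof.
move=> i_n hc op hj; rewrite (gamma_diff_rec i_n hc (k := 0)) ?mul0r // => a0 t sm st dt.
by rewrite mul0r sum_cyclic_weight_odd ?st ?dt.
Qed.

Lemma gamma_diff_even i j c : (i.+1 < n)%N -> bihomogeneous i j c -> ~~ odd (n - i.+1) ->
  (j <= (n - i.+1)./2 * m)%N -> gamma (d c) = m%:R * gamma c.
Proof.
move=> i_n hc op hj; rewrite (gamma_diff_rec i_n hc (k := m%:R)) // => a0 t sm st dt.
by rewrite sum_cyclic_weight_even ?st ?dt //; lia.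
Qed.

(** A critical cell in the target bidegree supplies the degree bound needed in either parity. *)
Lemma gamma_diff i j c x : bihomogeneous i j c -> critical x -> bidegree i.+1 j x ->
  gamma (d c) = (if odd (n - i.+1) then 0 else m%:R) * gamma c.
Proof.
move=> hc cx bx; have [i_n m_gt1 _ hj] := critical_bounds cx bx.
have E : (n - i.+1 = (n - i.+2).+1)%N by lia.
case: ifP => op.
  rewrite mul0r (@gamma_diff_odd i j) //; first exact: ltnW.
  by move: op hj; rewrite E /= => /negPf ->; rewrite uphalf_half; lia.
rewrite (@gamma_diff_even i j) ?op //; first exact: ltnW.
by move: op hj; rewrite E /= => /negbFE op; rewrite op uphalf_half op; lia.
Qed.

Lemma normalize i j c : bihomogeneous i.+1 j c ->
  exists b, (forall x, ~~ lower_in i j x -> b x = 0) /\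
            (forall x, lower_in i j x -> test x (c - d b) = 0).
Proof.
move=> hc; have [b [hb nb]] := solve_lower m_gt0 n_gt0 precP i j (fun x => test x c).
by exists b; split=> // x Lx; rewrite raddfB /= nb // subrr.
Qed.

(** In normal form only lower and critical cells carry values, and [gamma] reads off the critical
    one. What remains lives on lower cells, where the differential is injective. *)
Lemma normal_cocycle_eq0 i j c : bihomogeneous i.+1 j c ->
  (forall x, lower_in i j x -> test x c = 0) -> d c = 0 ->
  (forall x, critical x -> bidegree i.+1 j x -> gamma c = 0) -> c = 0.
Proof.
move=> hc nc dc gc; have sc := normal_support m_gt0 hc nc.
apply: (lower_inj (n_gt0 := n_gt0) m_gt0 precP (i := i.+1) (j := j)) => x; last by rewrite dc raddf0.
case: (eqVneq (c x) 0) => // cx0; have bx := bihomogeneousP _ _ _ hc x cx0.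
rewrite /lower_in bx andbT => lx; case: (boolP (critical x)) => cx; last by rewrite sc.
have := gc x cx bx; rewrite (gamma_critical hc sc cx bx) => /eqP.
by rewrite mulf_eq0 (negPf (gauge_neq0 prec (tag x))) => /eqP.
Qed.

Lemma bihomogeneousD i j c c' : bihomogeneous i j c -> bihomogeneous i j c' ->
  bihomogeneous i j (c + c').
Proof.
move=> hc hc'; rewrite -[c']opprK; apply: bihomogeneousB => //.
by rewrite -sub0r; apply: bihomogeneousB => //; apply: bihomogeneous0.
Qed.

(** The correction [b] that brings [z] into normal form lives on lower cells, where [gamma]
    vanishes; so [d b] has [gamma] 0 as well. *)
Lemma coboundary_of_gamma0 i j z : bihomogeneous i.+1 j z -> d z = 0 ->
  (forall x, critical x -> bidegree i.+1 j x -> gamma z = 0) ->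
  exists2 b, bihomogeneous i j b & z = d b.
Proof.
move=> hz dz gz; have [b [sb nb]] := normalize hz.
have hb := lower_supported_hom sb.
exists b => //; apply/eqP; rewrite -subr_eq0; apply/eqP.
apply: (normal_cocycle_eq0 _ nb) => [||x cx bx].
- by apply: bihomogeneousB => //; apply: bihomogeneous_diff.
- by rewrite raddfB /= dz diff_diff // subrr.
have [i_n _ _ _] := critical_bounds cx bx.
by rewrite raddfB /= (gz x) // (gamma_diff hb cx bx) (gamma_lower (ltnW i_n) sb) mulr0 subrr.
Qed.

(** The values at lower cells are solved for so that [d c] is in normal form. Being a cocycle
    itself, [d c] is 0 unless its [gamma] obstructs. *)
Lemma extend_cocycle i j c0 : bihomogeneous i j c0 ->
  (forall c, bihomogeneous i j c -> (forall x, ~~ lower x -> c x = c0 x) ->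
     forall y, critical y -> bidegree i.+1 j y -> gamma (d c) = 0) ->
  exists c, [/\ bihomogeneous i j c, d c = 0 & forall x, ~~ lower x -> c x = c0 x].
Proof.
move=> h0 hg; have [b [sb nb]] := solve_lower m_gt0 n_gt0 precP i j (fun x => - test x (d c0)).
have hb := lower_supported_hom sb.
have hc := bihomogeneousD h0 hb.
have E x : ~~ lower x -> (c0 + b) x = c0 x.
  by move=> lx; rewrite ffunE (sb x) ?addr0 // /lower_in (negPf lx).
exists (c0 + b); split=> //.
apply: (@normal_cocycle_eq0 i j); first exact: bihomogeneous_diff.
- by move=> x Lx; rewrite raddfD raddfD /= nb // subrr.
- exact: diff_diff.
- exact: hg.
Qed.
End Gamma.

Section Cyclic.
Variable m : nat.
Hypothesis m_gt0 : (0 < m)%N.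

Definition Zmod_gen : Zmod m := inZp 1.

Lemma Zmod_gen_mulrn k : Zmod_gen *+ k = inZp k.
Proof.
rewrite /Zmod_gen Zp_mulrn; apply: val_inj => /=.
by rewrite modnMml mul1n.
Qed.

Lemma Zmod_gen_eq0 (k : int) : (Zmod_gen *~ k == 0) = (m %| k)%Z.
Proof.
have H (a : nat) : (Zmod_gen *+ a == 0) = (m %| a)%N.
  by rewrite Zmod_gen_mulrn -val_eqE /= prednK.
case: k => a; first by rewrite /intmul H.
by rewrite NegzE mulrNz oppr_eq0 dvdzE abszN /= -H.
Qed.

Lemma Zmod_gen_surj (g : Zmod m) : exists k : int, Zmod_gen *~ k = g.
Proof.
by exists (Posz (g : 'I_(m.-1.+1))); rewrite -[LHS]/(Zmod_gen *+ _) Zmod_gen_mulrn valZpK.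
Qed.
End Cyclic.

Section Free.
Variables (m n : nat) (prec : rel 'I_n) (i j : nat) (Y : finType).
Variable F : Y -> {additive cochain m n -> int}.

Lemma cohomology_free :
  (forall z, bihomogeneous i j z -> diff prec z = 0 ->
    (forall y, F y z = 0) <-> exists2 b : cochain m n,
      if i is i'.+1 then bihomogeneous i' j b else b == 0 & z = diff prec b) ->
  (forall g : Y -> int, exists z, [/\ bihomogeneous i j z, diff prec z = 0 & forall y, F y z = g y]) ->
  zmod_iso (cohomology m prec i j) {ffun Y -> int}.
Proof.
move=> fker fsurj.
pose f0 (c : cochain m n) : {ffun Y -> int} := [ffun y => F y c].
have f0B : zmod_morphism f0 by move=> c c'; apply/ffunP => y; rewrite !ffunE raddfB.
pose f : {additive cochain m n -> {ffun Y -> int}} := HB.pack f0 (GRing.isZmodMorphism.Build _ _ f0 f0B).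
apply: (@cohomology_iso m n prec i j _ f) => [z hz dz|g].
  rewrite -fker //; split=> [/ffunP h y|h]; first by have := h y; rewrite !ffunE.
  by apply/ffunP => y; rewrite !ffunE.
have [z [hz dz fz]] := fsurj g.
by exists z; split=> //; apply/ffunP => y; rewrite ffunE.
Qed.
End Free.

(** * Cohomology in positive degree *)

Section Positive.
Variables (m n : nat) (prec : rel 'I_n).
Hypotheses (m_gt0 : (0 < m)%N) (n_gt0 : (0 < n)%N) (precP : strict_linear_order prec).
Notation state := (state m n).
Notation cochain := (cochain m n).
Notation d := (diff prec).
Notation gamma := (@gamma m n prec).
Implicit Types (x y : state) (c b z : cochain) (i j : nat).

Lemma gamma_point x k : critical x -> gamma (point x *~ (gauge prec (tag x) * k)) = k.
Proof.
move=> cx; rewrite raddfMz /= mulrzz gammaE (bigD1 x) //= [X in _ + X]big1 ?addr0.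
  by rewrite pointE eqxx mulr1 cyclic_weight_critical // mulr1 mulrA gauge_sq mul1r.
by move=> y /negPf yx; rewrite pointE yx mulr0.
Qed.

Lemma bihomogeneous_point i j x k : bidegree i j x -> bihomogeneous i j (point x *~ k).
Proof.
move=> bx; apply/bihomogeneousP => y; rewrite ffunMzE pointE.
by case: (eqVneq y x) => [-> _ | _ /eqP[]]; [exact: bx | exact: mul0rz].
Qed.

Lemma cohomology_trivial i j :
  (forall z, bihomogeneous i.+1 j z -> d z = 0 ->
    forall x, critical x -> bidegree i.+1 j x -> gamma z = 0) ->
  zmod_iso (cohomology m prec i.+1 j) {ffun 'I_0 -> int}.
Proof.
move=> gz; apply: (@cohomology_free _ _ _ _ _ _ (fun _ => gamma)) => [z hz dz|g].
  split=> [_|_ []//]; apply: (coboundary_of_gamma0 m_gt0 n_gt0 precP) => //.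
  exact: gz.
by exists 0; split=> [||[]//]; [apply: bihomogeneous0 | rewrite raddf0].
Qed.

(** The obstruction to extending the critical cell is 0 when [n - i.+2] is odd. When it is even, [j]
    lies above the internal degrees of the critical cells in the next cohomological degree. *)
Lemma cocycle_with_gamma i j x k : critical x -> bidegree i.+1 j x ->
  (odd (n - i.+2) \/ (n - i.+2)./2 * m < j)%N ->
  exists z, [/\ bihomogeneous i.+1 j z, d z = 0 & gamma z = k].
Proof.
move=> cx bx hj; pose c0 := point x *~ (gauge prec (tag x) * k).
have h0 : bihomogeneous i.+1 j c0 by apply: bihomogeneous_point.
have [c hc sc y cy by_|z [hz dz ez]] := extend_cocycle m_gt0 n_gt0 precP h0.
  rewrite (gamma_diff m_gt0 n_gt0 precP hc cy by_); case: ifP => op; first by rewrite mul0r.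
  case: hj => [|hj]; first by rewrite op.
  have [i_n _ _ hb] := critical_bounds m_gt0 n_gt0 cy by_.
  have E : (n - i.+2 = (n - i.+3).+1)%N by lia.
  move: hb hj op; rewrite E /= => hb hj /negbFE op; move: hb hj; rewrite op uphalf_half op; lia.
exists z; split=> //.
have nl : ~~ lower x.
  apply/negP => lx; have /and4P[_ _ qx _] := cx.
  have := cyclic_weight_lower n_gt0 lx qx.
  by rewrite (cyclic_weight_critical m_gt0 n_gt0 cx).
rewrite (gamma_critical prec m_gt0 n_gt0 hz _ cx bx) => [|y ly cy].
  by rewrite ez // ffunMzE pointE eqxx -mulrzr mul1r intz mulrA gauge_sq mul1r.
rewrite ez // ffunMzE pointE; case: eqP => [E|_]; last by rewrite mul0rz.
by rewrite E cx in cy.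
Qed.

Lemma cohomology_free1 i j x : critical x -> bidegree i.+1 j x ->
  (forall b, bihomogeneous i j b -> gamma (d b) = 0) ->
  (odd (n - i.+2) \/ (n - i.+2)./2 * m < j)%N ->
  zmod_iso (cohomology m prec i.+1 j) {ffun 'I_1 -> int}.
Proof.
move=> cx bx gb hj; apply: (@cohomology_free _ _ _ _ _ _ (fun _ => gamma)) => [z hz dz|g].
  split=> [/(_ ord0) gz|[b hb -> _]]; last exact: gb.
  exact: (coboundary_of_gamma0 m_gt0 n_gt0 precP).
have [z [hz dz gz]] := cocycle_with_gamma (g ord0) cx bx hj.
by exists z; split=> // y; rewrite (ord1 y).
Qed.

(** Here [j] is the top internal degree of the critical cells in cohomological degree [i.+1] and the
    bottom one in degree [i]. The coefficient between the two cells is m, and nothing leaves the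
    target. *)
Theorem cohomology_torsion i j : (i.+2 < n)%N -> odd (n - i.+2) ->
  j = ((n - i.+2)./2.+1 * m)%N -> zmod_iso (cohomology m prec i.+1 j) (Zmod m).
Proof.
move=> i_n op Ej.
have E : (n - i.+1 = (n - i.+2).+1)%N by lia.
have Eh : ((n - i.+1)./2 = (n - i.+2)./2.+1)%N.
  by rewrite E /= uphalf_half op.
have Eo : odd (n - i.+1) = false by rewrite E /= op.
pose f0 (c : cochain) : Zmod m := Zmod_gen m *~ gamma c.
have f0B : zmod_morphism f0 by move=> c c'; rewrite /f0 raddfB mulrzBr.
pose f : {additive cochain -> Zmod m} := HB.pack f0 (GRing.isZmodMorphism.Build _ _ f0 f0B).
have fE z : f z = 0 <-> (m %| gamma z)%Z.
  by rewrite -(Zmod_gen_eq0 m_gt0); apply: (rwP eqP).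
have gdb b : bihomogeneous i j b -> gamma (d b) = m%:R * gamma b.
  by move=> hb; rewrite (gamma_diff_even m_gt0 n_gt0 precP _ hb) ?Eo ?Eh ?Ej //; lia.
apply: (@cohomology_iso m n prec i.+1 j _ f) => [z hz dz|g].
  rewrite fE; split=> [/dvdzP[k gk]|[b hb ->]]; last first.
    by rewrite gdb // natz; apply/dvdzP; exists (gamma b); rewrite mulrC.
  (* For m = 1 there are no critical cells, and both groups are trivial. *)
  case: (ltnP 1 m) => m1.
    have [|y cy by_] := @critical_exists m n m_gt0 n_gt0 i j (ltnW i_n) m1.
      by rewrite Eo Eh Ej; lia.
    (* A multiple of the incoming critical cell whose differential has the same [gamma] as [z]; the
       gauge cancels the sign in [gamma]. *)
    pose b1 := point y *~ (gauge prec (tag y) * k).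
    have hb1 : bihomogeneous i j b1 by apply: bihomogeneous_point.
    have [||x cx bx|b2 hb2 E2] := @coboundary_of_gamma0 m n prec m_gt0 n_gt0 precP i j (z - d b1).
    - by apply: bihomogeneousB => //; apply: bihomogeneous_diff.
    - by rewrite raddfB /= dz diff_diff // subrr.
    - by rewrite raddfB /= gdb // gamma_point // gk natz mulrC subrr.
    exists (b1 + b2); first exact: bihomogeneousD.
    by rewrite raddfD /= -E2 addrC subrK.
  apply: (coboundary_of_gamma0 m_gt0 n_gt0 precP) => // x cx bx.
  by have [_ m_gt1 _ _] := critical_bounds m_gt0 n_gt0 cx bx; lia.
have [k <-] := Zmod_gen_surj g.
case: (ltnP 1 m) => m1; last first.
  exists 0; split; [exact: bihomogeneous0 | exact: raddf0 |].
  rewrite raddf0; apply/esym/eqP; rewrite (Zmod_gen_eq0 m_gt0).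
  by have -> : m = 1%N by lia.
have [|x cx bx] := @critical_exists m n m_gt0 n_gt0 i.+1 j i_n m1.
  by rewrite op Ej; lia.
have [z [hz dz gz]] := cocycle_with_gamma k cx bx (or_introl op).
by exists z; split=> //; rewrite /= /f0 gz.
Qed.

(** Apart from the torsion degrees, a critical cell neither receives nor emits a nonzero map, except
    at the bottom internal degree when [n - i.+2] is even. *)
Theorem cohomology_positive i j :
  ~ [/\ (i.+2 < n)%N, odd (n - i.+2) & j = ((n - i.+2)./2.+1 * m)%N] ->
  zmod_iso (cohomology m prec i.+1 j)
   {ffun 'I_((i.+2 < n) && ((n - i.+2)./2 * m < j < (n - i.+2)./2.+1 * m))%N -> int}.
Proof.
move=> nS.
have [x /andP[cx bx]|nocrit] := pickP (fun x : state => critical x && bidegree i.+1 j x); last first.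
  have -> : (((i.+2 < n) && ((n - i.+2)./2 * m < j < (n - i.+2)./2.+1 * m)) = false :> nat)%N.
    case: (boolP (_ && _)) => // /andP[i_n hj].
    have m1 : (1 < m)%N by lia.
    have hnS : odd (n - i.+2) -> j <> ((n - i.+2)./2.+1 * m)%N by move=> op Ej; apply: nS.
    have [|x cx bx] := @critical_exists m n m_gt0 n_gt0 i.+1 j i_n m1.
      by case: (odd _); lia.
    by have := nocrit x; rewrite cx bx.
  by apply: cohomology_trivial => z hz dz x cx bx; have := nocrit x; rewrite cx bx.
have [i_n m1 _ hj] := critical_bounds m_gt0 n_gt0 cx bx.
have E : (n - i.+1 = (n - i.+2).+1)%N by lia.
rewrite i_n /=; case: (boolP (odd (n - i.+2))) hj => op hj.
  have Eh : ((n - i.+1)./2 = (n - i.+2)./2.+1)%N by rewrite E /= uphalf_half op.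
  have Eo : odd (n - i.+1) = false by rewrite E /= op.
  have jlt : (j < (n - i.+2)./2.+1 * m)%N.
    have nE : j <> ((n - i.+2)./2.+1 * m)%N by move=> Ej; apply: nS.
    by lia.
  have -> : ((n - i.+2)./2 * m < j < (n - i.+2)./2.+1 * m)%N by lia.
  apply: (cohomology_free1 cx bx); last by left.
  move=> b hb; rewrite (gamma_diff_even m_gt0 n_gt0 precP (ltnW i_n) hb) ?Eo ?Eh //; last exact: ltnW.
  by rewrite (gamma_small prec m_gt0 n_gt0 _ hb) ?mulr0 ?Eo ?Eh ?addn0 //; lia.
case: (ltnP ((n - i.+2)./2 * m) j) => hj2.
  have -> : (j < (n - i.+2)./2.+1 * m)%N by lia.
  apply: (cohomology_free1 cx bx); last by right.
  move=> b hb; rewrite (gamma_diff_odd m_gt0 n_gt0 precP (ltnW i_n) hb) //; rewrite E //=.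
  by rewrite uphalf_half (negPf op); lia.
(* At this bottom degree the outgoing map is multiplication by m, which is injective, so a cocycle
   has [gamma] 0. *)
apply: cohomology_trivial => z hz dz y cy by_.
have := gamma_diff_even m_gt0 n_gt0 precP i_n hz op hj2.
by rewrite dz raddf0 => /esym/eqP; rewrite mulf_eq0 => /orP[|/eqP //]; lia.
Qed.
End Positive.

(** * Cohomology in degree zero *)

Section Zero.
Variables (m n : nat) (prec : rel 'I_n).
Hypotheses (m_gt0 : (0 < m)%N) (n_gt0 : (0 < n)%N) (precP : strict_linear_order prec).
Hypothesis n_gt1 : (1 < n)%N.
Notation state := (state m n).
Notation cochain := (cochain m n).
Notation d := (diff prec).
Notation gamma := (@gamma m n prec).
Implicit Types (x y : state) (c b z : cochain) (i j : nat).

(** The critical cell of cohomological degree 0 that is mapped by m to the one in degree 1: it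
    creates torsion there and carries no free parameter of a cocycle. *)
Definition torsion_cell j x := [&& odd n, j == (n./2 * m)%N & critical x].

Definition free_cell j x : bool := [&& ~~ lower x, bidegree 0 j x & ~~ torsion_cell j x].

Lemma half_pred : odd n -> ((n - 1)./2 = n./2)%N /\ odd (n - 1) = false.
Proof. by case: n => // k /=; rewrite subn1 /= uphalf_half => /negbTE ->. Qed.

Lemma gamma_cocycle_top j z : bihomogeneous 0 j z -> d z = 0 -> odd n -> j = (n./2 * m)%N ->
  gamma z = 0.
Proof.
move=> hz dz on ej; have [h1 h2] := half_pred on.
have := @gamma_diff_even m n prec m_gt0 n_gt0 precP 0 j z n_gt1 hz.
rewrite h2 h1 ej => /(_ isT (leqnn _)); rewrite dz raddf0 => /esym/eqP.
by rewrite mulf_eq0 => /orP[|/eqP //]; lia.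
Qed.

Lemma critical_nonlower x : critical x -> ~~ lower x.
Proof.
move=> cx; apply/negP => lx; have /and4P[_ _ qx _] := cx.
by have := cyclic_weight_lower n_gt0 lx qx; rewrite (cyclic_weight_critical m_gt0 n_gt0 cx).
Qed.

Lemma cocycle_eq0 j z : bihomogeneous 0 j z -> d z = 0 ->
  (forall x, free_cell j x -> z x = 0) -> z = 0.
Proof.
move=> hz dz fz.
have zz x : ~~ lower x -> ~~ torsion_cell j x -> z x = 0.
  move=> lx tx; case: (eqVneq (z x) 0) => // zx; apply: fz.
  by rewrite /free_cell lx tx (bihomogeneousP _ _ _ hz).
apply: (lower_inj (n_gt0 := n_gt0) m_gt0 precP (i := 0%N) (j := j)) => x; last by rewrite dz raddf0.
case: (eqVneq (z x) 0) => // zx; have bx := bihomogeneousP _ _ _ hz x zx.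
rewrite /lower_in bx andbT => lx.
case: (boolP (torsion_cell j x)) => tx; last exact: zz.
have /and3P[on /eqP ej cx] := tx.
have := gamma_cocycle_top hz dz on ej.
rewrite (gamma_critical prec m_gt0 n_gt0 hz _ cx bx) => [/eqP|y ly cy].
  by rewrite mulf_eq0 (negPf (gauge_neq0 prec (tag x))) => /eqP.
by apply: zz => //; apply: contra cy => /and3P[].
Qed.

Lemma gamma_eq_nonlower j c c' : bihomogeneous 0 j c -> bihomogeneous 0 j c' ->
  (forall x, ~~ lower x -> c x = c' x) -> gamma c = gamma c'.
Proof.
move=> hc hc' e; apply/eqP; rewrite -subr_eq0 -raddfB /=; apply/eqP.
apply: (@gamma_lower m n prec m_gt0 n_gt0 0 j) => // x.
rewrite !ffunE; case: (boolP (lower x)) => lx; last by rewrite e // subrr.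
rewrite /lower_in lx /= => bx.
have h c1 : bihomogeneous 0 j c1 -> c1 x = 0.
  by move/bihomogeneousP => h; case: (eqVneq (c1 x) 0) => // /h; rewrite (negPf bx).
by rewrite !h // subrr.
Qed.

Definition evaluation x (c : cochain) : int := c x.

Lemma evaluation_is_additive x : zmod_morphism (evaluation x).
Proof. by move=> c c'; rewrite /evaluation !ffunE. Qed.
HB.instance Definition _ x :=
  GRing.isZmodMorphism.Build cochain int (evaluation x) (evaluation_is_additive x).

(** No coboundaries occur in degree 0. A cocycle is determined by its values at the cells that are
    not lower, and these are arbitrary, except that the value at a torsion cell is forced by
    [gamma z = 0]. *)
Theorem cohomology_zero j :
  zmod_iso (cohomology m prec 0 j) {ffun {x | free_cell j x} -> int}.
Proof.
apply: (@cohomology_free _ _ _ _ _ _ (fun y : {x | free_cell j x} => evaluation (val y))) => [z hz dz|g].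
  split=> [fz|[b /eqP -> ->] y]; last by rewrite !raddf0.
  exists 0 => //; rewrite raddf0; apply: (cocycle_eq0 hz dz) => x fx.
  exact: (fz (exist _ x fx)).
pose c1 : cochain := [ffun x => if insub x is Some y then g y else 0].
have h1 : bihomogeneous 0 j c1.
  apply/bihomogeneousP => x; rewrite ffunE; case: insubP => [y fx _ _|]; last by rewrite eqxx.
  by case/and3P: fx.
pose ts x := torsion_cell j x && bidegree 0 j x.
(* The value at the torsion cell is adjusted to make [gamma] vanish, which removes the obstruction
   to extension. *)
pose c0 := if [pick x | ts x] is Some x then c1 - point x *~ (gauge prec (tag x) * gamma c1) else c1.
have h0 : bihomogeneous 0 j c0.
  rewrite /c0; case: pickP => // x /andP[_ bx].
  by apply: bihomogeneousB => //; apply: bihomogeneous_point.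
have e0 x (fx : free_cell j x) : c0 x = g (exist _ x fx).
  have e1 : c1 x = g (exist _ x fx).
    rewrite ffunE; case: insubP => [y _ ey|/negP //].
    by congr g; apply: val_inj.
  rewrite /c0; case: pickP => // x' /andP[tx' _]; rewrite !ffunE ffunMzE pointE.
  case: (eqVneq x x') => [E|_]; last by rewrite mul0rz subr0 -e1 ffunE.
  by exfalso; have /and3P[_ _] := fx; rewrite E tx'.
have [c hc sc y cy by_|z [hz dz ez]] := extend_cocycle m_gt0 n_gt0 precP h0.
  rewrite (gamma_diff m_gt0 n_gt0 precP hc cy by_); case: ifP => op; first by rewrite mul0r.
  have [i_n m1 _ hb] := critical_bounds m_gt0 n_gt0 cy by_.
  have E : (n - 1 = (n - 2).+1)%N by lia.
  have on : odd n by move: op; rewrite -{2}(subnK n_gt0) addn1 /= => ->.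
  have [hh ho] := half_pred on.
  have hj : (j <= n./2 * m)%N.
    by move: hb ho hh; rewrite E /= => hb /negbFE ho; rewrite uphalf_half ho; move: hb; rewrite ho; lia.
  case: (ltngtP j (n./2 * m)%N) hj => // hj _.
    by rewrite (gamma_small prec m_gt0 n_gt0 _ hc) ?mulr0 // hh ho addn0.
  rewrite (gamma_eq_nonlower hc h0 sc).
  have [|x cx bx] := @critical_exists m n m_gt0 n_gt0 0 j n_gt1 m1; first by rewrite hh ho hj; lia.
  rewrite /c0; case: pickP => [x' /andP[/and3P[_ _ cx'] _]|/(_ x)].
    by rewrite raddfB /= gamma_point // subrr mulr0.
  by rewrite /ts bx /torsion_cell on cx hj eqxx.
exists z; split=> // -[x fx] /=.
rewrite /evaluation ez ?e0 //; by case/and3P: fx.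
Qed.

Lemma card_free_cell j :
  (#|[pred x | free_cell j x]| + [&& odd n, j == n./2 * m & 1 < m] =
   #|[pred x : state | ~~ lower x && bidegree 0 j x]|)%N.
Proof.
rewrite -[RHS](cardID [pred x | ~~ torsion_cell j x]); congr addn.
  by apply: eq_card => x; rewrite !inE /free_cell andbA andbC.
case: (boolP [&& _, _ & _]) => [/and3P[on /eqP ej m1]|h].
  have [hh ho] := half_pred on.
  have [|x cx bx] := @critical_exists m n m_gt0 n_gt0 0 j n_gt1 m1; first by rewrite hh ho ej; lia.
  rewrite (@eq_card1 _ x) // => y; rewrite !inE negbK.
  apply/idP/eqP => [/and3P[/and3P[_ _ cy] _ by_]|->]; first exact: critical_uniq cy by_ cx bx.
  by rewrite /torsion_cell on ej eqxx cx -ej bx critical_nonlower.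
rewrite eq_card0 // => y; rewrite !inE negbK; apply/negP => /and3P[/and3P[on ej cy] _ by_].
by have [_ m1 _ _] := critical_bounds m_gt0 n_gt0 cy by_; case/negP: h; apply/and3P.
Qed.
End Zero.

(** * Generating functions of words *)

Lemma index_iota1_rcons m : (1 < m)%N -> index_iota 1 m = rcons (index_iota 1 m.-1) m.-1.
Proof.
case: m => [|[|k]] // _; rewrite /index_iota !subn1 /=.
by have := iotaD 1 k 1; rewrite addn1 add1n /= cats1.
Qed.

Section Words.
Variable m : nat.

Fixpoint words p : seq (seq nat) :=
  if p is p'.+1 then [seq x :: w | x <- index_iota 1 m, w <- words p'] else [:: [::]].

Lemma mem_words p w : (w \in words p) = (size w == p) && letters m w.
Proof.
elim: p w => [|p IH] w /=; first by rewrite inE; case: w.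
apply/allpairsP/idP => [[[x v] /= []]|].
  by rewrite mem_index_iota IH => hx /andP[/eqP sv lv] ->; rewrite /= sv eqxx /letters /= hx.
case: w => [|x v] // /andP[sv /andP[hx lv]].
by exists (x, v); rewrite mem_index_iota IH hx /=; split=> //; apply/andP.
Qed.

Lemma words_uniq p : uniq (words p).
Proof.
elim: p => [|p IH] //=; apply: allpairs_uniq => //; first exact: iota_uniq.
by move=> [x v] [y w] _ _ [-> ->].
Qed.

Definition letter_poly : {poly int} := \sum_(1 <= k < m) 'X^k.

Definition nonlower_poly p : {poly int} :=
  \sum_(w <- words p | ~~ lower_word m w) 'X^(sumn w).

Lemma words_poly p : \sum_(w <- words p) 'X^(sumn w) = letter_poly ^+ p :> {poly int}.
Proof.
elim: p => [|p IH]; first by rewrite /= big_seq1 expr0.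
rewrite /= [LHS]big_allpairs_dep exprS -IH big_distrl /=; apply: eq_bigr => x _.
by rewrite big_distrr /=; apply: eq_bigr => w _; rewrite -exprD.
Qed.

(** If the first letter exceeds 1, the rest is arbitrary. If it is 1, the second must be m-1, the
    pair having degree m, and the rest must again not be lower. *)
Lemma nonlower_poly_rec p : (1 < m)%N ->
  nonlower_poly p.+2 = (letter_poly - 'X) * letter_poly ^+ p.+1 + 'X^m * nonlower_poly p.
Proof.
move=> m_gt1; rewrite /nonlower_poly big_mkcond /= big_allpairs_dep big_ltn //= addrC.
congr (_ + _).
  have -> : letter_poly - 'X = \sum_(2 <= k < m) 'X^k.
    by rewrite /letter_poly big_ltn // addrAC expr1 subrr add0r.
  rewrite -words_poly big_distrl /=.
  rewrite !big_nat; apply: eq_bigr => x /andP[hx _].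
  rewrite big_distrr !big_allpairs_dep /=; apply: eq_bigr => y _; apply: eq_bigr => w _.
  by rewrite gtn_eqF //= -exprD.
rewrite big_allpairs_dep.
rewrite index_iota1_rcons //.
rewrite big_rcons /= [X in X + _]big_seq [X in X + _]big1 ?add0r => [|y]; last first.
  rewrite mem_index_iota => hy; rewrite big1 // => w _.
  by rewrite ltn_eqF //; lia.
rewrite [in RHS]big_mkcond big_distrr /=; apply: eq_bigr => w _.
rewrite eqxx /=; case: ifP => _; last by rewrite mulr0.
by rewrite -exprD; congr ('X^_); lia.
Qed.

Lemma letter_poly_shift : (0 < m)%N -> 'X * (1 + letter_poly) = letter_poly + 'X^m.
Proof.
move=> m_gt0; have -> : 1 + letter_poly = \sum_(0 <= k < m) 'X^k.
  by rewrite [RHS]big_ltn.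
rewrite big_distrr /=; under eq_bigr => k _ do rewrite -exprS.
by rewrite -(big_add1 _ _ 0 m.+1 predT (fun k => 'X^k)) big_nat_recr.
Qed.

(** The factor [1 + letter_poly] counts the head, which may be any of 0, ..., m-1. With it,
    [letter_poly_shift] gives the recursion a closed solution. *)
Lemma nonlower_poly_closed p : (1 < m)%N ->
  (1 + letter_poly) * nonlower_poly p =
  letter_poly ^+ p.+1 + 'X^(p./2 * m) * (if odd p then letter_poly else 1).
Proof.
move=> m_gt1; elim/ltn_ind: p => [[|[|p]]] IH.
- by rewrite /nonlower_poly /= big_cons big_nil /= !expr0 expr1; ring.
- have -> : nonlower_poly 1 = letter_poly.
    rewrite -[RHS]expr1 -words_poly /nonlower_poly big_mkcond; apply: eq_big_seq => w.
    by rewrite mem_words => /andP[/eqP]; case: w => [|x [|y w]].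
  by rewrite /= expr0 expr2; ring.
have E : ('X^(p.+2./2 * m) : {poly int}) = 'X^m * 'X^(p./2 * m) by rewrite -exprD mulSn.
rewrite nonlower_poly_rec // mulrDr mulrCA mulrA mulrCA IH // E.
rewrite -[odd p.+2]/(~~ ~~ odd p) negbK.
have H : (1 + letter_poly) * (letter_poly - 'X) = letter_poly ^+ 2 - 'X^m.
  by rewrite mulrBr [_ * 'X]mulrC (letter_poly_shift (ltnW m_gt1)); ring.
rewrite (exprS _ p.+2) (exprS _ p.+1).
transitivity (((1 + letter_poly) * (letter_poly - 'X)) * letter_poly ^+ p.+1 +
  'X^m * (letter_poly ^+ p.+1 + 'X^(p./2 * m) * (if odd p then letter_poly else 1))); first ring.
by rewrite H; ring.
Qed.
End Words.

Section Count.
Variables (m n : nat).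
Hypotheses (m_gt0 : (0 < m)%N) (n_gt1 : (1 < n)%N).

Lemma nonlower_set0 (x : state m n) : tag x = set0 ->
  ~~ lower x = letters m (behead (labels x)) && ~~ lower_word m (behead (labels x)).
Proof.
have n_gt0 := ltnW n_gt1.
move=> tx; have q : #|~: tag x| = n by rewrite tx setC0 cardsT card_ord.
have ix : initial_gaps x by apply/forallP => i; rewrite q tx inE ltn_ord.
have l1 : zero_lower x = (0%N \in behead (labels x)).
  rewrite /zero_lower q [n == _]gtn_eqF // orbF -index_mem -/(first_zero x).
  by rewrite (introT forallP) // => i; rewrite tx inE implybT.
have lt : letters m (behead (labels x)) = (0%N \notin behead (labels x)).
  apply/idP/idP => [|z]; first exact: letters0.
  apply/allP => a ha; rewrite lt0n.
  have -> : a != 0%N by apply: contraNneq z => <-.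
  by apply: (allP (labels_small n_gt0 x)); apply: mem_behead.
by rewrite /lower l1 /word_lower ix lt /= negb_or; case: (_ \in _).
Qed.

Lemma card_nonlower j :
  #|[pred x : state m n | ~~ lower x && bidegree 0 j x]|%:R =
  ((1 + letter_poly m) * nonlower_poly m (n - 1))`_j.
Proof.
have n_gt0 := ltnW n_gt1.
pose L := [seq a :: w | a <- index_iota 0 m, w <- [seq w <- words m (n - 1) | ~~ lower_word m w]].
have memL a : (a \in L) = (size a == n) && (small m a && (letters m (behead a) && ~~ lower_word m (behead a))).
  apply/allpairsP/idP => [[[x v] /= []]|].
    rewrite mem_index_iota mem_filter mem_words => /andP[_ hx] /and3P[lv /eqP sv ltv] -> /=.
    rewrite sv lv ltv small_cons hx subn1 prednK // eqxx /= andbT.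
    by apply/allP => u /(allP ltv) /andP[].
  case: a => [|x v]; first by rewrite /= eq_sym gtn_eqF.
  rewrite small_cons /= => /and4P[/eqP sv /andP[hx _] ltv lv].
  exists (x, v); rewrite mem_index_iota mem_filter mem_words hx ltv lv -sv /= subn1 eqxx.
  by [].
have uL : uniq L.
  apply: allpairs_uniq; [exact: iota_uniq | exact: filter_uniq (words_uniq _ _) |].
  by move=> [x v] [y w] _ _ [-> ->].
have -> : (1 + letter_poly m) * nonlower_poly m (n - 1) = \sum_(a <- L) 'X^(sumn a).
  have -> : 1 + letter_poly m = \sum_(0 <= k < m) 'X^k by rewrite [RHS]big_ltn.
  rewrite big_allpairs_dep big_distrl /=.
  apply: eq_bigr => x _; rewrite big_filter big_distrr /=.
  by apply: eq_bigr => w _; rewrite -exprD.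
rewrite coef_sum; under eq_bigr => a _ do rewrite coefXn.
rewrite -natr_sum; congr (_%:R).
set P := [pred x | _].
have -> : #|P| = size [seq a <- L | sumn a == j].
  rewrite cardE -(size_map (@labels m n)); apply: perm_size; apply: uniq_perm.
  - rewrite map_inj_in_uniq ?enum_uniq // => x y.
    rewrite !mem_enum !inE => /and3P[_ /eqP/cards0_eq tx _] /and3P[_ /eqP/cards0_eq ty _] E.
    by apply: labels_inj; rewrite ?tx ?ty.
  - exact: filter_uniq.
  move=> a; rewrite mem_filter memL; apply/mapP/idP => [[x]|/and3P[sa /eqP hsz]].
    rewrite mem_enum !inE => /and3P[lx /eqP/cards0_eq tx dx] ->.
    rewrite sumn_labels // dx size_labels tx setC0 cardsT card_ord (maxn_idPr _) // eqxx.
    by rewrite labels_small // -nonlower_set0.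
  move=> /andP[sm la].
  have [||x tx lx] := @state_of_labels m n n_gt0 set0 a => //.
    by rewrite setC0 cardsT card_ord (maxn_idPr _).
  exists x => //; rewrite mem_enum inE nonlower_set0 // lx la /bidegree tx cards0 eqxx.
  by rewrite -sumn_labels // lx.
rewrite size_filter -sum1_count big_mkcond /=; apply: eq_bigr => a _.
by rewrite eq_sym; case: eqP.
Qed.
End Count.

(** * Ranks and torsion *)

Lemma rank_unique (G : zmodType) r :
  (exists v : 'I_r -> G, Zindependent v) ->
  (forall r' (v : 'I_r' -> G), Zindependent v -> (r' <= r)%N) -> rank G = r.
Proof.
move=> ex ub; apply: classical_sets.xget_unique => // r' [[v vi] ub'].
have [w wi] := ex; apply/eqP; rewrite eqn_leq (ub _ v vi).
exact: (ub' _ w wi).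
Qed.

Lemma common_denominator r (u : 'I_r -> rat) :
  exists2 d : int, d != 0 & exists a : 'I_r -> int, forall i, (a i)%:~R = d%:~R * u i.
Proof.
exists (\prod_i denq (u i)); first by apply/prodf_neq0 => i _; apply: denq_neq0.
exists (fun i => numq (u i) * \prod_(k | k != i) denq (u k)) => i.
rewrite [in RHS](bigD1 i) //= !intrM -[X in _ = _ * X](divq_num_den (u i)).
by field; rewrite intr_eq0 denq_neq0.
Qed.

(** More vectors than coordinates satisfy a nontrivial relation over the rationals; clearing
    denominators makes it integral. *)
Lemma independent_ffun (Y : finType) r (w : 'I_r -> {ffun Y -> int}) :
  Zindependent w -> (r <= #|Y|)%N.
Proof.
move=> wi; rewrite leqNgt; apply/negP => rY.
pose A : 'M[rat]_(r, #|Y|) := \matrix_(i, k) (w i (enum_val k))%:~R.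
have kA : kermx A != 0.
  rewrite -mxrank_eq0 mxrank_ker subn_eq0 -ltnNge.
  exact: leq_ltn_trans (rank_leq_col A) rY.
have [i0 ki0] : exists i0, row i0 (kermx A) != 0.
  apply/existsP; apply: contraNT kA => /existsPn h; apply/eqP/row_matrixP => i.
  by rewrite row0; apply/eqP; have := h i; rewrite negbK.
pose u := row i0 (kermx A).
have uA : u *m A = 0 by apply/sub_kermxP; apply: row_sub.
have [d d0 [a ha]] := common_denominator (fun i => u 0 i).
have U y : \sum_i u 0 i * (w i y)%:~R = 0.
  have := congr1 (fun M : 'M_(1, _) => M 0 (enum_rank y)) uA.
  rewrite mxE [RHS]mxE => E; rewrite -[RHS]E; apply: eq_bigr => i _.
  by rewrite [A _ _]mxE enum_rankK.
have : \sum_i w i *~ a i = 0.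
  apply/ffunP => y; rewrite sum_ffunE [RHS]ffunE; apply: (@intr_inj rat).
  rewrite -[RHS](mulr0 d%:~R) -[X in _ = _ * X](U y) mulr_sumr (raddf_sum (intmul 1)).
  by apply: eq_bigr => i _; rewrite mulrA -ha -intrM ffunMzE mulrzz mulrC.
move/wi => a0; case/eqP: ki0; apply/rowP => i; rewrite [RHS]mxE.
have := ha i; rewrite a0 => /esym/eqP; rewrite mulf_eq0 intr_eq0 (negPf d0) /=.
by move/eqP.
Qed.

Lemma rank_free (G : zmodType) (Y : finType) : zmod_iso G {ffun Y -> int} -> rank G = #|Y|.
Proof.
case=> f [h fK hK]; have finj := can_inj fK.
apply: rank_unique => [|r v vi]; last first.
  apply: (@independent_ffun Y r (fun i => f (v i))) => a E; apply: vi; apply: finj.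
  rewrite raddf0 -E raddf_sum; apply: eq_bigr => i _; exact: raddfMz.
exists (fun i => h [ffun y => (y == enum_val i)%:R]) => a E i.
have := congr1 (fun x => f x (enum_val i)) E; rewrite raddf0 ffunE => <-.
rewrite raddf_sum sum_ffunE (bigD1 i) //= big1 ?addr0 => [|k ki].
  by rewrite raddfMz hK ffunMzE ffunE eqxx intz.
by rewrite raddfMz hK ffunMzE ffunE (inj_eq enum_val_inj) eq_sym (negPf ki) mul0rz.
Qed.

Lemma Zmod_mulrn m (m_gt0 : (0 < m)%N) (x : Zmod m) : x *+ m = 0.
Proof.
rewrite Zp_mulrn; apply: val_inj => /=.
by apply/eqP/dvdn_mull; rewrite prednK.
Qed.

Lemma iso_mulrn (G G' : zmodType) k : zmod_iso G G' -> (forall x : G', x *+ k = 0) ->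
  forall x : G, x *+ k = 0.
Proof.
by case=> f [h fK _] hk x; apply: (can_inj fK); rewrite raddfMn raddf0 hk.
Qed.

Lemma rank_torsion (G : zmodType) k : (0 < k)%N -> (forall x : G, x *+ k = 0) -> rank G = 0%N.
Proof.
move=> k0 hk; apply: rank_unique => [|r v vi]; first by exists (fun _ => 0) => a _ [].
case: r v vi => // r v vi.
have /vi/(_ ord0)/eqP : \sum_i v i *~ (Posz k) = 0 by apply: big1 => i _; exact: hk.
by rewrite -[_ == _]/(k == 0%N) gtn_eqF.
Qed.

Lemma free_torsionless (G : zmodType) (Y : finType) (x : G) k :
  zmod_iso G {ffun Y -> int} -> (0 < k)%N -> x *+ k = 0 -> x = 0.
Proof.
case=> f [h fK _] k0 hx; apply: (can_inj fK); rewrite raddf0; apply/ffunP => y.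
have := congr1 (fun z => f z y) hx; rewrite raddfMn raddf0 ffunMnE !ffunE => /eqP.
by rewrite mulrn_eq0 gtn_eqF //= => /eqP.
Qed.

(** * Assembling the torsion and the Poincaré polynomial *)

Section Final.
Variables (m n : nat) (prec : rel 'I_n).
Hypotheses (m_gt0 : (0 < m)%N) (precP : strict_linear_order prec) (n_gt2 : (2 < n)%N).
Let H := cohomology m prec.
Let n_gt1 : (1 < n)%N := ltnW n_gt2.
Let n_gt0 : (0 < n)%N := ltnW n_gt1.

Definition torsion_degree (i j : nat) : Prop :=
  exists k : nat, [/\ (1 <= k <= (n - 1)./2)%N, i = (n - 2 * k)%N & j = (k * m)%N].

Lemma torsion_degreeS i j : torsion_degree i.+1 j <->
  [/\ (i.+2 < n)%N, odd (n - i.+2) & j = ((n - i.+2)./2.+1 * m)%N].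
Proof.
split=> [[k [/andP[k1 k2] ei ej]]|[h1 h2 h3]].
  have E : (n - i.+2 = (2 * k).-1)%N by lia.
  have o : odd (n - i.+2) by rewrite E; lia.
  by split=> //; [lia | rewrite ej; congr muln; lia].
exists (n - i.+2)./2.+1; split=> //; lia.
Qed.

Lemma torsion_degree0 j : ~ torsion_degree 0 j.
Proof. by case=> k [/andP[k1 k2] e _]; lia. Qed.

Definition betti (i j : nat) : nat :=
  if i is i'.+1 then ((i'.+2 < n) && ((n - i'.+2)./2 * m < j < (n - i'.+2)./2.+1 * m))%N
  else #|[pred x : state m n | free_cell j x]|.

Lemma cohomology_torsion_degree i j : torsion_degree i j -> zmod_iso (H i j) (Zmod m).
Proof.
case: i => [/torsion_degree0 //|i /torsion_degreeS[h1 h2 h3]].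
exact: cohomology_torsion.
Qed.

Lemma cohomology_free_degree i j : ~ torsion_degree i j ->
  exists Y : finType, zmod_iso (H i j) {ffun Y -> int} /\ #|Y| = betti i j.
Proof.
case: i => [_|i nS].
  exists {x : state m n | free_cell j x}; split; first exact: cohomology_zero.
  by rewrite card_sig.
exists 'I_(betti i.+1 j); split; last exact: card_ord.
by apply: cohomology_positive => // h; apply: nS; apply/torsion_degreeS.
Qed.

Lemma rank_betti i j : rank (H i j) = betti i j.
Proof.
case: (pselect (torsion_degree i j)) => hS.
  rewrite (rank_torsion m_gt0 (iso_mulrn (cohomology_torsion_degree hS) (Zmod_mulrn m_gt0))).
  case: i hS => [/torsion_degree0 //|i /torsion_degreeS[h1 h2 h3]] /=.
  by rewrite h3 ltnn andbF andbF.
have [Y [iso <-]] := cohomology_free_degree hS.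
exact: rank_free.
Qed.

Lemma torsion_dsum : Tor_eq_dsum H torsion_degree.
Proof.
move=> h _; split=> [[k k0 hk] i j nS|h0].
  have [Y [iso _]] := cohomology_free_degree nS.
  exact: (free_torsionless iso k0 (hk i j)).
exists m => // i j; case: (pselect (torsion_degree i j)) => hS.
  exact: (iso_mulrn (cohomology_torsion_degree hS) (Zmod_mulrn m_gt0)).
by rewrite h0 // mul0rn.
Qed.

(** Indexed by the number p = n - 1 - i of letters behind the head, which treats both parities of n
    alike; p = 2k and p = 2k+1 share the power q^(km). *)
Definition bracket : {poly {poly int}} :=
  \sum_(1 <= p < n - 1) 'X^(n - 1 - p) * ('X^(p./2 * m))%:P.

Lemma coef_bracket i j :
  (((letter_poly m)%:P * bracket)`_i.+1)`_j = (betti i.+1 j)%:R.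
Proof.
rewrite coefCM coef_sum.
have -> : \sum_(1 <= p < n - 1) ('X^(n - 1 - p) * ('X^(p./2 * m))%:P : {poly {poly int}})`_i.+1 =
   (if (i.+2 < n)%N then 'X^((n - i.+2)./2 * m) else 0) :> {poly int}.
  under eq_bigr => p _ do rewrite coefMC coefXn.
  case: ifP => hi; last first.
    rewrite big_nat big1 // => p hp; rewrite (_ : (_ == _) = false) ?mul0r //; lia.
  have hin : (n - i.+2)%N \in index_iota 1 (n - 1) by rewrite mem_index_iota; lia.
  rewrite (bigD1_seq _ hin (iota_uniq _ _)) /=.
  rewrite big1_seq ?addr0 => [|p]; last first.
    rewrite mem_index_iota => /andP[pn hp].
    by rewrite (_ : (_ == _) = false) ?mul0r //; lia.
  by rewrite (_ : (_ == _) = true) ?mul1r //; lia.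
rewrite /betti; case: ifP => hi /=; last by rewrite mulr0 coef0.
rewrite coefMXn /letter_poly coef_sum.
case: ltnP => hj; first by rewrite (_ : (_ && _) = false) //; lia.
under eq_bigr => k _ do rewrite coefXn.
rewrite mulSn.
case: (boolP (_ && _)) => h.
  have hin : (j - (n - i.+2)./2 * m)%N \in index_iota 1 m by rewrite mem_index_iota; lia.
  rewrite (bigD1_seq _ hin (iota_uniq _ _)) /=.
  by rewrite eqxx big1_seq ?addr0 // => k /andP[/negPf]; rewrite eq_sym => ->.
rewrite big1_seq // => k; rewrite mem_index_iota => /= hk.
by rewrite (_ : (_ == _) = false) //; lia.
Qed.

Lemma coef_bracket0 : ((letter_poly m)%:P * bracket)`_0 = 0.
Proof.
rewrite coefCM coef_sum big1_seq ?mulr0 // => p; rewrite mem_index_iota => /= hp.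
by rewrite coefMC coefXn (_ : (_ == _) = false) ?mul0r //; lia.
Qed.

(** For odd n the second term of [nonlower_poly_closed] counts exactly the torsion cell and is
    removed with it. For even n it stays and is the additional summand. *)
Lemma coef_betti0 j :
  (letter_poly m ^+ n +
    (if odd n then 0 else 'X^((n - 1)./2 * m) * letter_poly m))`_j = (betti 0 j)%:R.
Proof.
have E := card_free_cell m_gt0 n_gt0 n_gt1 j; have C := card_nonlower m_gt0 n_gt1 j.
have -> : (betti 0 j)%:R = (betti 0 j + [&& odd n, j == n./2 * m & 1 < m])%N%:R
    - [&& odd n, j == n./2 * m & 1 < m]%N%:R :> int.
  by rewrite natrD addrK.
rewrite /betti E C; case: (ltnP 1 m) => m1; last first.
  have -> : letter_poly m = 0 by rewrite /letter_poly big_geq.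
  rewrite !andbF subr0 expr0n gtn_eqF // mulr0 if_same addr0 coef0 /nonlower_poly.
  rewrite subn1 -[n.-1]prednK; last by lia.
  by rewrite /= /index_iota (_ : (m - 1 = 0)%N) ?big_nil ?mulr0 ?coef0 //; lia.
have En : (n - 1).+1 = n by rewrite subn1 prednK.
rewrite nonlower_poly_closed // En /= andbT.
case: (boolP (odd n)) => on /=.
  have [-> ->] := half_pred on.
  by rewrite mulr1 addr0 coefD coefXn addrK.
have -> : odd (n - 1) by move: on; rewrite -{1}(subnK n_gt0) addn1 /= negbK.
by rewrite subr0.
Qed.

Lemma Poincare_betti : Poincare_polynomial H
  ((letter_poly m ^+ n + (if odd n then 0 else 'X^((n - 1)./2 * m) * letter_poly m))%:P
   + (letter_poly m)%:P * bracket).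
Proof.
move=> [|i] j; rewrite rank_betti coefD coefC /=.
  by rewrite coef_bracket0 addr0 coef_betti0.
by rewrite add0r coef_bracket.
Qed.
End Final.

Lemma sum_by_pairs (V : zmodType) (F : nat -> V) g : (0 < g)%N ->
  \sum_(1 <= p < 2 * g) F p = F 1%N + \sum_(1 <= i < g) (F (2 * i)%N + F (2 * i).+1).
Proof.
elim: g => // -[_ _|g IH _]; first by rewrite big_nat1 big_geq // addr0.
rewrite (_ : 2 * g.+2 = (2 * g.+1).+2)%N; last lia.
rewrite big_nat_recr /=; last lia.
rewrite big_nat_recr /=; last lia.
by rewrite IH // [in RHS]big_nat_recr //= -!addrA.
Qed.

Theorem corollary4p3 (m g n : nat) (prec : rel 'I_n) :
  (0 < m)%N -> (0 < g)%N -> strict_linear_order prec ->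
  let H := cohomology m prec in
  let t : {poly {poly int}} := 'X in
  let q : {poly {poly int}} := 'X%:P in
  let Q : {poly {poly int}} := \sum_(1 <= k < m) q ^+ k in
  let S := fun i j : nat =>
    exists k : nat, [/\ (1 <= k <= g)%N, i = (n - 2 * k)%N & j = (k * m)%N] in
  (n = (2 * g + 1)%N ->
    [/\ Tor_eq_dsum H S,
        forall i j, S i j -> zmod_iso (H i j) (Zmod m) &
        Poincare_polynomial H
          (Q ^+ n + Q * (t ^+ (n - 2) + \sum_(1 <= i < g)
             (t ^+ (n - 1 - 2 * i) + t ^+ (n - 2 - 2 * i)) * q ^+ (i * m)))])
  /\
  (n = (2 * g + 2)%N ->
    [/\ Tor_eq_dsum H S,
        forall i j, S i j -> zmod_iso (H i j) (Zmod m) &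
        Poincare_polynomial H
          (Q ^+ n + q ^+ (m * (n./2 - 1)) * Q
           + Q * (t ^+ (n - 2) + \sum_(1 <= i < g)
               (t ^+ (n - 1 - 2 * i) + t ^+ (n - 2 - 2 * i)) * q ^+ (i * m)
             + t * q ^+ (m * g)))]).
Proof.
move=> m_gt0 g_gt0 precP H t q Q S.
have QE : Q = (letter_poly m)%:P.
  by rewrite /Q /letter_poly rmorph_sum; apply: eq_bigr => k _; rewrite rmorphXn.
have qE k : q ^+ k = ('X^k)%:P by rewrite rmorphXn.
have parts : (2 < n)%N -> (n - 1)./2 = g ->
    Tor_eq_dsum H S /\ forall i j, S i j -> zmod_iso (H i j) (Zmod m).
  move=> n_gt2 ng; have SE : S = torsion_degree m n by rewrite /torsion_degree ng.
  rewrite SE; split; first exact: torsion_dsum.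
  by move=> i j; apply: cohomology_torsion_degree.
have pairs : (2 * g + 1 <= n)%N ->
    \sum_(1 <= p < 2 * g) 'X^(n - 1 - p) * ('X^(p./2 * m))%:P =
    t ^+ (n - 2) + \sum_(1 <= i < g)
      (t ^+ (n - 1 - 2 * i) + t ^+ (n - 2 - 2 * i)) * q ^+ (i * m).
  move=> n_ge; rewrite sum_by_pairs //; congr (_ + _).
    by rewrite /= mul0n expr0 polyC1 mulr1 -subnDA.
  apply: eq_bigr => i _; rewrite mulrDl qE -[((2 * i).+1)./2]/(uphalf (2 * i)).
  have -> : (uphalf (2 * i) = i)%N by lia.
  have -> : ((2 * i)./2 = i)%N by lia.
  by congr (_ + 'X^_ * _); lia.
split=> En.
  have n_gt2 : (2 < n)%N by lia.
  have ng : (n - 1)./2 = g by rewrite En; lia.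
  have [h1 h2] := parts n_gt2 ng; split=> //.
  have := Poincare_betti m_gt0 precP n_gt2.
  have -> : odd n by rewrite En; lia.
  rewrite addr0 /bracket (_ : index_iota 1 (n - 1) = index_iota 1 (2 * g)); last first.
    by congr (index_iota _ _); lia.
  by rewrite rmorphXn /= -QE pairs //; lia.
have n_gt2 : (2 < n)%N by lia.
have ng : (n - 1)./2 = g by rewrite En; lia.
have [h1 h2] := parts n_gt2 ng; split=> //.
have := Poincare_betti m_gt0 precP n_gt2.
have -> : odd n = false by rewrite En; lia.
rewrite /bracket (_ : index_iota 1 (n - 1) = index_iota 1 (2 * g).+1); last first.
  by congr (index_iota _ _); lia.
(* For even n the index p = 2g is left over by the pairing and gives the term t q^(mg). *)
rewrite big_nat_recr /=; last lia.
have -> : (n - 1 - 2 * g = 1)%N by lia.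
have -> : ((2 * g)./2 = g)%N by lia.
have -> : (m * (n./2 - 1) = g * m)%N by rewrite mulnC En; congr muln; lia.
rewrite !qE (mulnC m g) rmorphD rmorphM rmorphXn /= -QE.
by rewrite pairs ?ng ?expr1 //; lia.
Qed.
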